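(* Let $n\ge2$, let $f\in S$ and $F=\Psi_n(f)$. Let $\{f_t\}_{t\ge0}$ be a normalized Loewner chain on $\mathbb{D}$ with $f_0=f$ and let $F_t(z)=e^t\Psi_n(e^{-t}f_t)(z)$ for $z\in\mathbb{B}_n$, $t\ge0$. If $F$ is a support point of $\Psi_n(S)$, then $e^{-t}F_t$ is a support point of $\Psi_n(S)$ for all $t\ge0$.
   Context: $\mathbb{D}$ is the open unit disc and $S$ is the set of univalent (holomorphic and injective) functions $f:\mathbb{D}\to\mathbb{C}$ with $f(0)=0$, $f'(0)=1$. A normalized Loewner chain on $\mathbb{D}$ is a family $\{f_t\}_{t\ge0}$ of univalent functions on $\mathbb{D}$ such that $e^{-t}f_t\in S$ for all $t\ge0$, $f_s(\mathbb{D})\subseteq f_t(\mathbb{D})$ for $0\le s\le t$, and, for some $d\in[1,\infty]$, for every compact $K\subset\mathbb{D}$ and $T>0$ there is a non-negative $c_{K,T}\in L^d([0,T])$ with $|f_s(z)-f_t(z)|\le\int_s^tc_{K,T}(\tau)\,d\tau$ for all $z\in K$, $0\le s\le t\le T$. $\mathbb{B}_n$ is the Euclidean unit ball of $\mathbb{C}^n$ and $\mathcal{H}(\mathbb{B}_n,\mathbb{C}^n)$ the space of holomorphic maps $\mathbb{B}_n\to\mathbb{C}^n$ with the topology of locally uniform convergence. $\Psi_n$ is the Roper–Suffridge extension operator: for $f\in S$, $\Psi_n(f)(z_1,\dots,z_n)=\left(f(z_1),z_2\sqrt{f'(z_1)},\dots,z_n\sqrt{f'(z_1)}\right)$ on $\mathbb{B}_n$,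 with the branch of the square root such that $\sqrt1=1$. $\Psi_n(S)=\{\Psi_n(f):f\in S\}$. A support point of $E\subset\mathcal{H}(\mathbb{B}_n,\mathbb{C}^n)$ is an element $x\in E$ for which there is a continuous linear functional $L:\mathcal{H}(\mathbb{B}_n,\mathbb{C}^n)\to\mathbb{C}$ such that $\operatorname{Re}L$ is nonconstant on $E$ and $\operatorname{Re}L(x)=\max_{y\in E}\operatorname{Re}L(y)$. *)

(* Defs.v *)
From HB Require Import structures.
From mathcomp Require Import all_boot all_order all_algebra.
From mathcomp Require Export complex.
From mathcomp Require Import all_classical all_reals all_analysis.

Set Implicit Arguments.
Unset Strict Implicit.
Unset Printing Implicit Defensive.

Import Order.TTheory GRing.Theory Num.Theory.
Import numFieldNormedType.Exports.

Local Open Scope classical_set_scope.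
Local Open Scope ring_scope.
Local Open Scope complex_scope.

(* R[i] seen as a numClosedFieldType, so that the topology and the normed-module
   structure carried by every numeric field are inferred on it.  Its norm is
   valued in the field itself, and x <= y means Re x <= Re y and Im x = Im y. *)
Definition Cplx (R : realType) : numClosedFieldType := R[i].

Section OneVariable.
Variable R : realType.
Local Notation C := (Cplx R).

Definition unit_disc : set C := [set z | `|z| < 1].

(* Complex differentiability (over the field C) at every point of A;
   used for open A only. *)
Definition holomorphic_on (V W : normedModType C) (A : set V) (f : V -> W) :=
  forall z, A z -> differentiable f z.

Definition univalent (f : C -> C) : Prop :=
  holomorphic_on unit_disc f /\ set_inj unit_disc f.

(* Functions on the disc are total functions of which only the values on the
   disc are constrained. *)
Definition class_S : set (C -> C) :=
  [set f | [/\ univalent f, f 0 = 0 & derive1 f 0 = 1]].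

(* L^d([0,T]): extension by zero (f \_ D) belongs to L^d of the line. *)
Definition loewner_bound (d : \bar R) (f : R -> C -> C)
    (K : set C) (T : R) (c : R -> R) : Prop :=
  [/\ (c \_ `[0, T]) \in Lfun (@lebesgue_measure R) d,
      (forall x, 0 <= x <= T -> 0 <= c x) &
      forall (z : C) (s t : R), K z -> 0 <= s -> s <= t -> t <= T ->
        `|f s z - f t z| <=
          (\int[@lebesgue_measure R]_(x in `[s, t]) c x)%R%:C].

(* Only the times t >= 0 are constrained. *)
Definition normalized_loewner_chain (f : R -> C -> C) : Prop :=
  [/\ (forall t, 0 <= t -> univalent (f t)),
      (forall t, 0 <= t -> class_S ((expR (- t))%:C *: f t)),
      (forall s t, 0 <= s -> s <= t ->
         f s @` unit_disc `<=` f t @` unit_disc) &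
      exists2 d : \bar R, (1 <= d)%E &
        forall (K : set C) (T : R), compact K -> K `<=` unit_disc -> 0 < T ->
          exists c : R -> R, loewner_bound d f K T c].

(* The holomorphic square root h of g on the disc with h 0 = 1; it is unique on
   the disc, and exists when g is holomorphic without zeros there and g 0 = 1. *)
Definition sqrt_branch (g : C -> C) : C -> C :=
  get [set h : C -> C | [/\ holomorphic_on unit_disc h, h 0 = 1 &
                   forall z, unit_disc z -> h z ^+ 2 = g z]].

End OneVariable.

Section SeveralVariables.
Variables (R : realType) (n : nat).
Local Notation C := (Cplx R).
Local Notation Cn := ('rV[C]_n).

(* The library norm of 'rV_n is the maximum norm (with the same topology),
   hence the explicit Euclidean ball. *)
Definition unit_ball : set Cn := [set z | \sum_(j < n) `|z 0 j| ^+ 2 < 1].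

(* H(B_n, C^n): a map on the ball is represented by its extension by zero. *)
Definition holo_maps : set (Cn -> Cn) :=
  [set F | holomorphic_on unit_ball F /\ forall z, ~ unit_ball z -> F z = 0].

Definition compacts_of_ball : set (set Cn) :=
  [set K | compact K /\ K `<=` unit_ball].

(* All maps Cn -> Cn with uniform convergence on the compact subsets of the
   ball; the topology of H(B_n, C^n) is the one induced on holo_maps. *)
Definition compact_convergence :=
  {family compacts_of_ball, Cn -> Cn}.

(* L is only relevant on holo_maps. *)
Definition continuous_linear_functional (L : compact_convergence -> C) : Prop :=
  (forall (a : C) (F G : Cn -> Cn), holo_maps F -> holo_maps G ->
     L (a *: F + G) = a * L F + L G) /\
  {within (holo_maps : set compact_convergence), continuous L}.

Definition support_point (E : set (Cn -> Cn)) (F : Cn -> Cn) : Prop :=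
  E F /\ exists L : compact_convergence -> C,
    [/\ continuous_linear_functional L,
        (exists F1 F2, [/\ E F1, E F2 &
           complex.Re (L F1) <> complex.Re (L F2)]) &
        forall G, E G -> complex.Re (L G) <= complex.Re (L F)].

End SeveralVariables.

(* Roper-Suffridge operator in dimension n.+1; the first coordinate has index
   ord0. The value outside the ball is 0, as in holo_maps. *)
Definition roper_suffridge (R : realType) (n : nat) (f : Cplx R -> Cplx R) :
    'rV[Cplx R]_n.+1 -> 'rV[Cplx R]_n.+1 :=
  patch (fun=> 0) (@unit_ball R n.+1)
    (fun z => \row_j if j == ord0 then f (z 0 ord0)
                     else z 0 j * sqrt_branch (derive1 f) (z 0 ord0)).
Arguments roper_suffridge {R} n f _.

(* Main.v *)
(* Write f = e^t g o v with g = e^-t f_t and v = f_t^-1 o f a self-map of the disc, and let sg be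
   the square root of e^t v'.  By the Schwarz-Pick lemma V(z) = (v(z_1), e^-t sg(z_1) z') maps the
   ball into itself, and e^t Psi(h) o V = Psi(e^t h o v) for h in S.  So if Re L is maximal on
   Psi(S) at Psi(f), then the functional L' : H |-> L(e^t H o V) is continuous and Re L' is maximal
   on Psi(S) at Psi(g).

   If Re L' were constant on Psi(S), apply it to Psi of the primitive of (1 + e p)^2, for a
   polynomial p with p(0) = 0 and small complex e: this is a quadratic polynomial in e, so both
   coefficients vanish under L', and e = 1 may be substituted although the primitive need not be
   univalent any more.  Polynomials in v are dense, so for every h in S one can approximate
   sqrt(h')/sg by 1 + p o v, hence Psi(h) by e^t Psi(primitive of (1 + p)^2) o V, locally uniformly
   on the ball.  Then L is constant on Psi(S), a contradiction.

   Density of the polynomials in v replaces Runge's theorem: v is a composition of transition maps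
   phi of the chain over short time intervals.  Each phi'(0) is close to 1, so phi is close to the
   identity and has a holomorphic inverse on a disc which is larger than a given disc of radius
   r < 1, where the inverse has polynomial approximations.

   Cauchy's formula is obtained without integrals: the bisection argument of Goursat works for
   trapezoidal sums on dyadic grids, applied to the homotopy between a circle and a point, and
   the normalized integral over a circle is an ultrafilter limit of means over roots of unity. *)
Require Import Defs.
From mathcomp Require Import all_boot all_order all_algebra.
From mathcomp Require Import all_classical all_reals all_analysis.
From mathcomp Require Import ring lra.
Import Order.TTheory GRing.Theory Num.Theory.
Import numFieldNormedType.Exports.
Local Open Scope classical_set_scope.
Local Open Scope ring_scope.
Local Open Scope complex_scope.
Set Implicit Arguments.
Unset Strict Implicit.
Unset Printing Implicit Defensive.

(** * Modulus and complex derivative *)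

(** [Psi] is not linear, so constancy of [Re L'] on its image cannot be tested on a spanning set of
    functions. But [Psi f] is linear in the pair made of [f] and a root of [f']: prescribing the
    root as 1 + e p makes the function a polynomial in e. Complex values of e are taken because only
    real parts are known to be constant. The approximation is made at the level of the roots as
    well: two derivatives that are squares of close roots are close, and so are their normalized
    primitives. For the density, the required closeness of phi'(0) to 1 must not depend on phi. It
    depends on r alone: the Schwarz-Pick lemma, applied to phi(z)/z, bounds |phi(z) - z| on a fixed
    disc by an explicit multiple of 1 - phi'(0). By Schwarz's lemma transition maps do not increase
    moduli, so the same r serves for every step, and finitely many steps suffice because phi'(0) =
    e^(s-t) between the times s and t. *)

Section Modulus.
Variable R : realType.
Local Notation C := (Cplx R).

(** The library norm takes values in the complex field itself; a real-valued modulus makes estimates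
    accessible to [lra] and to Archimedean arguments. *)
Definition cmod (z : C) : R := complex.Re `|z|.

Lemma normE (z : C) : `|z| = (cmod z)%:C.
Proof. by rewrite /cmod normc_def. Qed.

Lemma cmod_ge0 z : 0 <= cmod z.
Proof. by rewrite /cmod normc_def /= sqrtr_ge0. Qed.

Lemma cmodM z w : cmod (z * w) = cmod z * cmod w.
Proof. by apply: complexI; rewrite rmorphM /= -!normE normrM. Qed.

Lemma cmod_realE (x : R) : cmod x%:C = `|x|.
Proof. by rewrite /cmod normc_def /= expr0n addr0 sqrtr_sqr. Qed.

Lemma cmod0 : cmod 0 = 0.
Proof. by rewrite (cmod_realE 0) normr0. Qed.

Lemma cmod1 : cmod 1 = 1.
Proof. by rewrite (cmod_realE 1) normr1. Qed.

Lemma cmod_eq0 z : (cmod z == 0) = (z == 0).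
Proof.
by rewrite -(normr_eq0 z) normE; apply/eqP/eqP => [->|/complexI].
Qed.

Lemma cmod_gt0 z : (0 < cmod z) = (z != 0).
Proof. by rewrite lt_def cmod_ge0 andbT cmod_eq0. Qed.

Lemma cmodN z : cmod (- z) = cmod z.
Proof. by rewrite /cmod normrN. Qed.

Lemma cmodB z w : cmod (z - w) = cmod (w - z).
Proof. by rewrite -cmodN opprB. Qed.

Lemma cmodD z w : cmod (z + w) <= cmod z + cmod w.
Proof. by rewrite -lecR rmorphD /= -!normE ler_normD. Qed.

Lemma cmodBD z w : cmod (z - w) <= cmod z + cmod w.
Proof. by rewrite (le_trans (cmodD _ _))// cmodN. Qed.

Lemma cmod_dist z w : cmod z - cmod w <= cmod (z - w).
Proof. by rewrite lerBlDr -{1}(subrK w z) cmodD. Qed.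

Lemma cmod_tri y x z : cmod (x - z) <= cmod (x - y) + cmod (y - z).
Proof. by rewrite -[x - z](subrKA y) cmodD. Qed.

Lemma cmodV z : cmod z^-1 = (cmod z)^-1.
Proof.
by apply: complexI; rewrite -normE normfV normE -fmorphV.
Qed.

Lemma cmodX z n : cmod (z ^+ n) = cmod z ^+ n.
Proof. by elim: n => [|n IH]; rewrite ?expr0 ?cmod1// !exprS cmodM IH. Qed.

Lemma cmod_nat n : cmod (n%:R) = n%:R.
Proof.
by have := cmod_realE n%:R; rewrite rmorph_nat => ->; rewrite normr_nat.
Qed.

Lemma cmod_sum I (r : seq I) (P : pred I) (F : I -> C) :
  cmod (\sum_(i <- r | P i) F i) <= \sum_(i <- r | P i) cmod (F i).
Proof.
elim/big_ind2: _ => [|x a y b hx hy|i _ //]; first by rewrite cmod0.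
by rewrite (le_trans (cmodD _ _))// lerD.
Qed.

Lemma cmod_Re z : `|complex.Re z| <= cmod z.
Proof. by rewrite -lecR -normE normc_ge_Re. Qed.

Lemma cmod_sqr z : cmod z ^+ 2 = complex.Re z ^+ 2 + complex.Im z ^+ 2.
Proof.
by rewrite /cmod normc_def /= sqr_sqrtr// addr_ge0// sqr_ge0.
Qed.

Lemma cmod_Im z : `|complex.Im z| <= cmod z.
Proof.
rewrite -(@ler_pXn2r _ 2)// ?nnegrE ?normr_ge0 ?cmod_ge0// cmod_sqr.
by rewrite real_normK ?num_real// lerDr sqr_ge0.
Qed.

Lemma cmod_ReIm z : cmod z <= `|complex.Re z| + `|complex.Im z|.
Proof.
rewrite -(@ler_pXn2r _ 2)// ?nnegrE ?addr_ge0 ?normr_ge0 ?cmod_ge0//.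
rewrite cmod_sqr sqrrD !real_normK ?num_real// addrAC lerDl.
by rewrite mulrn_wge0// mulr_ge0// normr_ge0.
Qed.

Lemma normC_ltP (z : C) (r : R) : (`|z| < r%:C) = (cmod z < r).
Proof. by rewrite normE ltcR. Qed.

Lemma unit_discE (z : C) : unit_disc z = is_true (cmod z < 1).
Proof. by rewrite /unit_disc /= -(normC_ltP z 1). Qed.

Lemma posCP (e : C) : 0 < e -> exists2 r : R, 0 < r & e = r%:C.
Proof.
move=> e0; exists (complex.Re e); last first.
  by rewrite RRe_real// realE ltW.
by move: e0; rewrite ltcE => /andP[].
Qed.

Lemma nbhsCP (z : C) (A : set C) :
  nbhs z A <-> exists2 e : R, 0 < e & forall w, cmod (w - z) < e -> A w.
Proof.
split=> [/nbhs_normP[e /= e0 eA]|[e e0 eA]].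
  have [r r0 er] := posCP e0; exists r => // w wz; apply: eA => /=.
  by rewrite er normC_ltP cmodB.
apply/nbhs_normP; exists e%:C => /=; first by rewrite ltcR.
by move=> w /=; rewrite normC_ltP cmodB; apply: eA.
Qed.

Lemma cvgCP T (F : set_system T) {FF : Filter F} (f : T -> C) (l : C) :
  f @ F --> l <-> forall e : R, 0 < e -> \forall x \near F, cmod (f x - l) < e.
Proof.
split=> [fl e e0|h].
  by apply: (fl [set w | cmod (w - l) < e]); apply/nbhsCP; exists e.
by move=> A /nbhsCP[e e0 eA]; apply: filterS (h e e0) => x; apply: eA.
Qed.

(** Without a quotient, the point [w = z] needs no exclusion, and composition and restriction to a
    neighbourhood are direct estimates. [derP] is the bridge to the library derivative. *)
Definition der (f : C -> C) (z d : C) := forall e : R, 0 < e ->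
  exists2 s : R, 0 < s & forall w, cmod (w - z) < s ->
    cmod (f w - f z - d * (w - z)) <= e * cmod (w - z).

Lemma derP (f : C -> C) (z d : C) : is_derive z (1 : C) f d <-> der f z d.
Proof.
split=> [[fd <-] e e0|h].
  have /cvgCP /(_ e e0) := fd.
  case/nbhsCP => s s0 hs; exists s => // w wz.
  have [->|wz0] := eqVneq w z; first by rewrite !subrr mulr0 subrr cmod0 mulr0.
  have h0 : w - z != 0 by rewrite subr_eq0.
  have := hs (w - z); rewrite /= subr0 => /(_ wz h0).
  rewrite /GRing.scale/= mulr1 subrK => /ltW.
  rewrite -(ler_pM2r (_ : 0 < cmod (w - z))) ?cmod_gt0// -cmodM mulrBl.
  by rewrite mulrAC mulVf// mul1r.
have cv : (fun h => h^-1 *: (f (h *: 1 + z) - f z)) @ 0^' --> d.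
  apply/cvgCP => e e0; have e20 : 0 < e / 2 by rewrite divr_gt0.
  have [s s0 hs] := h _ e20; apply/nbhsCP; exists s => // w.
  rewrite subr0 => ws w0; have := hs (w + z); rewrite addrK => /(_ ws).
  rewrite /GRing.scale/= mulr1 => wz.
  rewrite -(ltr_pM2r (_ : 0 < cmod w)) ?cmod_gt0// -cmodM mulrBl.
  rewrite mulrAC mulVf// mul1r (le_lt_trans wz)// ltr_pM2r ?cmod_gt0//.
  by rewrite ltr_pdivrMr// mulr_natr mulr2n ltrDl.
split; first by apply/cvg_ex; exists d.
exact: cvg_lim cv.
Qed.

Lemma differentiableCP (f : C -> C) (z : C) : differentiable f z <-> exists d, der f z d.
Proof.
rewrite -derivable1_diffP; split=> [/derivableP/derP h|[d /derP[]//]].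
by exists ('D_1 f z).
Qed.

Lemma derE f z d : der f z d -> derive1 f z = d.
Proof. by move=> /derP h; rewrite derive1E derive_val. Qed.

Lemma der_unique f z d d' : der f z d -> der f z d' -> d = d'.
Proof. by move=> /derE <- /derE <-. Qed.

Lemma der_near f g z d (r : R) : 0 < r ->
  (forall w, cmod (w - z) < r -> f w = g w) -> der f z d -> der g z d.
Proof.
move=> r0 fg h e e0; have [s s0 hs] := h e e0.
exists (Num.min s r); first by rewrite lt_min s0.
move=> w; rewrite lt_min => /andP[ws wr].
by rewrite -fg// -fg ?subrr ?cmod0//; apply: hs.
Qed.

Lemma der_cst c z : der (fun=> c) z 0.
Proof. by move=> e e0; exists 1 => // w _; rewrite mul0r !subrr cmod0 mulr_ge0 ?cmod_ge0 ?ltW. Qed.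

Lemma der_id z : der id z 1.
Proof. by move=> e e0; exists 1 => // w _; rewrite mul1r subrr cmod0 mulr_ge0 ?cmod_ge0 ?ltW. Qed.

Lemma derD f g z a b : der f z a -> der g z b -> der (fun w => f w + g w) z (a + b).
Proof. by move=> /derP hf /derP hg; apply/derP; apply: is_deriveD. Qed.

Lemma derN f z a : der f z a -> der (fun w => - f w) z (- a).
Proof. by move=> /derP hf; apply/derP; apply: is_deriveN. Qed.

Lemma derB f g z a b : der f z a -> der g z b -> der (fun w => f w - g w) z (a - b).
Proof. by move=> hf hg; apply: derD => //; apply: derN. Qed.

Lemma derM f g z a b : der f z a -> der g z b ->
  der (fun w => f w * g w) z (f z * b + g z * a).
Proof. by move=> /derP hf /derP hg; apply/derP; apply: is_deriveM. Qed.

Lemma derZ c f z a : der f z a -> der (fun w => c * f w) z (c * a).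
Proof.
by move=> h; have := derM (der_cst c z) h; rewrite mulr0 addr0.
Qed.

Lemma der_cont f z d : der f z d -> {for z, continuous f}.
Proof.
move=> h; apply: differentiable_continuous.
by apply/differentiableCP; exists d.
Qed.

Lemma contCP (f : C -> C) z : {for z, continuous f} <-> forall e : R, 0 < e ->
  exists2 s : R, 0 < s & forall w, cmod (w - z) < s -> cmod (f w - f z) < e.
Proof.
have H := @cvgCP _ (nbhs z) _ f (f z).
split=> [h e e0|h]; first by move/H : h => /(_ e e0)/nbhsCP.
by apply/H => e e0; apply/nbhsCP; apply: h.
Qed.

Lemma derV f z a : f z != 0 -> der f z a ->
  der (fun w => (f w)^-1) z (- a / f z ^+ 2).
Proof.
move=> fz0 /derP[hf hv]; apply/derP.
split; first exact: derivableV.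
by rewrite deriveV// hv /GRing.scale/= mulNr mulrC mulNr.
Qed.

Lemma der_comp f g z a b : der f z a -> der g (f z) b ->
  der (fun w => g (f w)) z (b * a).
Proof.
move=> hf hg e e0.
(* [K] is a local Lipschitz constant of [f] at [z]. The errors of [g] and of [f] contribute half of
   [e] each. *)
pose K := cmod a + 1; have K0 : 0 < K by rewrite ltr_pwDr ?cmod_ge0.
have e1 : 0 < e / 2 / K by rewrite !divr_gt0.
have e2 : 0 < Num.min 1 (e / 2 / (cmod b + 1)).
  by rewrite lt_min ltr01/= !divr_gt0// ltr_pwDr ?cmod_ge0.
have [s1 s10 h1] := hg _ e1; have [s2 s20 h2] := hf _ e2.
exists (Num.min s2 (s1 / K)); first by rewrite lt_min s20 divr_gt0.
move=> w; rewrite lt_min => /andP[ws2 ws1].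
have B := h2 w ws2; have wge := cmod_ge0 (w - z).
have B1 : cmod (f w - f z - a * (w - z)) <= cmod (w - z).
  apply: le_trans B _; rewrite -[leRHS]mul1r ler_wpM2r//.
  by rewrite ge_min lexx.
have B2 : cmod (f w - f z) <= K * cmod (w - z).
  rewrite -[f w - f z](subrK (a * (w - z))) (le_trans (cmodD _ _))//.
  by rewrite cmodM /K mulrDl mul1r addrC lerD2l.
have B3 : cmod (g (f w) - g (f z) - b * (f w - f z)) <= e / 2 / K * cmod (f w - f z).
  apply: h1; apply: le_lt_trans B2 _.
  by move: ws1; rewrite ltr_pdivlMr// mulrC.
have -> : g (f w) - g (f z) - b * a * (w - z) =
  (g (f w) - g (f z) - b * (f w - f z)) + b * (f w - f z - a * (w - z)) by ring.
apply: le_trans (cmodD _ _) _.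
have -> : e = e / 2 + e / 2 by lra.
rewrite mulrDl lerD//.
  apply: le_trans B3 _; apply: le_trans (ler_wpM2l (ltW e1) B2) _.
  by rewrite mulrA divfK// gt_eqF.
rewrite cmodM; apply: le_trans (ler_wpM2l (cmod_ge0 b) B) _.
rewrite mulrA ler_wpM2r//.
have b1 : 0 < cmod b + 1 by rewrite ltr_pwDr ?cmod_ge0.
apply: (@le_trans _ _ (cmod b * (e / 2 / (cmod b + 1)))).
  by rewrite ler_wpM2l ?cmod_ge0// ge_min lexx orbT.
rewrite mulrA ler_pdivrMr// mulrC ler_wpM2l//; last by rewrite lerDl.
by rewrite divr_ge0// ltW.
Qed.

Lemma der_poly (p : {poly C}) z : der (fun w => p.[w]) z p^`().[z].
Proof.
elim/poly_ind: p => [|p c IH].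
  rewrite deriv0 horner0 (_ : (fun _ => _) = fun=> 0); first exact: der_cst.
  by apply/funext => w; rewrite horner0.
have := derD (derM IH (der_id z)) (der_cst c z).
rewrite (_ : (fun _ => _ ) = fun w => (p * 'X + c%:P).[w]); last first.
  by apply/funext => w; rewrite !hornerE.
congr der; rewrite derivD derivC addr0 derivM derivX !hornerE /=.
by rewrite addrC mulrC [_ * z]mulrC.
Qed.

End Modulus.

(** * Goursat's theorem for trapezoidal sums *)

Section Bisection.
Variable R : realType.

Lemma exp2V_lt (d : R) : 0 < d -> exists n, 2 ^- n < d.
Proof.
move=> d0; exists (Num.bound d^-1).
rewrite -ltf_pV2 ?posrE ?invr_gt0 ?exprn_gt0// invrK.
apply: lt_trans (archi_boundP _) _; first by rewrite invr_ge0 ltW.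
by rewrite -natrX ltr_nat ltn_expl.
Qed.

Lemma nested_dyadic (a : nat -> R) :
  (forall n, a n <= a n.+1) ->
  (forall n, a n.+1 + 2 ^- n.+1 <= a n + 2 ^- n) ->
  exists c, forall n, a n <= c <= a n + 2 ^- n.
Proof.
move=> a_nd b_ni.
have nd m n : (m <= n)%N -> a m <= a n.
  by move=> /subnK <-; elim: (n - m)%N => // k /le_trans; apply.
have ni m n : (m <= n)%N -> a n + 2 ^- n <= a m + 2 ^- m.
  move=> /subnK <-; elim: (n - m)%N => // k; apply: le_trans.
  exact: b_ni.
have ab m n : a m <= a n + 2 ^- n.
  have := nd _ _ (leq_maxl m n); have := ni _ _ (leq_maxr m n).
  have : 0 <= 2 ^- maxn m n :> R by rewrite invr_ge0 exprn_ge0.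
  by lra.
exists (sup (range a)) => n; apply/andP; split.
  apply: ub_le_sup; last by exists n.
  by exists (a 0 + 2 ^- 0) => _ [m _ <-].
apply: ge_sup; first by exists (a 0), 0.
by move=> _ [m _ <-].
Qed.

(** An induction principle over squares: if the unit square were bad, some quarter would be bad, and
    so on. The bad squares shrink to a point, where the local hypothesis contradicts their
    badness. *)
Lemma square_bisection (P : R -> R -> R -> Prop) :
  (forall x y l, P x y (l / 2) -> P (x + l / 2) y (l / 2) ->
     P x (y + l / 2) (l / 2) -> P (x + l / 2) (y + l / 2) (l / 2) -> P x y l) ->
  (forall x0 y0, 0 <= x0 <= 1 -> 0 <= y0 <= 1 ->
     exists2 s, 0 < s & forall x y l, 0 < l < s ->
       0 <= x -> x + l <= 1 -> 0 <= y -> y + l <= 1 ->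
       x <= x0 <= x + l -> y <= y0 <= y + l -> P x y l) ->
  P 0 0 1.
Proof.
move=> Psplit Ploc; apply: contrapT => nP.
pose sub n (p q : R * R) := [/\ q.1 = p.1 \/ q.1 = p.1 + 2 ^- n / 2,
  q.2 = p.2 \/ q.2 = p.2 + 2 ^- n / 2 & ~ P q.1 q.2 (2 ^- n / 2)].
have subE n p : ~ P p.1 p.2 (2 ^- n) -> exists q, sub n p q.
  move=> np; apply: contrapT => nq; apply: np; apply: Psplit;
  apply: contrapT => h; apply: nq.
  - by exists p; split; [left|left|].
  - by exists (p.1 + 2 ^- n / 2, p.2); split; [right|left|].
  - by exists (p.1, p.2 + 2 ^- n / 2); split; [left|right|].
  - by exists (p.1 + 2 ^- n / 2, p.2 + 2 ^- n / 2); split; [right|right|].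
(* The default of [xget] is harmless: by [uP] every chosen square is bad, hence has a bad
   quarter. *)
pose u := fix u n : R * R :=
  if n is m.+1 then xget (0, 0) [set q | sub m (u m) q] else (0, 0).
have half n : 2 ^- n.+1 = 2 ^- n / 2 :> R by rewrite exprSr invfM.
have uP n : ~ P (u n).1 (u n).2 (2 ^- n) /\ sub n (u n) (u n.+1).
  have H k : ~ P (u k).1 (u k).2 (2 ^- k) -> sub k (u k) (u k.+1).
    by move=> /subE[q hq]; exact: (xgetPex (0, 0) (ex_intro _ q hq)).
  elim: n => [|n [_ [_ _ h]]]; first by rewrite expr0 invr1; split=> //; apply: H; rewrite expr0 invr1.
  by move: h; rewrite -half => h; split=> //; apply: H.
have l0 n : 0 < 2 ^- n :> R by rewrite invr_gt0 exprn_gt0.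
have [x0 hx] : exists c, forall n, (u n).1 <= c <= (u n).1 + 2 ^- n.
  apply: nested_dyadic => n; have [_ [h _ _]] := uP n; have := l0 n;
  case: h => ->; rewrite ?half; lra.
have [y0 hy] : exists c, forall n, (u n).2 <= c <= (u n).2 + 2 ^- n.
  apply: nested_dyadic => n; have [_ [_ h _]] := uP n; have := l0 n;
  case: h => ->; rewrite ?half; lra.
have u01 n : [/\ 0 <= (u n).1, (u n).1 + 2 ^- n <= 1, 0 <= (u n).2 & (u n).2 + 2 ^- n <= 1].
  elim: n => [|n [h1 h2 h3 h4]]; first by rewrite /= expr0 invr1; split; lra.
  have [_ [hx' hy' _]] := uP n; have := l0 n; rewrite half => l.
  by split; [case: hx'|case: hx'|case: hy'|case: hy'] => ->; lra.
have [||s s0 hs] := Ploc x0 y0.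
- by have := hx 0; rewrite /= expr0 invr1 add0r.
- by have := hy 0; rewrite /= expr0 invr1 add0r.
have [n ns] := exp2V_lt s0; have [[h _] [h1 h2 h3 h4]] := (uP n, u01 n).
by apply: h; apply: hs => //; rewrite l0 ns.
Qed.

End Bisection.

Section Goursat.
Variable R : realType.
Local Notation C := (Cplx R).
Implicit Types (g : C -> C) (p : R -> C).

Definition edge g (a b : C) := (g a + g b) / 2 * (b - a).

(* The trapezoidal rule is exact for affine [g], so that these sums can replace integrals in
   Goursat's bisection argument. *)
Definition trapz g (N : nat) p x l :=
  \sum_(i < N) edge g (p (x + l * (i%:R / N%:R))) (p (x + l * (i.+1%:R / N%:R))).

Lemma trapz_split g N p x l : (0 < N)%N ->
  trapz g (N + N) p x l = trapz g N p x (l / 2) + trapz g N p (x + l / 2) (l / 2).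
Proof.
move=> N0; have N0' : N%:R != 0 :> R by rewrite pnatr_eq0 -lt0n.
rewrite /trapz big_split_ord /=; congr (_ + _); apply: eq_bigr => i _.
  have h (k : nat) : x + l * (k%:R / (N + N)%:R) = x + l / 2 * (k%:R / N%:R).
    by rewrite addnn -muln2 natrM; field.
  by rewrite !h.
have h (k : nat) : x + l * ((N + k)%:R / (N + N)%:R) =
    x + l / 2 + l / 2 * (k%:R / N%:R) by rewrite natrD addnn -muln2 natrM; field.
by rewrite -addnS !h.
Qed.

Lemma trapzD g1 g2 N p x l :
  trapz (fun z => g1 z + g2 z) N p x l = trapz g1 N p x l + trapz g2 N p x l.
Proof.
rewrite /trapz -big_split; apply: eq_bigr => i _ /=; rewrite /edge; ring.
Qed.

Lemma trapz_affine (a b : C) N p x l : (0 < N)%N ->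
  trapz (fun z => a + b * z) N p x l =
  (a * p (x + l) + b * p (x + l) ^+ 2 / 2) - (a * p x + b * p x ^+ 2 / 2).
Proof.
move=> N0; have N0' : N%:R != 0 :> R by rewrite pnatr_eq0 -lt0n.
pose G i := a * p (x + l * (i%:R / N%:R)) + b * p (x + l * (i%:R / N%:R)) ^+ 2 / 2.
rewrite /trapz -(big_mkord xpredT (fun i =>
  edge _ (p (x + l * (i%:R / N%:R))) (p (x + l * (i.+1%:R / N%:R))))).
rewrite (eq_bigr (fun i => G i.+1 - G i)); last first.
  by move=> i _; rewrite /edge /G; field.
by rewrite telescope_sumr// /G mul0r mulr0 addr0 divff// mulr1.
Qed.

(** The discrete form of maximum times length, the path having length at most [D * l]. *)
Lemma trapz_bound g N p x l (M D : R) : (0 < N)%N -> 0 <= l -> 0 <= M ->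
  (forall t, x <= t <= x + l -> cmod (g (p t)) <= M) ->
  (forall s t, x <= s <= x + l -> x <= t <= x + l ->
     cmod (p s - p t) <= D * `|s - t|) ->
  cmod (trapz g N p x l) <= M * (D * l).
Proof.
move=> N0 l0 M0 gM pD; have N0' : 0 < N%:R :> R by rewrite ltr0n.
have inI (i : nat) : (i <= N)%N -> x <= x + l * (i%:R / N%:R) <= x + l.
  move=> iN; rewrite lerDl lerD2l mulr_ge0 ?divr_ge0//=.
  by rewrite ler_piMr// ler_pdivrMr// mul1r ler_nat.
rewrite /trapz (le_trans (cmod_sum _ _ _))//.
have -> : M * (D * l) = \sum_(i < N) M * (D * l / N%:R).
  by rewrite sumr_const card_ord -[RHS]mulr_natr -mulrA divfK// gt_eqF.
apply: ler_sum => i _; rewrite /edge !cmodM cmodV cmod_nat.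
have h1 := inI i (ltnW (ltn_ord i)); have h2 := inI i.+1 (ltn_ord i).
apply: ler_pM; rewrite ?mulr_ge0 ?invr_ge0 ?cmod_ge0//.
  rewrite ler_pdivrMr// (le_trans (cmodD _ _))// mulr_natr mulr2n.
  by rewrite lerD// gM.
rewrite (le_trans (pD _ _ h2 h1))// -mulrA.
have -> : x + l * (i.+1%:R / N%:R) - (x + l * (i%:R / N%:R)) = l / N%:R.
  rewrite -[in i.+1%:R]addn1 natrD; field; exact: lt0r_neq0.
by rewrite ger0_norm// divr_ge0// ltW.
Qed.

Variables (gam : R -> R -> C) (g : C -> C) (K : R).
Hypothesis gam_lip : forall x y x' y', 0 <= x <= 1 -> 0 <= y <= 1 ->
  0 <= x' <= 1 -> 0 <= y' <= 1 ->
  cmod (gam x y - gam x' y') <= K * (`|x - x'| + `|y - y'|).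
Hypothesis g_der : forall x y, 0 <= x <= 1 -> 0 <= y <= 1 ->
  exists d, der g (gam x y) d.

(** The sum along the [gam]-image of the boundary of a square, traversed counterclockwise in the
    parameters. Inner edges cancel when the square is quartered. *)
Definition circ g N x y l := trapz g N (gam^~ y) x l + trapz g N (gam (x + l)) y l
  - trapz g N (gam^~ (y + l)) x l - trapz g N (gam x) y l.

Lemma circ_split N x y l : (0 < N)%N ->
  circ g (N + N) x y l = circ g N x y (l / 2) + circ g N (x + l / 2) y (l / 2)
    + circ g N x (y + l / 2) (l / 2) + circ g N (x + l / 2) (y + l / 2) (l / 2).
Proof.
move=> N0; rewrite /circ !trapz_split//.
have h2 z : z + l / 2 + l / 2 = z + l by rewrite -addrA -splitr.
rewrite !h2; ring.
Qed.

Lemma circD g1 g2 N x y l :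
  circ (fun z => g1 z + g2 z) N x y l = circ g1 N x y l + circ g2 N x y l.
Proof. by rewrite /circ !trapzD; ring. Qed.

(** Goursat's argument: near each point [g] is affine up to a small relative error, and the affine
    part contributes exactly 0 on every grid. *)
Lemma circ_small (eta : R) : 0 < eta ->
  exists k, forall j, (k <= j)%N -> cmod (circ g (2 ^ j) 0 0 1) <= eta.
Proof.
move=> eta0.
have K0 : 0 <= K.
  have := @gam_lip 1 0 0 0; rewrite !lexx ler01 subr0 subrr normr0 normr1 addr0 mulr1.
  by move=> /(_ isT isT isT isT); apply: le_trans; apply: cmod_ge0.
suff : exists k, forall j, (k <= j)%N ->
    cmod (circ g (2 ^ j) 0 0 1) <= eta * 1 ^+ 2 by rewrite expr1n mulr1.
(* The bound [eta * l ^+ 2] is additive under quartering. The threshold [k] may depend on the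
   square; it goes up by one when quarters are joined, because the grid doubles. *)
apply: (square_bisection (P := fun x y l => exists k, forall j, (k <= j)%N ->
    cmod (circ g (2 ^ j) x y l) <= eta * l ^+ 2)).
  move=> x y l [k1 h1] [k2 h2] [k3 h3] [k4 h4].
  exists (maxn (maxn k1 k2) (maxn k3 k4)).+1 => -[//|j].
  rewrite ltnS !geq_max => /andP[/andP[j1 j2] /andP[j3 j4]].
  rewrite expnS mul2n -addnn circ_split ?expn_gt0//.
  have -> : eta * l ^+ 2 = eta * (l / 2) ^+ 2 + eta * (l / 2) ^+ 2
     + eta * (l / 2) ^+ 2 + eta * (l / 2) ^+ 2 by field.
  by do 3!(apply: le_trans (cmodD _ _) _; apply: lerD;
    last by [apply: h2|apply: h3|apply: h4]); apply: h1.
move=> x0 y0 x01 y01; have [d hd] := g_der x01 y01.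
(* Each of the four sides will contribute at most [e * (2 * (K + 1) * l) * ((K + 1) * l)], which
   accounts for the 8. Using [K + 1] avoids dividing by 0. *)
pose e := eta / (8 * (K + 1) ^+ 2).
have K1 : 0 < K + 1 by rewrite ltr_wpDl.
have e0 : 0 < e by rewrite divr_gt0// mulr_gt0// exprn_gt0.
have [s s0 hs] := hd e e0.
exists (s / (2 * (K + 1))); first by rewrite divr_gt0// mulr_gt0.
move=> x y l /andP[l0 ls] x_ge x_le y_ge y_le xx yy; exists 0 => j _.
pose c := gam x0 y0.
pose rem z := g z - g c - d * (z - c).
have N0 : (0 < 2 ^ j)%N by rewrite expn_gt0.
have -> : circ g (2 ^ j) x y l = circ rem (2 ^ j) x y l.
  have gE : g = fun z => ((g c - d * c) + d * z) + rem z.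
    by apply/funext => z; rewrite /rem; ring.
  rewrite {1}gE circD -[RHS]add0r; congr (_ + _).
  by rewrite /circ !trapz_affine//; ring.
have xl_in t : x <= t <= x + l -> 0 <= t <= 1 by lra.
have yl_in t : y <= t <= y + l -> 0 <= t <= 1 by lra.
have dist z t : x <= z <= x + l -> y <= t <= y + l ->
    cmod (gam z t - c) <= (K + 1) * (2 * l).
  move=> hz ht; apply: le_trans (gam_lip (xl_in _ hz) (yl_in _ ht) x01 y01) _.
  apply: ler_pM => //; rewrite ?addr_ge0// ?lerDl//.
  have : `|z - x0| <= l by rewrite ler_norml; lra.
  have : `|t - y0| <= l by rewrite ler_norml; lra.
  lra.
have remM z t : x <= z <= x + l -> y <= t <= y + l ->
    cmod (rem (gam z t)) <= e * ((K + 1) * (2 * l)).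
  move=> hz ht; have D := dist _ _ hz ht.
  apply: le_trans (hs _ _) _; last by rewrite ler_pM2l.
  apply: le_lt_trans D _; move: ls; rewrite ltr_pdivlMr ?mulr_gt0//.
  by congr (_ < _); ring.
have xl2 : x <= x + l <= x + l by rewrite lexx lerDl ltW.
have xl1 : x <= x <= x + l by rewrite lexx lerDl ltW.
have yl2 : y <= y + l <= y + l by rewrite lexx lerDl ltW.
have yl1 : y <= y <= y + l by rewrite lexx lerDl ltW.
have b0 : 0 <= e * ((K + 1) * (2 * l)).
  by apply: mulr_ge0; [exact: ltW|apply: mulr_ge0; [exact: ltW|apply: mulr_ge0 => //; exact: ltW]].
have H1 t : y <= t <= y + l ->
   cmod (trapz rem (2 ^ j) (gam^~ t) x l) <= e * ((K + 1) * (2 * l)) * ((K + 1) * l).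
  move=> ht; apply: trapz_bound => //; first exact: ltW.
    by move=> z hz; exact: remM.
  move=> z z' hz hz'; apply: le_trans (gam_lip (xl_in _ hz) (yl_in _ ht) (xl_in _ hz') (yl_in _ ht)) _.
  by rewrite subrr normr0 addr0 ler_wpM2r// lerDl.
have H2 z : x <= z <= x + l ->
   cmod (trapz rem (2 ^ j) (gam z) y l) <= e * ((K + 1) * (2 * l)) * ((K + 1) * l).
  move=> hz; apply: trapz_bound => //; first exact: ltW.
    by move=> t ht; exact: remM.
  move=> t t' ht ht'; apply: le_trans (gam_lip (xl_in _ hz) (yl_in _ ht) (xl_in _ hz) (yl_in _ ht')) _.
  by rewrite subrr normr0 add0r ler_wpM2r// lerDl.
have -> : eta * l ^+ 2 = e * ((K + 1) * (2 * l)) * ((K + 1) * l) + e * ((K + 1) * (2 * l)) * ((K + 1) * l)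
   + e * ((K + 1) * (2 * l)) * ((K + 1) * l) + e * ((K + 1) * (2 * l)) * ((K + 1) * l).
  by rewrite /e; field; rewrite gt_eqF.
rewrite /circ.
apply: le_trans (cmodBD _ _) _; apply: lerD; last exact: H2.
apply: le_trans (cmodBD _ _) _; apply: lerD; last exact: H1.
apply: le_trans (cmodD _ _) _; apply: lerD; last exact: H2.
exact: H1.
Qed.

End Goursat.

(** * Cauchy's formula *)

Section Ultralimit.
Variable R : realType.
Local Notation C := (Cplx R).

Lemma cmod_dist_continuous (c : C) : continuous (fun z : C => cmod (z - c)).
Proof.
move=> z; apply/(@cvgrPdist_lt _ _ _ (nbhs z) (nbhs_filter z)) => e e0.
apply/nbhsCP; exists e => // w wz.
apply: le_lt_trans wz.
have -> : cmod (w - z) = cmod ((w - c) - (z - c)) by congr cmod; ring.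
rewrite cmodB ler_norml cmod_dist andbT.
by rewrite lerNl opprB (le_trans (cmod_dist _ _))// cmodB.
Qed.

Lemma closed_disc_closed (c : C) (M : R) : closed [set z : C | cmod (z - c) <= M].
Proof.
apply: (@closed_comp _ _ (fun z : C => cmod (z - c)) [set x : R | x <= M]).
  by move=> z _; apply: cmod_dist_continuous.
exact: closed_le.
Qed.

(** Compactness is transported from a real square by the continuous map [h]. *)
Lemma closed_disc_compact (c : C) (M : R) : compact [set z : C | cmod (z - c) <= M].
Proof.
pose h (p : R * R) : C := c + (p.1 +i* p.2).
have hc : continuous h.
  move=> p; apply/(@cvgCP _ _ (nbhs p) (nbhs_filter p)) => e e0; have e20 : 0 < e / 2 by rewrite divr_gt0.
  exists ([set x | `|p.1 - x| < e / 2], [set y | `|p.2 - y| < e / 2]).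
    by split; apply/nbhs_ballP; exists (e / 2).
  move=> q [/= q1 q2]; rewrite /h opprD addrACA subrr add0r.
  apply: le_lt_trans (cmod_ReIm _) _ => /=.
  by rewrite distrC (distrC q.2) (splitr e) ltrD.
apply: (@subclosed_compact _ _ (h @` (`[- M, M] `*` `[- M, M]))).
- exact: closed_disc_closed.
- apply: continuous_compact; first exact: continuous_subspaceT.
  by apply: compact_setX; exact: segment_compact.
move=> z /= zM; exists (complex.Re (z - c), complex.Im (z - c)); last first.
  by rewrite /h /=; case: (z - c) (subrKC c z).
by split; rewrite /= in_itv/= -ler_norml; apply: le_trans zM;
  [apply: cmod_Re|apply: cmod_Im].
Qed.

Definition evbd (a : nat -> C) := exists M k, forall j, (k <= j)%N -> cmod (a j) <= M.

(** An ultrafilter finer than [\oo] assigns a limit to every eventually bounded sequence, linearly,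
    so that the means over finer and finer grids need not be shown to converge. *)
Lemma ultralimit : exists Lim : (nat -> C) -> C,
  (forall a l M k, (forall j, (k <= j)%N -> cmod (a j - l) <= M) -> cmod (Lim a - l) <= M) /\
  (forall c a b, evbd a -> evbd b ->
     Lim (fun j => c * a j + b j) = c * Lim a + Lim b).
Proof.
have [U [UU oU]] := @ultraFilterLemma nat \oo _.
have UE k : U [set j | (k <= j)%N] by apply: oU; exists k.
have limE a : evbd a -> exists l, forall e : R, 0 < e -> U [set j | cmod (a j - l) < e].
  move=> [M [k hM]]; have FU : ProperFilter (a @ U) by exact: fmap_proper_filter.
  have aM : U (a @^-1` [set z : C | cmod (z - 0) <= M]).
    by apply: filterS (UE k) => j /= kj; rewrite subr0; apply: hM.
  have := @closed_disc_compact 0 M (a @ U) FU aM; case.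
  move=> l [_ cl]; exists l => e e0.
  have [//|nU] := in_ultra_setVsetC [set j | cmod (a j - l) < e] UU.
  have [z []] := cl [set z | ~ cmod (z - l) < e] [set z | cmod (z - l) < e] nU
    ((nbhsCP l [set z | cmod (z - l) < e]).2 (ex_intro2 _ _ e e0 (fun _ x => x))).
  by [].
(* The value 0 is taken only when no limit exists, which does not happen for eventually bounded
   sequences. *)
pose Lim a := xget (0 : C) [set l | forall e : R, 0 < e -> U [set j | cmod (a j - l) < e]].
have LimP a : evbd a -> forall e : R, 0 < e -> U [set j | cmod (a j - Lim a) < e].
  move=> ha; exact: (@xgetPex _ (0 : C)
    (fun l => forall e : R, 0 < e -> U [set j | cmod (a j - l) < e]) (limE a ha)).
exists Lim; split => [a l M k hM|c a b ha hb].
  apply/ler_addgt0Pr => e e0.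
  have ea : evbd a.
    exists (M + cmod l), k => j kj; rewrite -[a j](subrK l).
    by rewrite (le_trans (cmodD _ _))// lerD2r hM.
  have /filter_ex[j [/= j1 j2]] : U ([set j | cmod (a j - Lim a) < e] `&` [set j | (k <= j)%N]).
    by apply: filterI; [exact: LimP|exact: UE].
  rewrite (_ : Lim a - l = (a j - l) - (a j - Lim a)); last by ring.
  rewrite (le_trans (cmodBD _ _))// lerD//; first exact: hM.
  exact: ltW.
have hs : evbd (fun j => c * a j + b j).
  have [[M1 [k1 h1]] [M2 [k2 h2]]] := (ha, hb).
  exists (cmod c * M1 + M2), (maxn k1 k2) => j; rewrite geq_max => /andP[j1 j2].
  by rewrite (le_trans (cmodD _ _))// lerD ?h2// cmodM ler_wpM2l ?cmod_ge0// h1.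
apply/eqP; rewrite -subr_eq0 -cmod_eq0 eq_le cmod_ge0 andbT.
apply/ler_addgt0Pr => e e0; rewrite add0r.
pose K := cmod c + 2; have K0 : 0 < K by rewrite ltr_wpDl ?cmod_ge0.
have eK : 0 < e / K by rewrite divr_gt0.
have H : U ([set j | cmod (a j - Lim a) < e / K] `&` [set j | cmod (b j - Lim b) < e / K]
    `&` [set j | cmod (c * a j + b j - Lim (fun j => c * a j + b j)) < e / K]).
  by apply: filterI; [apply: filterI|]; apply: LimP.
have /filter_ex[j [[/= j1 j2] /= j3]] := H.
set s := Lim _ in j3 *.
have -> : s - (c * Lim a + Lim b) = c * (a j - Lim a) + (b j - Lim b) - (c * a j + b j - s) by ring.
apply: le_trans (cmodBD _ _) _.
have -> : e = cmod c * (e / K) + (e / K) + (e / K) by rewrite /K; field; rewrite gt_eqF.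
apply: lerD; last exact: ltW.
apply: le_trans (cmodD _ _) _; apply: lerD; last exact: ltW.
by rewrite cmodM ler_wpM2l ?cmod_ge0// ltW.
Qed.

End Ultralimit.

(** * Roots of unity and trapezoidal sums over circles *)

Section UnitCircle.
Variable R : realType.
Local Notation C := (Cplx R).

Definition circle (s : R) : C := cos (2 * pi * s) +i* sin (2 * pi * s).

Lemma circleD s t : circle (s + t) = circle s * circle t.
Proof.
rewrite /circle mulrDr cosD sinD; apply/eqP; rewrite eq_complex /=.
by rewrite eqxx /= addrC.
Qed.

Lemma circle0 : circle 0 = 1.
Proof. by rewrite /circle mulr0 cos0 sin0. Qed.

Lemma circle1 : circle 1 = 1.
Proof. by rewrite /circle mulr1 mulr_natl cos2pi sin2pi. Qed.

Lemma cmod_circle s : cmod (circle s) = 1.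
Proof.
apply/eqP; rewrite -(@eqrXn2 _ 2) ?cmod_ge0// expr1n.
by rewrite cmod_sqr /= cos2Dsin2.
Qed.

Lemma circle_neq0 s : circle s != 0.
Proof. by rewrite -cmod_eq0 cmod_circle oner_eq0. Qed.

Lemma circleMn s n : circle (s *+ n) = circle s ^+ n.
Proof.
elim: n => [|n IH]; first by rewrite mulr0n circle0.
by rewrite mulrS circleD IH exprS.
Qed.

Lemma circleN s : circle (- s) = (circle s)^-1.
Proof.
apply: (mulfI (circle_neq0 s)); rewrite -circleD subrr circle0 divff//.
exact: circle_neq0.
Qed.

Lemma lipschitz1 (f df : R -> R) : (forall x, is_derive x (1 : R) f (df x)) ->
  (forall x, `|df x| <= 1) -> forall x y, `|f x - f y| <= `|x - y|.
Proof.
move=> fd fd1.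
have H x y : x <= y -> `|f y - f x| <= `|y - x|.
  have fc : {within `[x, y], continuous f}.
    apply: continuous_subspaceT => z.
    by apply: differentiable_continuous; apply/derivable1_diffP; case: (fd z).
  move=> xy; have [c _ ->] := @MVT_segment _ f df x y xy (fun z _ => fd z) fc.
  by rewrite normrM ler_piMl.
by move=> x y; case: (leP x y) => [/H|/ltW/H]//; rewrite distrC (distrC y).
Qed.

Lemma circle_lip s t : cmod (circle s - circle t) <= 4 * pi * `|s - t|.
Proof.
apply: le_trans (cmod_ReIm _) _ => /=.
have hc : `|cos (2 * pi * s) - cos (2 * pi * t)| <= `|2 * pi * s - 2 * pi * t|.
  apply: (@lipschitz1 cos (fun x => - sin x) (@is_derive_cos R)) => x.
  by rewrite normrN sin_max.
have hs : `|sin (2 * pi * s) - sin (2 * pi * t)| <= `|2 * pi * s - 2 * pi * t|.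
  by apply: (@lipschitz1 sin cos (@is_derive_sin R)) => x; exact: cos_max.
apply: le_trans (lerD hc hs) _.
have pi0 := pi_ge0 R.
by rewrite -mulrBr normrM (ger0_norm (_ : 0 <= 2 * pi)) ?mulr_ge0//; lra.
Qed.

(** For N = 2^j the value N sin(2 pi / N) is 4 at N = 4 and does not decrease when N doubles, by the
    double-angle formula. This lower bound allows the factor of the mean in [trapz_circle] to be
    divided out. *)
Lemma sin_dyadic j : (2 <= j)%N -> 4 <= (2 ^ j)%:R * sin (2 * pi / (2 ^ j)%:R) :> R.
Proof.
move=> /subnK <-; elim: (j - 2)%N => [|k IH].
  rewrite add0n (_ : 2 * pi / (2 ^ 2)%:R = pi / 2); last by field.
  by rewrite sin_pihalf mulr1 lexx.
rewrite addSn; set N := (2 ^ _)%N in IH; apply: le_trans IH _.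
have N0 : (4 <= N)%N by rewrite /N -[4%N]/(2 ^ 2)%N leq_exp2l// leq_addl.
have N0' : 0 < N%:R :> R by rewrite ltr0n (leq_trans _ N0).
rewrite expnS -/N natrM; set x := 2 * pi / (2 * N%:R).
have -> : 2 * pi / N%:R = x *+ 2 by rewrite -mulr_natr /x; field; rewrite gt_eqF.
rewrite sin_mulr2n.
have -> : N%:R * (cos x * sin x *+ 2) = 2 * N%:R * (cos x * sin x) by ring.
rewrite ler_wpM2l ?mulr_ge0//.
rewrite ler_piMl ?cos_le1// sin_ge0_pi//.
have pi0 := pi_gt0 R; apply/andP; split.
  by rewrite divr_ge0 ?mulr_ge0 ?ltW.
rewrite /x ler_pdivrMr ?mulr_gt0// mulrC ler_pM2l// ler_peMr// ler1n.
exact: leq_trans N0.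
Qed.

Definition root2 j : C := circle ((2 ^ j)%:R^-1).

Lemma root2_unity j : root2 j ^+ (2 ^ j) = 1.
Proof.
by rewrite -circleMn -[_ *+ _]mulr_natr mulVf ?circle1// pnatr_eq0 expn_eq0.
Qed.

Definition mean j (h : C -> C) (r : R) : C :=
  (\sum_(i < 2 ^ j) h (r%:C * root2 j ^+ i)) / (2 ^ j)%:R.

Lemma meanD j c h1 h2 r :
  mean j (fun z => c * h1 z + h2 z) r = c * mean j h1 r + mean j h2 r.
Proof. by rewrite /mean big_split /= -mulr_sumr mulrDl mulrA. Qed.

Lemma cmod_scircle (r : R) s : 0 <= r -> cmod (r%:C * circle s) = r.
Proof. by move=> r0; rewrite cmodM cmod_circle mulr1 cmod_realE ger0_norm. Qed.

Lemma root2X j i : root2 j ^+ i = circle (i%:R / (2 ^ j)%:R).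
Proof. by rewrite -circleMn; congr circle; rewrite mulr_natl. Qed.

Lemma mean_bound j h r M : 0 <= r -> (forall z, cmod z = r -> cmod (h z) <= M) ->
  cmod (mean j h r) <= M.
Proof.
move=> r0 hM; rewrite /mean cmodM cmodV cmod_nat.
have N0 : 0 < (2 ^ j)%:R :> R by rewrite ltr0n expn_gt0.
rewrite ler_pdivrMr// (le_trans (cmod_sum _ _ _))//.
rewrite mulr_natr -[X in _ *+ X]card_ord -sumr_const ler_sum// => i _.
by rewrite hM// root2X cmod_scircle.
Qed.

Lemma mean_eq j h1 h2 r : 0 <= r -> (forall z, cmod z = r -> h1 z = h2 z) ->
  mean j h1 r = mean j h2 r.
Proof.
move=> r0 h12; congr (_ / _); apply: eq_bigr => i _.
by apply: h12; rewrite root2X cmod_scircle.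
Qed.

Lemma mean1 j r : mean j (fun=> 1) r = 1.
Proof. by rewrite /mean sumr_const card_ord divff// pnatr_eq0 expn_eq0. Qed.

(** A geometric sum of a root of unity [q]. The condition [2 * m < 2 ^ j] puts the angle of
    [root2 j ^+ m] strictly between 0 and pi, so its sine is positive and [q] is not 1. *)
Lemma mean_negpow j m r : 0 < r -> (0 < m)%N -> (2 * m < 2 ^ j)%N ->
  mean j (fun z => z ^- m) r = 0.
Proof.
move=> r0 m0 mj; rewrite /mean.
rewrite (eq_bigr (fun i : 'I_(2 ^ j) => r%:C ^- m * (root2 j ^- m) ^+ i)); last first.
  by move=> i _; rewrite exprMn invfM; congr (_ * _); rewrite exprVn -!exprM mulnC.
rewrite -mulr_sumr; set q := root2 j ^- m.
have q1 : q - 1 != 0.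
  rewrite subr_eq0 /q invr_eq1 root2X; apply/eqP => -[_].
  apply/eqP; rewrite gt_eqF//; apply: sin_gt0_pi.
  have N0 : 0 < (2 ^ j)%:R :> R by rewrite ltr0n expn_gt0.
  have pi0 := pi_gt0 R; rewrite mulr_gt0 ?mulr_gt0 ?divr_gt0 ?ltr0n//=.
  rewrite (mulrC 2) -mulrA gtr_pMr// mulrA ltr_pdivrMr// mul1r.
  by rewrite -natrM ltr_nat.
suff -> : \sum_(i < 2 ^ j) q ^+ i = 0 by rewrite mulr0 mul0r.
apply: (mulfI q1); rewrite mulr0 -subrX1 /q exprVn -exprM mulnC exprM root2_unity.
by rewrite expr1n invr1 subrr.
Qed.

(** Shifting the index in half of each edge leaves, at every node z, the product of g(z) z and half
    of [w - w^-1]: a discrete form of dz = i z dtheta. *)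
Lemma trapz_circle (g : C -> C) j (r : R) : 
  trapz g (2 ^ j) (fun s => r%:C * circle s) 0 1 =
  (root2 j - (root2 j)^-1) / 2 * (mean j (fun z => g z * z) r * (2 ^ j)%:R).
Proof.
set N := (2 ^ j)%N; have N0 : (0 < N)%N by rewrite expn_gt0.
have N0' : N%:R != 0 :> C by rewrite pnatr_eq0 -lt0n.
rewrite /mean -/N divfK//; set w := root2 j.
have w0 : w != 0 by exact: circle_neq0.
pose a i : C := g (r%:C * w ^+ i) * (r%:C * w ^+ i).
have shift : \sum_(i < N) a i.+1 = \sum_(i < N) a i.
  apply/eqP; rewrite -subr_eq0 -sumrB -(big_mkord xpredT (fun i => a i.+1 - a i)).
  by rewrite telescope_sumr// /a root2_unity expr0 subrr.
transitivity (\sum_(i < N) ((w - 1) / 2 * a i + (1 - w^-1) / 2 * a i.+1)).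
  apply: eq_bigr => i _; rewrite /edge !add0r !mul1r -!root2X -/w /a exprS.
  by field.
rewrite big_split /= -!mulr_sumr shift -/a; field; exact: w0.
Qed.

End UnitCircle.

(** * Cauchy's formula for means over a circle *)

Section CauchyFormula.
Variable R : realType.
Local Notation C := (Cplx R).

Lemma expr_small (x e : R) : 0 <= x -> x < 1 -> 0 < e -> exists n, x ^+ n < e.
Proof.
move=> x0 x1 e0; have : GRing.exp x @ \oo --> 0 by apply: cvg_expr; rewrite ger0_norm.
move=> /cvgrPdist_lt/(_ e e0)[n _ /(_ n (leqnn n))].
by rewrite /= sub0r normrN ger0_norm ?exprn_ge0//; exists n.
Qed.

(** The difference quotient is not yet known to be differentiable at [w]. The circle is therefore
    contracted towards [w] only up to the factor [t0]; on the last curve boundedness of the quotient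
    and shortness of the curve are enough. *)
Lemma cauchy_mean (f : C -> C) (r : R) (w : C) : 0 < r ->
  (forall z, cmod z <= r -> exists d, der f z d) -> cmod w < r ->
  forall e : R, 0 < e -> exists k, forall j, (k <= j)%N ->
    cmod (mean j (fun z => (f z - f w) / (z - w) * z) r) <= e.
Proof.
move=> r_gt0 fd wr e e0.
pose g z := (f z - f w) / (z - w).
have [d hd] := fd w (ltW wr).
have [s s0 hs] := hd 1 ltr01.
pose M := cmod d + 1; have M0 : 0 < M by rewrite ltr_wpDl ?cmod_ge0.
have gM z : z != w -> cmod (z - w) < s -> cmod (g z) <= M.
  move=> zw /hs; rewrite mul1r => h.
  have zw0 : 0 < cmod (z - w) by rewrite cmod_gt0 subr_eq0.
  rewrite /g cmodM cmodV ler_pdivrMr// /M mulrDl mul1r -cmodM.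
  rewrite -[f z - f w](subrK (d * (z - w))) (le_trans (cmodD _ _))//.
  by rewrite addrC lerD2l.
have pi0 : 0 < pi :> R := pi_gt0 R.
pose L : R := r * (4 * pi); have L0 : 0 < L by rewrite !mulr_gt0.
(* The three bounds keep the contraction convex, place the last curve where [g] is bounded by [M],
   and make the sum along it at most [e]. *)
pose t0 := Num.min 1 (Num.min (s / (4 * r)) (e / (M * L))).
have t00 : 0 < t0 by rewrite !lt_min ltr01 !divr_gt0 ?mulr_gt0.
have t01 : t0 <= 1 by rewrite ge_min lexx.
have t0s : t0 * (2 * r) < s.
  apply: (@le_lt_trans _ _ (s / (4 * r) * (2 * r))).
    by rewrite ler_pM2r ?mulr_gt0// /t0 !ge_min lexx orbT.
  have -> : s / (4 * r) * (2 * r) = s / 2 by field; rewrite gt_eqF.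
  by rewrite ltr_pdivrMr// mulr_natr mulr2n ltrDl.
have t0e : M * (t0 * L) <= e.
  rewrite mulrCA -ler_pdivlMr ?mulr_gt0//.
  by rewrite /t0 !ge_min lexx !orbT.
pose tt (u : R) : R := t0 + (1 - t0) * u.
have ttE u : 0 <= u <= 1 -> 0 < tt u <= 1.
  move=> u01; rewrite /tt.
  have h1 : 0 <= (1 - t0) * u by apply: mulr_ge0; lra.
  have h2 : (1 - t0) * u <= (1 - t0) by rewrite ler_piMr//; lra.
  by apply/andP; split; lra.
pose gam (u v : R) : C := w + (tt u)%:C * (r%:C * circle v - w).
have rc v : cmod (r%:C * circle v) = r by rewrite cmod_scircle// ltW.
have rcw v : r%:C * circle v - w != 0.
  by rewrite subr_eq0; apply/eqP => h; move: wr; rewrite -h rc ltxx.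
have rcw2 v : cmod (r%:C * circle v - w) <= 2 * r.
  by rewrite (le_trans (cmodBD _ _))// rc mulrC mulr_natr mulr2n lerD2l ltW.
have gam_in u v : 0 <= u <= 1 -> cmod (gam u v) <= r.
  move=> /ttE ut.
  have -> : gam u v = (1 - tt u)%:C * w + (tt u)%:C * (r%:C * circle v).
    by rewrite /gam rmorphB /=; ring.
  rewrite (le_trans (cmodD _ _))// !cmodM cmod_circle mulr1 !cmod_realE.
  rewrite !ger0_norm; [|lra..].
  have : (1 - tt u) * cmod w <= (1 - tt u) * r.
    by apply: ler_wpM2l; [lra|exact: ltW].
  by rewrite (_ : r = (1 - tt u) * r + tt u * r); [lra|ring].
have gam_w u v : 0 <= u <= 1 -> gam u v != w.
  move=> /ttE ut; rewrite /gam -subr_eq0 addrAC subrr add0r mulf_neq0//.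
  by rewrite -cmod_eq0 cmod_realE normr_eq0 gt_eqF//; lra.
have gam_lip x y x' y' : 0 <= x <= 1 -> 0 <= y <= 1 -> 0 <= x' <= 1 -> 0 <= y' <= 1 ->
    cmod (gam x y - gam x' y') <= (2 * r + L) * (`|x - x'| + `|y - y'|).
  move=> hx hy hx' hy'.
  have -> : gam x y - gam x' y' = (tt x - tt x')%:C * (r%:C * circle y - w) +
      (tt x')%:C * (r%:C * (circle y - circle y')) by rewrite /gam rmorphB /=; ring.
  apply: le_trans (cmodD _ _) _; rewrite !cmodM !cmod_realE.
  have tx' := ttE _ hx'; rewrite (ger0_norm (_ : 0 <= tt x')); last by lra.
  rewrite (ger0_norm (ltW r_gt0)).
  have h1 : `|tt x - tt x'| <= `|x - x'|.
    rewrite /tt opprD addrACA subrr add0r -mulrBr normrM ler_piMl//.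
    by rewrite ger0_norm; lra.
  have h2 : `|tt x - tt x'| * cmod (r%:C * circle y - w) <= `|x - x'| * (2 * r).
    by apply: ler_pM => //; exact: cmod_ge0.
  have h3 : tt x' * (r * cmod (circle y - circle y')) <= L * `|y - y'|.
    have h4 : r * cmod (circle y - circle y') <= L * `|y - y'|.
      by rewrite /L -mulrA ler_pM2l// circle_lip.
    apply: le_trans h4; apply: ler_piMl; first by rewrite mulr_ge0 ?cmod_ge0 ?ltW.
    by lra.
  have h4 : 0 <= L * `|x - x'| by rewrite mulr_ge0// ltW.
  have h5 : 0 <= r * `|y - y'| by rewrite mulr_ge0// ltW.
  lra.
have g_der x y : 0 <= x <= 1 -> 0 <= y <= 1 -> exists d, der g (gam x y) d.
  move=> hx hy; have [d' hd'] := fd _ (gam_in x y hx).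
  eexists; apply: derM; first by apply: derB; [exact: hd'|exact: der_cst].
  apply: derV; first by rewrite subr_eq0 gam_w.
  by apply: derB; [exact: der_id|exact: der_cst].
have [k hk] := circ_small gam_lip g_der e0.
exists (maxn 2 k) => j; rewrite geq_max => /andP[j2 /hk].
have N0 : (0 < 2 ^ j)%N by rewrite expn_gt0.
rewrite /circ !add0r.
(* The curves are closed, so two sides of the parameter square have the same image and cancel. What
   remains compares the circle with the small curve. *)
have -> : gam^~ 1 = gam^~ 0 by apply/funext => u; rewrite /gam circle0 circle1.
rewrite [X in X - _ - _]addrC addrK => hc.
have tt1 : tt 1 = 1 by rewrite /tt; ring.
have tt0 : tt 0 = t0 by rewrite /tt; ring.
have : cmod (trapz g (2 ^ j) (gam 0) 0 1) <= e.
  apply: le_trans t0e; rewrite -[X in M * X]mulr1.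
  have in01 (t : R) : 0 <= t <= 0 + 1 -> 0 <= t <= 1 by rewrite add0r.
  apply: trapz_bound => //; first exact: ltW.
    move=> v _; apply: gM; first by rewrite gam_w// lexx ler01.
    rewrite /gam tt0 addrAC subrr add0r cmodM cmod_realE ger0_norm ?ltW//.
    by apply: le_lt_trans t0s; rewrite ler_pM2l.
  move=> v v' _ _; rewrite /gam tt0.
  have -> : w + t0%:C * (r%:C * circle v - w) - (w + t0%:C * (r%:C * circle v' - w))
    = t0%:C * (r%:C * (circle v - circle v')) by ring.
  rewrite !cmodM !cmod_realE (ger0_norm (ltW t00)) (ger0_norm (ltW r_gt0)).
  rewrite (_ : t0 * L * `|v - v'| = t0 * (r * (4 * pi * `|v - v'|))); last by rewrite /L; ring.
  by rewrite !ler_pM2l// circle_lip.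
move=> h0; have : cmod (trapz g (2 ^ j) (fun s : R => r%:C * circle s) 0 1) <= 2 * e.
  move: hc; have -> : gam 1 = fun s => r%:C * circle s.
    by apply/funext => v; rewrite /gam tt1 mul1r addrC subrK.
  move=> hc; set T := trapz _ _ _ _ _ in hc *.
  rewrite -[T](subrK (trapz g (2 ^ j) (gam 0) 0 1)) (le_trans (cmodD _ _))//.
  by rewrite mulrC mulr_natr mulr2n lerD.
rewrite trapz_circle -/g.
have -> : (fun z => (f z - f w) / (z - w) * z) = fun z => g z * z by [].
move: (mean _ _ _) => m; rewrite !cmodM cmodV !cmod_nat.
have -> : cmod (root2 R j - (root2 R j)^-1) = 2 * sin (2 * pi / (2 ^ j)%:R).
  have -> : root2 R j - (root2 R j)^-1 = Complex 0 (2 * sin (2 * pi / (2 ^ j)%:R)).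
    rewrite /root2 -circleN /circle mulrN cosN sinN.
    by apply/eqP; rewrite eq_complex; apply/andP; split; apply/eqP; rewrite /=; ring.
  have sp : 0 <= sin (2 * pi / (2 ^ j)%:R) :> R.
    have := sin_dyadic R j2; rewrite -ler_pdivrMl ?ltr0n//; apply: le_trans.
    by rewrite mulr_ge0.
  by rewrite /cmod normc_def /= expr0n add0r sqrtr_sqr ger0_norm// mulr_ge0.
move=> h; have := sin_dyadic R j2 => hsin.
have : 4 * cmod m <= 2 * e.
  apply: le_trans h; have := cmod_ge0 m; move: hsin (cmod m).
  move: (sin _) => S; move: ((2 ^ j)%:R : R) => N hsin' x x0.
  by rewrite (_ : _ / 2 * _ = N * S * x); [rewrite ler_wpM2r|field].
lra.
Qed.

Definition circle_bounded (r : R) (h : C -> C) :=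
  exists M, forall z, cmod z = r -> cmod (h z) <= M.

Lemma circle_bounded_cont (r : R) (h : C -> C) : 0 < r ->
  (forall z, cmod z = r -> {for z, continuous h}) -> circle_bounded r h.
Proof.
move=> r0 hc.
have cc : compact [set z : C | cmod z = r].
  apply: (@subclosed_compact _ _ [set z : C | cmod (z - 0) <= r]).
  - have -> : [set z : C | cmod z = r] =
      (fun z : C => cmod (z - 0)) @^-1` [set x : R | x = r].
      by apply/seteqP; split => z /=; rewrite subr0.
    apply: closed_comp; first by move=> z _; exact: cmod_dist_continuous.
    exact: closed_eq.
  - exact: closed_disc_compact.
  - by move=> z /= zr; rewrite subr0 zr.
have [||c _ hM] := @compact_EVT_max _ R (fun z => cmod (h z - 0)) _ _ cc.
- by exists r%:C; rewrite /= cmod_realE ger0_norm// ltW.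
- apply: continuous_in_subspaceT => z; rewrite inE /= => /hc hz.
  exact: (@continuous_comp _ _ _ h (fun z => cmod (z - 0)) z hz (@cmod_dist_continuous R 0 (h z))).
exists (cmod (h c - 0)) => z zr; have := hM z; rewrite subr0; apply.
by rewrite inE.
Qed.

Lemma circle_bounded_der (r : R) (h : C -> C) : 0 < r ->
  (forall z, cmod z = r -> exists d, der h z d) -> circle_bounded r h.
Proof.
by move=> r0 hd; apply: circle_bounded_cont => // z /hd[d /der_cont].
Qed.

(* [Lam h] stands for the normalized integral of [h] over the circle of radius [r]. *)
Lemma circle_mean (r : R) : 0 < r -> exists Lam : (C -> C) -> C,
  [/\ forall h M, (forall z, cmod z = r -> cmod (h z) <= M) -> cmod (Lam h) <= M,
      forall c h1 h2, circle_bounded r h1 -> circle_bounded r h2 ->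
        Lam (fun z => c * h1 z + h2 z) = c * Lam h1 + Lam h2 &
      forall (f : C -> C) w,
        (forall z, cmod z <= r -> exists d, der f z d) -> cmod w < r ->
        f w = Lam (fun z => f z * (z / (z - w)))].
Proof.
move=> r0; have [Lim [LimM LimD]] := ultralimit R.
pose Lam h := Lim (fun j => mean j h r).
have ev h : circle_bounded r h -> evbd (fun j => mean j h r).
  by move=> [M hM]; exists M, 0%N => j _; apply: mean_bound => //; exact: ltW.
have LamM h M : (forall z, cmod z = r -> cmod (h z) <= M) -> cmod (Lam h) <= M.
  move=> hM; rewrite -[Lam h]subr0; apply: (LimM _ _ _ 0%N) => j _.
  by rewrite subr0; apply: mean_bound => //; exact: ltW.
have LamD c h1 h2 : circle_bounded r h1 -> circle_bounded r h2 ->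
        Lam (fun z => c * h1 z + h2 z) = c * Lam h1 + Lam h2.
  move=> b1 b2; rewrite /Lam -LimD; [|exact: ev..].
  by congr Lim; apply/funext => j; exact: meanD.
exists Lam; split => // f w fd wr.
have zw z : cmod z = r -> z - w != 0.
  by move=> zr; rewrite subr_eq0; apply/eqP => h; move: wr; rewrite -h zr ltxx.
have kd z : cmod z = r -> exists d, der (fun z => z / (z - w)) z d.
  move=> zr; eexists; apply: derM; first exact: der_id.
  by apply: derV; [exact: zw|apply: derB; [exact: der_id|exact: der_cst]].
have kb : circle_bounded r (fun z => z / (z - w)) by apply: circle_bounded_der.
have qb : circle_bounded r (fun z => (f z - f w) / (z - w) * z).
  apply: circle_bounded_der => // z zr.
  have [d hd] : exists d, der f z d by apply: fd; rewrite zr.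
  eexists; apply: derM; last exact: der_id.
  apply: derM; first by apply: derB; [exact: hd|exact: der_cst].
  by apply: derV; [exact: zw|apply: derB; [exact: der_id|exact: der_cst]].
have q0 : Lam (fun z => (f z - f w) / (z - w) * z) = 0.
  apply/eqP; rewrite -cmod_eq0 eq_le cmod_ge0 andbT.
  apply/ler_addgt0Pr => e e0; rewrite add0r.
  have [k hk] := cauchy_mean r0 fd wr e0; rewrite -[Lam _]subr0.
  by apply: (LimM _ _ _ k) => j kj; rewrite subr0; apply: hk.
(* The kernel is expanded as a geometric series in w/z. Only the constant term has a nonzero mean
   once [2 ^ j] exceeds twice the exponents that occur, and the tail [kn n.+1] is uniformly
   small. *)
have k1 : Lam (fun z => z / (z - w)) = 1.
  pose x := cmod w / r; have x0 : 0 <= x by rewrite divr_ge0 ?cmod_ge0// ltW.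
  have x1 : x < 1 by rewrite ltr_pdivrMr// mul1r.
  pose kn n z : C := (w ^+ n * z ^- n) * (z / (z - w)).
  pose c := r / (r - cmod w).
  have rw0 : 0 < r - cmod w by rewrite subr_gt0.
  have knM n z : cmod z = r -> cmod (kn n z) <= x ^+ n * c.
    move=> zr; rewrite /kn !cmodM !cmodV !cmodX zr -exprVn -exprMn -/x.
    rewrite ler_wpM2l ?exprn_ge0// /c ler_wpM2l ?(ltW r0)//.
    rewrite lef_pV2 ?posrE ?cmod_gt0 ?zw//.
    by rewrite -zr cmod_dist.
  have kS n z : cmod z = r -> kn n z = w ^+ n * z ^- n + kn n.+1 z.
    move=> zr; have z0 : z != 0 by rewrite -cmod_gt0 zr.
    have := zw z zr; rewrite /kn !exprS => zw0; field; rewrite zw0 z0 /=.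
    by rewrite expf_neq0.
  have mS n j : mean j (kn n) r = w ^+ n * mean j (fun z => z ^- n) r + mean j (kn n.+1) r.
    by rewrite -meanD; apply: mean_eq; [exact: ltW|exact: kS].
  have mE n j : (2 * n < 2 ^ j)%N -> mean j (kn 0) r = 1 + mean j (kn n.+1) r.
    elim: n => [_|n IH nj].
      rewrite mS expr0 mul1r (mean_eq _ (ltW r0) (h2 := fun=> 1)) ?mean1//.
      by move=> z _; rewrite expr0 invr1.
    rewrite IH; last by apply: leq_ltn_trans nj; rewrite leq_mul2l leqnSn.
    by rewrite mS mean_negpow// mulr0 add0r.
  apply/eqP; rewrite -subr_eq0 -cmod_eq0 eq_le cmod_ge0 andbT.
  apply/ler_addgt0Pr => e e0; rewrite add0r.
  have c0 : 0 < c by rewrite divr_gt0.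
  have [n hn] := expr_small x0 x1 (divr_gt0 e0 c0).
  (* From [2 * n <= j] it follows that [2 * n < 2 ^ j], as [mE] demands. *)
  apply: (LimM _ _ _ (2 * n)%N) => j jm.
  have -> : mean j (fun z => z / (z - w)) r = mean j (kn 0%N) r.
    apply: mean_eq => [|z _]; first exact: ltW.
    by rewrite /kn expr0 expr0 invr1 !mul1r.
  rewrite (mE n); last exact: leq_ltn_trans jm (ltn_expl _ _).
  rewrite addrAC subrr add0r; apply: (@le_trans _ _ (x ^+ n.+1 * c)).
    by apply: mean_bound; [exact: ltW|exact: knM].
  rewrite -ler_pdivlMr// (le_trans _ (ltW hn))// exprS ler_piMl ?exprn_ge0//.
  exact: ltW.
have -> : (fun z => f z * (z / (z - w))) =
    fun z => f w * (z / (z - w)) + (f z - f w) / (z - w) * z.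
  apply/funext => z; ring.
by rewrite LamD// k1 q0 mulr1 addr0.
Qed.

End CauchyFormula.

(** * Holomorphy of derivatives and of difference quotients *)

Section Consequences.
Variable R : realType.
Local Notation C := (Cplx R).

Definition hol (c : C) (r : R) (f : C -> C) :=
  forall z, cmod (z - c) < r -> exists d, der f z d.

Lemma hol_der c r f z : hol c r f -> cmod (z - c) < r -> der f z (derive1 f z).
Proof. by move=> hf zr; have [d hd] := hf z zr; rewrite (derE hd). Qed.

Lemma ler_expV2 n (a b : R) : 0 < a -> a <= b -> b ^- n <= a ^- n.
Proof.
move=> a0 ab; have b0 := lt_le_trans a0 ab.
by rewrite lef_pV2 ?posrE ?exprn_gt0// lerXn2r ?nnegrE// ltW.
Qed.

(** Differentiation under [Lam]: a quadratic remainder that is uniform on the circle passes through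
    the bound on [Lam], with no exchange of limits. *)
Lemma der_quadratic (Lam : (C -> C) -> C) (r s K : R) (k : C -> C -> C) (k1 : C -> C) (w : C) :
  (forall h M, (forall z, cmod z = r -> cmod (h z) <= M) -> cmod (Lam h) <= M) ->
  (forall c h1 h2, circle_bounded r h1 -> circle_bounded r h2 ->
        Lam (fun z => c * h1 z + h2 z) = c * Lam h1 + Lam h2) ->
  0 < s -> (forall x, cmod (x - w) < s -> circle_bounded r (k x)) -> circle_bounded r k1 ->
  (forall x z, cmod z = r -> cmod (x - w) < s ->
    cmod (k x z - k w z - k1 z * (x - w)) <= K * cmod (x - w) ^+ 2) ->
  der (fun x => Lam (k x)) w (Lam k1).
Proof.
move=> LM LD s0 kb k1b kK e e0.
have eK : 0 < e / (`|K| + 1) by rewrite divr_gt0// ltr_wpDl.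
exists (Num.min s (e / (`|K| + 1))); first by rewrite lt_min s0.
move=> x; rewrite lt_min => /andP[xs xe].
have kw : circle_bounded r (k w) by apply: kb; rewrite subrr cmod0.
have kx := kb x xs.
have bD c h1 h2 : circle_bounded r h1 -> circle_bounded r h2 ->
    circle_bounded r (fun z => c * h1 z + h2 z).
  move=> [M1 b1] [M2 b2]; exists (cmod c * M1 + M2) => z zr.
  by rewrite (le_trans (cmodD _ _))// lerD ?b2// cmodM ler_wpM2l ?cmod_ge0// b1.
have E : Lam (k x) - Lam (k w) - Lam k1 * (x - w) =
    Lam (fun z => (- (x - w)) * k1 z + ((-1) * k w z + k x z)).
  by rewrite !LD//; [ring|exact: bD].
rewrite E; apply: (@le_trans _ _ (K * cmod (x - w) ^+ 2)).
  apply: LM => z zr; apply: le_trans (kK _ _ zr xs).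
  by rewrite le_eqVlt; apply/orP; left; apply/eqP; congr cmod; ring.
rewrite expr2 mulrA ler_wpM2r ?cmod_ge0//.
apply: (@le_trans _ _ ((`|K| + 1) * cmod (x - w))).
  by rewrite ler_wpM2r ?cmod_ge0// (le_trans (ler_norm K))// lerDl.
by move: xe; rewrite ltr_pdivlMr ?ltr_wpDl// mulrC => /ltW.
Qed.

Section Kernel.
Variables (Lam : (C -> C) -> C) (r : R).
Hypothesis LM : forall h M, (forall z, cmod z = r -> cmod (h z) <= M) -> cmod (Lam h) <= M.
Hypothesis LD : forall c h1 h2, circle_bounded r h1 -> circle_bounded r h2 ->
  Lam (fun z => c * h1 z + h2 z) = c * Lam h1 + Lam h2.
Variable phi : C -> C.
Hypothesis phib : circle_bounded r phi.

Lemma kernel_bounded n x : cmod x < r -> circle_bounded r (fun z => phi z * (z - x) ^- n).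
Proof.
move=> xr; have [M hM] := phib; exists (M * (r - cmod x) ^- n) => z zr.
rewrite cmodM cmodV cmodX; apply: ler_pM; rewrite ?cmod_ge0 ?invr_ge0 ?exprn_ge0 ?cmod_ge0 ?hM//.
have rx : 0 < r - cmod x by rewrite subr_gt0.
have zx : r - cmod x <= cmod (z - x) by rewrite -zr cmod_dist.
exact: ler_expV2.
Qed.

(** [Lam] acts on functions on the whole plane; its bound with [M = 0] shows that only the values on
    the circle matter. *)
Lemma Lam_eq h1 h2 : circle_bounded r h1 -> (forall z, cmod z = r -> h1 z = h2 z) ->
  Lam h1 = Lam h2.
Proof.
move=> b1 h12; have b2 : circle_bounded r h2.
  by have [M hM] := b1; exists M => z zr; rewrite -h12// hM.
apply/eqP; rewrite -subr_eq0 -cmod_eq0 eq_le cmod_ge0 andbT.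
rewrite (_ : Lam h1 - Lam h2 = (-1) * Lam h2 + Lam h1); last by ring.
rewrite -LD//; apply: LM => z zr; rewrite h12// mulN1r addNr cmod0//.
Qed.

Lemma kernel_der1 w : cmod w < r ->
  der (fun x => Lam (fun z => phi z * (z - x) ^- 1)) w (Lam (fun z => phi z * (z - w) ^- 2)).
Proof.
move=> wr; have [M hM] := phib; pose s := (r - cmod w) / 2.
have s0 : 0 < s by rewrite divr_gt0// subr_gt0.
have xs x : cmod (x - w) < s -> cmod x < r /\ forall z, cmod z = r -> s <= cmod (z - x).
  move=> xw; have h : cmod x < r - s.
    by have := cmod_dist x w; rewrite /s in s0 xw *; lra.
  split=> [|z zr]; first by lra.
  by have := cmod_dist z x; lra.
(* The points [x] near [w] stay at distance at least [s] from the circle; the constant is the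
   resulting bound for the coefficient of [(x - w) ^+ 2] in the exact identity below. *)
apply: (@der_quadratic _ r s (M * (s^-1 * s ^- 2))) => //.
- by move=> x /xs[xr _]; exact: kernel_bounded.
- exact: kernel_bounded.
move=> x z zr xw; have [_ /(_ z zr) zx] := xs x xw.
have [_ /(_ z zr) zw] : cmod w < r /\ forall z, cmod z = r -> s <= cmod (z - w).
  by apply: xs; rewrite subrr cmod0.
have zx0 : 0 < cmod (z - x) by exact: lt_le_trans zx.
have zw0 : 0 < cmod (z - w) by exact: lt_le_trans zw.
have zx0' : z - x != 0 by rewrite -cmod_gt0.
have zw0' : z - w != 0 by rewrite -cmod_gt0.
have -> : phi z * (z - x) ^- 1 - phi z * (z - w) ^- 1 - phi z * (z - w) ^- 2 * (x - w) =
   (phi z * ((z - x)^-1 * (z - w) ^- 2)) * (x - w) ^+ 2.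
  by field; rewrite zx0' zw0'.
rewrite !cmodM !cmodV !cmodX -expr2 ler_wpM2r ?sqr_ge0//.
apply: ler_pM; rewrite ?mulr_ge0 ?invr_ge0 ?exprn_ge0 ?cmod_ge0 ?hM//.
apply: ler_pM; rewrite ?invr_ge0 ?exprn_ge0 ?cmod_ge0//.
  by rewrite lef_pV2 ?posrE.
exact: ler_expV2.
Qed.

Lemma kernel_der2 w : cmod w < r ->
  exists d, der (fun x => Lam (fun z => phi z * (z - x) ^- 2)) w d.
Proof.
move=> wr; have [M hM] := phib; pose s := (r - cmod w) / 2.
exists (Lam (fun z => 2 * (phi z * (z - w) ^- 3))).
have s0 : 0 < s by rewrite divr_gt0// subr_gt0.
have xs x : cmod (x - w) < s -> cmod x < r /\ forall z, cmod z = r -> s <= cmod (z - x).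
  move=> xw; have h : cmod x < r - s.
    by have := cmod_dist x w; rewrite /s in s0 xw *; lra.
  split=> [|z zr]; first by lra.
  by have := cmod_dist z x; lra.
apply: (@der_quadratic _ r s (M * (s ^- 2 * s ^- 3 * (3 * (2 * r) + s)))) => //.
- by move=> x /xs[xr _]; exact: kernel_bounded.
- have [N hN] := kernel_bounded 3 wr; exists (2 * N) => z zr.
  by rewrite cmodM cmod_nat ler_pM2l// hN.
move=> x z zr xw; have [xr /(_ z zr) zx] := xs x xw.
have [_ /(_ z zr) zw] : cmod w < r /\ forall z, cmod z = r -> s <= cmod (z - w).
  by apply: xs; rewrite subrr cmod0.
have zx0 : 0 < cmod (z - x) by exact: lt_le_trans zx.
have zw0 : 0 < cmod (z - w) by exact: lt_le_trans zw.
have zx0' : z - x != 0 by rewrite -cmod_gt0.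
have zw0' : z - w != 0 by rewrite -cmod_gt0.
have -> : phi z * (z - x) ^- 2 - phi z * (z - w) ^- 2 - 2 * (phi z * (z - w) ^- 3) * (x - w) =
   (phi z * ((z - x) ^- 2 * (z - w) ^- 3 * (3 * (z - x) + (x - w)))) * (x - w) ^+ 2.
  by field; rewrite zx0' zw0'.
rewrite !cmodM !cmodV !cmodX -expr2 ler_wpM2r ?sqr_ge0//.
apply: ler_pM; rewrite ?mulr_ge0 ?invr_ge0 ?exprn_ge0 ?cmod_ge0 ?hM//.
apply: ler_pM; rewrite ?mulr_ge0 ?invr_ge0 ?exprn_ge0 ?cmod_ge0//.
  apply: ler_pM; rewrite ?invr_ge0 ?exprn_ge0 ?cmod_ge0//.
    exact: ler_expV2.
  exact: ler_expV2.
rewrite (le_trans (cmodD _ _))// lerD ?(ltW xw)// cmodM cmod_nat ler_pM2l//.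
by rewrite (le_trans (cmodBD _ _))// zr; lra.
Qed.

End Kernel.

Lemma cauchy_local c r f : 0 < r -> hol c r f -> exists s (Lam : (C -> C) -> C),
  [/\ 0 < s < r,
    forall h M, (forall z, cmod z = s -> cmod (h z) <= M) -> cmod (Lam h) <= M,
    forall c h1 h2, circle_bounded s h1 -> circle_bounded s h2 ->
      Lam (fun z => c * h1 z + h2 z) = c * Lam h1 + Lam h2,
    circle_bounded s (fun z => f (c + z)) &
    forall x, cmod x < s -> f (c + x) = Lam (fun z => f (c + z) * (z / (z - x)))].
Proof.
move=> r0 hf; exists (r / 2).
have r20 : 0 < r / 2 by rewrite divr_gt0.
have fd z : cmod z <= r / 2 -> exists d, der (fun z => f (c + z)) z d.
  move=> zr; have [|d hd] := hf (c + z); first by rewrite addrAC subrr add0r; lra.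
  exists (d * (0 + 1)); apply: (der_comp (f := fun z => c + z)) hd.
  by apply: derD; [exact: der_cst|exact: der_id].
have [Lam [LM LD LC]] := circle_mean r20; exists Lam; split => //.
- by rewrite r20/=; lra.
- by apply: circle_bounded_der => // z zr; apply: fd; rewrite zr.
- by move=> x xr; rewrite (LC (fun z => f (c + z))).
Qed.

Lemma der_shift (f : C -> C) (c z d : C) : der (fun x => f (c + x)) (z - c) d -> der f z d.
Proof.
move=> h; have := @der_comp _ (fun x => x - c) (fun x => f (c + x)) z (1 - 0) d.
rewrite subr0 mulr1 (_ : (fun w => f (c + (w - c))) = f).
  by apply => //; have := derB (der_id z) (der_cst c z); rewrite subr0.
by apply/funext => x; rewrite addrC subrK.
Qed.

(** Near [z], both [f] and, by [kernel_der1], its derivative are given by Cauchy kernels, and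
    [kernel_der2] differentiates once more. *)
Lemma hol_derive1 c r f : hol c r f -> hol c r (derive1 f).
Proof.
move=> hf z zr; have rz : 0 < r - cmod (z - c) by rewrite subr_gt0.
have hz : hol z (r - cmod (z - c)) f.
  move=> x xz; apply: hf; have := cmod_tri z x c; lra.
have [s [Lam [/andP[s0 sr] LM LD fb LC]]] := cauchy_local rz hz.
pose phi x := f (z + x) * x.
have phib : circle_bounded s phi.
  have [M hM] := fb; exists (M * s) => x xs.
  by rewrite cmodM xs ler_wpM2r ?(ltW s0)// hM.
have fE x : cmod x < s -> f (z + x) = Lam (fun y => phi y * (y - x) ^- 1).
  by move=> xs; rewrite LC//; congr Lam; apply/funext => y; rewrite /phi expr1 mulrA.
have f1E x : cmod x < s -> derive1 f (z + x) = Lam (fun y => phi y * (y - x) ^- 2).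
  move=> xs; apply: derE; apply: (@der_shift _ z); rewrite (_ : z + x - z = x); last by rewrite addrC addKr.
  apply: (@der_near _ _ _ _ _ (s - cmod x)) (kernel_der1 LM LD phib xs).
    by rewrite subr_gt0.
  move=> y yx; rewrite fE//; have := cmod_dist y x; lra.
have c0 : cmod (0 : C) < s by rewrite cmod0.
have [d hd] := kernel_der2 LM LD phib c0.
exists d; apply: (@der_shift _ z); rewrite subrr; apply: (@der_near _ _ _ _ _ s) hd => //.
by move=> y; rewrite subr0 => ys; rewrite f1E.
Qed.

Definition dquot (f : C -> C) (c z : C) : C :=
  if z == c then derive1 f c else (f z - f c) / (z - c).

Lemma dquotE f c z : f z = f c + (z - c) * dquot f c z.
Proof.
rewrite /dquot; case: eqVneq => [->|zc]; first by rewrite subrr mul0r addr0.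
by rewrite mulrC divfK ?subr_eq0// addrC subrK.
Qed.

(** Removable singularity. At [c], the identity z/(z - x) = 1 + x/(z - x) under Cauchy's formula
    exhibits the quotient as [Lam] of f(c + z)/(z - x), for x = 0 too, and this is differentiable in
    x. *)
Lemma hol_dquot c r f : hol c r f -> hol c r (dquot f c).
Proof.
move=> hf z zr; have [zc|zc] := eqVneq z c; last first.
  have zc0 : 0 < cmod (z - c) by rewrite cmod_gt0 subr_eq0.
  have [d hd] := hf z zr.
  eexists; apply: der_near (derM (derB hd (der_cst (f c) z)) (derV _ (derB (der_id z) (der_cst c z)))).
  - exact: zc0.
  - move=> w wz; rewrite /dquot; case: eqVneq => // wc.
    by move: wz; rewrite wc cmodB ltxx.
  - by rewrite /= subr_eq0.
move: zr; rewrite zc subrr cmod0 => r0; clear z zc.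
have [s [Lam [/andP[s0 sr] LM LD fb LC]]] := cauchy_local r0 hf.
have c0 : cmod (0 : C) < s by rewrite cmod0.
pose phi x := f (c + x) * x.
have phib : circle_bounded s phi.
  have [M hM] := fb; exists (M * s) => x xs.
  by rewrite cmodM xs ler_wpM2r ?(ltW s0)// hM.
have E x : cmod x < s -> dquot f c (c + x) = Lam (fun z => f (c + z) * (z - x) ^- 1).
  move=> xs; rewrite /dquot -subr_eq0 addrAC subrr add0r.
  have [->|x0] := eqVneq x 0.
    have : der f c (Lam (fun y => phi y * (y - 0) ^- 2)).
      apply: (@der_shift _ c); rewrite subrr.
      apply: (@der_near _ _ _ _ _ s) (kernel_der1 LM LD phib c0) => //.
      by move=> y; rewrite subr0 => ys; rewrite LC//; congr Lam; apply/funext => y'; rewrite /phi expr1 mulrA.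
    move=> /derE ->; apply: (Lam_eq LM LD).
      exact: kernel_bounded.
    move=> y ys; have y0 : y != 0 by rewrite -cmod_gt0 ys.
    by rewrite /phi subr0; field.
  have fb0 : circle_bounded s (fun z => f (c + z) * (z - x) ^- 1) by exact: kernel_bounded.
  have -> : f c = Lam (fun z => f (c + z)).
    rewrite -{1}[c]addr0 LC//; apply: (Lam_eq LM LD) => //.
      have [M hM] := fb; exists M => z zs; have z0 : z != 0 by rewrite -cmod_gt0 zs.
      by rewrite subr0 divff// mulr1 hM.
    move=> z zs; have z0 : z != 0 by rewrite -cmod_gt0 zs.
    by rewrite subr0 divff// mulr1.
  have -> : f (c + x) = x * Lam (fun z => f (c + z) * (z - x) ^- 1) + Lam (fun z => f (c + z)).
    rewrite LC// -LD//; apply: (Lam_eq LM LD).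
      have := kernel_bounded phib 1 xs; congr circle_bounded; apply/funext => z.
      by rewrite /phi expr1 mulrA.
    move=> z zs; have zx : z - x != 0.
      by rewrite subr_eq0; apply/eqP => h; move: xs; rewrite -h zs ltxx.
    by rewrite expr1; field.
  by rewrite addrK mulrC mulKf.
exists (Lam (fun z => f (c + z) * (z - 0) ^- 2)); apply: (@der_shift _ c); rewrite subrr.
apply: (@der_near _ _ _ _ _ s) (kernel_der1 LM LD fb c0) => //.
by move=> y; rewrite subr0 => ys; rewrite E.
Qed.

End Consequences.

(** * Maximum modulus, Schwarz-Pick, local inversion *)

Section MaximumModulus.
Variable R : realType.
Local Notation C := (Cplx R).

Lemma hol_shift c r (f : C -> C) : hol c r f -> hol 0 r (fun x => f (c + x)).
Proof.
move=> hf z; rewrite subr0 => zr; have [|d hd] := hf (c + z).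
  by rewrite addrAC subrr add0r.
exists (d * (0 + 1)); apply: (der_comp (f := fun z => c + z)) hd.
by apply: derD; [exact: der_cst|exact: der_id].
Qed.

Lemma hol_sub c r c' r' (f : C -> C) : cmod (c' - c) + r' <= r -> hol c r f -> hol c' r' f.
Proof.
move=> h hf z zr; apply: hf; have := cmod_tri c' z c; lra.
Qed.

(* Landau's trick: the crude Cauchy bound, applied to the powers of [f], loses its constant. *)
Lemma max_modulus (f : C -> C) (r M : R) w : 0 < r ->
  (forall z, cmod z <= r -> exists d, der f z d) ->
  (forall z, cmod z = r -> cmod (f z) <= M) -> cmod w < r -> cmod (f w) <= M.
Proof.
move=> r0 fd fM wr.
have M0 : 0 <= M.
  by apply: le_trans (fM r%:C _); rewrite ?cmod_ge0// cmod_realE ger0_norm// ltW.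
have [Lam [LM _ LC]] := circle_mean r0.
pose c := r / (r - cmod w); have rw0 : 0 < r - cmod w by rewrite subr_gt0.
have c0 : 0 < c by rewrite divr_gt0.
have P n : cmod (f w) ^+ n <= M ^+ n * c.
  rewrite -cmodX (LC (fun z => f z ^+ n))//; last first.
    move=> z /fd[d hd]; elim: n => [|n [d' IH]]; first by exists 0; exact: der_cst.
    eexists; have := derM hd IH; rewrite (_ : (fun _ => _) = (fun z => f z ^+ n.+1)); first exact.
    by apply/funext => y; rewrite exprS.
  apply: LM => z zr; rewrite !cmodM cmodX cmodV zr; apply: ler_pM.
  - by rewrite exprn_ge0 ?cmod_ge0.
  - by rewrite mulr_ge0 ?invr_ge0 ?cmod_ge0 ?(ltW r0).
  - by apply: lerXn2r; rewrite ?nnegrE ?cmod_ge0// fM.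
  - rewrite ler_pM2l//; have zx : r - cmod w <= cmod (z - w) by rewrite -zr cmod_dist.
    by rewrite lef_pV2 ?posrE// (lt_le_trans rw0).
rewrite leNgt; apply/negP => Mf.
have f0 : 0 < cmod (f w) by exact: le_lt_trans Mf.
have q1 : M / cmod (f w) < 1 by rewrite ltr_pdivrMr// mul1r.
have ci0 : 0 < c^-1 by rewrite invr_gt0.
have [n] := expr_small (divr_ge0 M0 (cmod_ge0 (f w))) q1 ci0.
rewrite ltNge => /negP; apply; rewrite expr_div_n ler_pdivlMr ?exprn_gt0//.
by rewrite mulrC ler_pdivrMr.
Qed.

Lemma max_modulus_center (f : C -> C) c (r M : R) : 0 < r ->
  (forall z, cmod (z - c) <= r -> exists d, der f z d) ->
  (forall z, cmod (z - c) = r -> cmod (f z) <= M) -> cmod (f c) <= M.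
Proof.
move=> r0 fd fM; rewrite -[c]addr0.
apply: (@max_modulus (fun x => f (c + x)) r M 0) => //; last by rewrite cmod0.
  move=> z zr; have [|d hd] := fd (c + z); first by rewrite addrAC subrr add0r.
  exists (d * (0 + 1)); apply: (der_comp (f := fun z => c + z)) hd.
  by apply: derD; [exact: der_cst|exact: der_id].
by move=> z zr; apply: fM; rewrite addrAC subrr add0r.
Qed.

(** Otherwise [1 / (f - w)] would be holomorphic and violate the maximum principle. This takes the
    place of the argument principle in all later surjectivity statements. *)
Lemma min_modulus (f : C -> C) c w (r m : R) : 0 < r ->
  (forall z, cmod (z - c) <= r -> exists d, der f z d) ->
  cmod (f c - w) < m -> (forall z, cmod (z - c) = r -> m <= cmod (f z - w)) ->
  exists2 z, cmod (z - c) < r & f z = w.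
Proof.
move=> r0 fd fc fm; apply: contrapT => nz.
have m0 : 0 < m by apply: le_lt_trans fc; exact: cmod_ge0.
have fz0 z : cmod (z - c) <= r -> f z - w != 0.
  rewrite le_eqVlt => /orP[/eqP zr|zr].
    by rewrite -cmod_gt0 (lt_le_trans m0)// fm.
  by rewrite subr_eq0; apply/eqP => h; apply: nz; exists z.
have : cmod (f c - w)^-1 <= m^-1.
  apply: (@max_modulus_center (fun z => (f z - w)^-1) c r) => // z zr.
    have [d hd] := fd z zr; eexists; apply: derV; first exact: fz0.
    by apply: derB; [exact: hd|exact: der_cst].
  have zr' : cmod (z - c) <= r by rewrite zr.
  by rewrite cmodV lef_pV2 ?posrE ?cmod_gt0 ?fz0// fm.
have fc0 : f c - w != 0 by apply: fz0; rewrite subrr cmod0 ltW.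
by rewrite cmodV lef_pV2 ?posrE ?cmod_gt0// leNgt fc.
Qed.

(** Taylor polynomials: [a n] are the coefficients, and [rem w n] is the tail of the geometric
    expansion of the Cauchy kernel on an intermediate circle of radius [s]. *)
Lemma poly_approx (f : C -> C) (r0 r e : R) : 0 < r -> r < r0 -> hol 0 r0 f -> 0 < e ->
  exists p : {poly C}, forall w, cmod w <= r -> cmod (f w - p.[w]) <= e.
Proof.
move=> r_gt0 rr0 hf e0; have [s /andP[rs sr1]] : exists s, r < s < r0 by exists ((r + r0) / 2); lra.
have s0 : 0 < s by exact: lt_trans rs.
have fd z : cmod z <= s -> exists d, der f z d.
  by move=> zs; apply: hf; rewrite subr0; exact: le_lt_trans zs sr1.
have [Lam [LM LD LC]] := circle_mean s0.
have [M hM] : circle_bounded s f.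
  by apply: circle_bounded_der => // z zs; apply: fd; rewrite zs.
have M0 : 0 <= M.
  by apply: le_trans (hM s%:C _); rewrite ?cmod_ge0// cmod_realE ger0_norm// ltW.
pose a n := Lam (fun z => f z * z ^- n).
have sr0 : 0 < s - r by rewrite subr_gt0.
pose rem w n z := f z * (w ^+ n * z ^- n * (z / (z - w))).
have remM w n z : cmod w <= r -> cmod z = s -> cmod (rem w n z) <= M * ((r / s) ^+ n * (s / (s - r))).
  move=> wr zs; rewrite /rem cmodM; apply: ler_pM; rewrite ?cmod_ge0 ?hM//.
  rewrite cmodM; apply: ler_pM; rewrite ?cmod_ge0//.
    rewrite cmodM cmodV !cmodX zs -exprVn -exprMn.
    apply: lerXn2r; rewrite ?nnegrE ?divr_ge0 ?cmod_ge0 ?(ltW s0) ?(ltW r_gt0)//.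
    by rewrite ler_pM2r ?invr_gt0.
  rewrite cmodM cmodV zs ler_pM2l//.
  have zw : s - r <= cmod (z - w) by have := cmod_dist z w; lra.
  by rewrite lef_pV2 ?posrE// (lt_le_trans sr0).
have fE w n : cmod w <= r -> f w = \sum_(m < n) a m * w ^+ m + Lam (rem w n).
  move=> wr; have ws : cmod w < s by exact: le_lt_trans rs.
  elim: n => [|n ->].
    rewrite big_ord0 add0r (LC f)//; congr Lam; apply/funext => z.
    by rewrite /rem !expr0 invr1 !mul1r.
  rewrite big_ord_recr /= -addrA; congr (_ + _); rewrite mulrC -LD; last 2 first.
  - exists (M * s ^- n) => z zs; rewrite cmodM cmodV cmodX zs.
    by rewrite ler_wpM2r ?hM// invr_ge0 exprn_ge0// ltW.
  - by exists (M * ((r / s) ^+ n.+1 * (s / (s - r)))) => z; exact: remM.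
  apply: (Lam_eq LM LD).
    by exists (M * ((r / s) ^+ n * (s / (s - r)))) => z; exact: remM.
  move=> z zs; have z0 : z != 0 by rewrite -cmod_gt0 zs.
  have zw : z - w != 0.
    by rewrite subr_eq0; apply/eqP => h; move: ws; rewrite -h zs ltxx.
  by rewrite /rem !exprS; field; rewrite zw z0 expf_neq0.
pose c := M * (s / (s - r)) + 1.
have c0 : 0 < c by rewrite ltr_wpDl// mulr_ge0// divr_ge0// ltW.
have q0 : 0 <= r / s by rewrite divr_ge0 ?ltW.
have q1 : r / s < 1 by rewrite ltr_pdivrMr// mul1r.
have [n hn] := expr_small q0 q1 (divr_gt0 e0 c0).
exists (\poly_(m < n) a m) => w wr; rewrite horner_poly (fE w n wr) addrAC subrr add0r.
apply: (@le_trans _ _ (M * ((r / s) ^+ n * (s / (s - r))))).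
  by apply: LM => z zs; exact: remM.
rewrite mulrCA; apply: (@le_trans _ _ ((r / s) ^+ n * c)).
  by rewrite ler_wpM2l ?exprn_ge0// lerDl.
by rewrite -ler_pdivlMr// ltW.
Qed.

End MaximumModulus.

(** * The lemmas of Schwarz and Schwarz-Pick *)

Section SchwarzPick.
Variable R : realType.
Local Notation C := (Cplx R).

Lemma schwarz (g : C -> C) : hol 0 1 g -> (forall z, cmod z < 1 -> cmod (g z) <= 1) ->
  g 0 = 0 -> forall z, cmod z < 1 -> cmod (dquot g 0 z) <= 1.
Proof.
move=> hg g1 g0 z z1; apply/ler_addgt0Pr => e e0.
(* The radius [r] must exceed [cmod z] and be so close to 1 that [r^-1 <= 1 + e], the bound which
   the maximum principle gives for the quotient. *)
pose d := Num.max (cmod z) (1 + e)^-1.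
have e1 : 0 < 1 + e by rewrite addr_gt0.
have d1 : d < 1 by rewrite gt_max z1 invf_lt1// ltrDl.
pose r := (d + 1) / 2; have r1 : r < 1 by rewrite /r; lra.
have dr : d < r by rewrite /r; lra.
have zr : cmod z < r by apply: le_lt_trans dr; rewrite le_max lexx.
have er : (1 + e)^-1 <= r by apply: ltW; apply: le_lt_trans dr; rewrite le_max lexx orbT.
have r0 : 0 < r by apply: lt_le_trans er; rewrite invr_gt0.
apply: (@max_modulus _ _ r) => // x xr.
  by apply: (hol_dquot hg); rewrite subr0; exact: le_lt_trans xr _.
have x0 : x != 0 by rewrite -cmod_gt0 xr.
have x1 : cmod x < 1 by rewrite xr.
have := g1 x x1; rewrite {1}(dquotE g 0 x) g0 add0r subr0 cmodM xr.
rewrite -ler_pdivlMl// mulr1 => /le_trans; apply.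
by rewrite -[leRHS]invrK lef_pV2 ?posrE ?invr_gt0.
Qed.

Lemma mobius_sqr (a u : C) : cmod (1 - conjc a * u) ^+ 2 - cmod (u - a) ^+ 2 =
  (1 - cmod a ^+ 2) * (1 - cmod u ^+ 2).
Proof. by rewrite !cmod_sqr; case: a u => [a b] [u v] /=; ring. Qed.

Lemma mobius_bound (a u : C) : cmod a <= 1 -> cmod u <= 1 ->
  cmod (u - a) <= cmod (1 - conjc a * u).
Proof.
move=> a1 u1; rewrite -(@ler_pXn2r _ 2)// ?nnegrE ?cmod_ge0// -subr_ge0.
by rewrite mobius_sqr mulr_ge0// subr_ge0 expr_le1// cmod_ge0.
Qed.

Lemma mobius_bound_lt (a u : C) : cmod a < 1 -> cmod u < 1 ->
  cmod (u - a) < cmod (1 - conjc a * u).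
Proof.
move=> a1 u1; rewrite -(@ltr_pXn2r _ 2)// ?nnegrE ?cmod_ge0// -subr_gt0.
by rewrite mobius_sqr mulr_gt0// subr_gt0 expr_lt1// cmod_ge0.
Qed.

Lemma conjcM_cmod (a : C) : conjc a * a = (cmod a ^+ 2)%:C.
Proof.
apply/eqP; rewrite cmod_sqr eq_complex; case: a => a b /=.
by apply/andP; split; apply/eqP; ring.
Qed.

Lemma mobius_denom (a u : C) : cmod a < 1 -> cmod u <= 1 -> 1 - conjc a * u != 0.
Proof.
move=> a1 u1; have cc : cmod (conjc a) = cmod a by rewrite /cmod normcJ.
rewrite subr_eq0; apply/eqP => h; have := cmod1 R; rewrite h cmodM cc => h'.
have : cmod a * cmod u <= cmod a by rewrite ler_piMr// cmod_ge0.
by rewrite h' leNgt a1.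
Qed.

(** Schwarz's lemma for [u] followed by the disc automorphism that sends [u 0] to 0. The bound on
    [u] is not strict, so that [near_id] can apply the lemma to the quotient v(z)/z. *)
Lemma schwarz_pick0 (u : C -> C) : hol 0 1 u -> (forall z, cmod z < 1 -> cmod (u z) <= 1) ->
  cmod (u 0) < 1 ->
  cmod (derive1 u 0) <= 1 - cmod (u 0) ^+ 2 /\
  forall z, cmod z < 1 ->
  cmod (u z - u 0) <= cmod z * cmod (1 - conjc (u 0) * u z).
Proof.
move=> hu u1 u01; set a := u 0.
pose g x := (u x - a) / (1 - conjc a * u x).
have gd : hol 0 1 g.
  move=> x x1; have [d hd] := hu x x1; rewrite subr0 in x1.
  eexists; apply: derM; first by apply: derB; [exact: hd|exact: der_cst].
  apply: derV; first by apply: mobius_denom => //; exact: u1.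
  by apply: derB; [exact: der_cst|exact: derZ hd].
have den x : cmod x < 1 -> 0 < cmod (1 - conjc a * u x).
  by move=> x1; rewrite cmod_gt0 mobius_denom// u1.
have g1 x : cmod x < 1 -> cmod (g x) <= 1.
  move=> x1; rewrite /g cmodM cmodV ler_pdivrMr ?den// mul1r.
  by apply: mobius_bound; [exact: ltW|exact: u1].
have g0 : g 0 = 0 by rewrite /g subrr mul0r.
have sg := schwarz gd g1 g0; split=> [|z z1].
  have z1 : cmod (0 : C) < 1 by rewrite cmod0.
  have a2 : 0 < 1 - cmod a ^+ 2 by rewrite subr_gt0 expr_lt1// cmod_ge0.
  have aE : 1 - conjc a * a = (1 - cmod a ^+ 2)%:C by rewrite conjcM_cmod rmorphB.
  have du : der u 0 (derive1 u 0) by apply: (hol_der hu); rewrite subr0.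
  have : der g 0 (derive1 u 0 / (1 - conjc a * a)).
    have a0 : 1 - conjc a * a != 0 by rewrite -cmod_gt0; apply: den.
    have := derM (derB du (der_cst a 0)) (@derV _ (fun x => 1 - conjc a * u x) 0 _ a0
      (derB (der_cst 1 0) (derZ (conjc a) du))).
    by rewrite subrr mul0r add0r subr0 mulrC.
  move=> /derE gE; have := sg 0 z1; rewrite /dquot eqxx gE aE cmodM cmodV cmod_realE.
  by rewrite gtr0_norm// ler_pdivrMr// mul1r.
have := dquotE g 0 z; rewrite g0 add0r subr0 => gE.
rewrite -ler_pdivrMr ?den// -cmodV -cmodM -/(g z) gE cmodM.
by rewrite ler_piMr ?cmod_ge0// sg.
Qed.

(** The automorphism [phi] moves 0 to [b], with derivative [1 - cmod b ^+ 2] at 0, which reduces the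
    claim to the origin. *)
Lemma schwarz_pick (v : C -> C) : hol 0 1 v -> (forall z, cmod z < 1 -> cmod (v z) < 1) ->
  forall b, cmod b < 1 ->
  cmod (derive1 v b) * (1 - cmod b ^+ 2) <= 1 - cmod (v b) ^+ 2.
Proof.
move=> hv v1 b b1.
have cc x : cmod (conjc x) = cmod x :> R by rewrite /cmod normcJ.
pose phi x := (x + b) / (1 + conjc b * x).
have den x : cmod x < 1 -> 1 + conjc b * x != 0.
  move=> x1; rewrite -[conjc b * x]opprK -mulrN.
  by apply: mobius_denom => //; rewrite cmodN ltW.
have phi1 x : cmod x < 1 -> cmod (phi x) < 1.
  move=> x1; rewrite /phi cmodM cmodV ltr_pdivrMr ?cmod_gt0 ?den// mul1r.
  have := @mobius_bound_lt (- b) x; rewrite cmodN => /(_ b1 x1).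
  by rewrite opprK raddfN /= mulNr opprK.
have phid x : cmod x < 1 -> der phi x
    ((x + b) * (- (conjc b) / (1 + conjc b * x) ^+ 2) + (1 + conjc b * x)^-1).
  move=> x1; have h := derM (derD (der_id x) (der_cst b x))
    (@derV _ (fun y => 1 + conjc b * y) x _ (den x x1) (derD (der_cst 1 x) (derZ (conjc b) (der_id x)))).
  by move: h; rewrite add0r addr0 !mulr1.
pose u x := v (phi x).
have hu : hol 0 1 u.
  move=> x; rewrite subr0 => x1; eexists; apply: der_comp; first exact: phid.
  by apply: (hol_der hv); rewrite subr0 phi1.
have z1 : cmod (0 : C) < 1 by rewrite cmod0.
have phi0 : phi 0 = b by rewrite /phi add0r mulr0 addr0 invr1 mulr1.
have [] := schwarz_pick0 hu.
- by move=> z zz; apply/ltW/v1/phi1.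
- by apply/v1/phi1.
rewrite /u phi0 => h _; apply: le_trans h.
have b2 : 0 < 1 - cmod b ^+ 2 by rewrite subr_gt0 expr_lt1// cmod_ge0.
have hvb : der v (phi 0) (derive1 v b) by rewrite phi0; apply: (hol_der hv); rewrite subr0.
rewrite (derE (der_comp (phid 0 z1) hvb)) cmodM mulr0 addr0 add0r expr1n invr1 mulr1.
have -> : b * - conjc b + 1 = (1 - cmod b ^+ 2)%:C.
  by rewrite rmorphB /= -conjcM_cmod mulrN mulrC addrC.
by rewrite cmod_realE gtr0_norm.
Qed.

End SchwarzPick.

(** * Local surjectivity; injective functions have nonzero derivative *)

Section LocalInverse.
Variable R : realType.
Local Notation C := (Cplx R).

Lemma der_lower (f : C -> C) z d : der f z d -> d != 0 -> exists2 s : R, 0 < s &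
  forall w, cmod (w - z) < s -> cmod d / 2 * cmod (w - z) <= cmod (f w - f z).
Proof.
move=> hf d0; have d20 : 0 < cmod d / 2 by rewrite divr_gt0// cmod_gt0.
have [s s0 hs] := hf _ d20; exists s => // w /hs h.
have := cmod_dist (d * (w - z)) (d * (w - z) - (f w - f z)).
rewrite subKr cmodM (cmodB (d * (w - z))).
move: (cmod (f w - f z)) (cmod (f w - f z - _)) h => X Y h; lra.
Qed.

Lemma local_surj (f : C -> C) c r e : 0 < r -> hol c r f -> derive1 f c != 0 -> 0 < e ->
  exists2 s : R, 0 < s & forall w, cmod (w - f c) < s ->
    exists2 z, cmod (z - c) < e & f z = w.
Proof.
move=> r0 hf d0 e0.
have fc : der f c (derive1 f c) by apply: (hol_der hf); rewrite subrr cmod0.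
have [s s0 hs] := der_lower fc d0.
have m0 : 0 < Num.min s (Num.min r e) by rewrite !lt_min s0 r0 e0.
pose q := Num.min s (Num.min r e) / 2.
have q0 : 0 < q by rewrite divr_gt0.
have : q < Num.min s (Num.min r e) by rewrite /q ltr_pdivrMr// mulr_natr mulr2n ltrDl.
rewrite !lt_min => /and3P[qs qr qe].
have dd : 0 < cmod (derive1 f c) / 2 * q by rewrite mulr_gt0// divr_gt0// cmod_gt0.
(* On the circle of radius [q], [f] is at least twice this far from [f c]. A value [w] closer to
   [f c] than this satisfies the hypotheses of [min_modulus]. *)
exists (cmod (derive1 f c) / 2 * q / 2); first by rewrite divr_gt0.
move=> w wc; have [|||z zq zw] := @min_modulus _ f c w q (cmod (derive1 f c) / 2 * q / 2) q0.
- by move=> z zq; apply: hf; exact: le_lt_trans qr.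
- by rewrite cmodB.
- move=> z zq; have := hs z; rewrite zq => /(_ qs) h.
  by have := cmod_tri w (f z) (f c); lra.
- by exists z => //; exact: lt_trans qe.
Qed.

Lemma root_unity_neq1 k : (2 <= k)%N -> exists2 x : C, x != 1 & x ^+ k = 1.
Proof.
move=> k2; exists (circle (k%:R^-1)); last first.
  by rewrite -circleMn -[_ *+ _]mulr_natr mulVf ?circle1// pnatr_eq0 -lt0n (leq_trans _ k2).
move: k2; rewrite leq_eqVlt => /orP[/eqP <-|k2].
  rewrite /circle (_ : 2 * pi * 2^-1 = pi); last by field.
  by rewrite cospi sinpi eq_complex /= negb_and lt_eqF// ltrN10.
have k0 : 0 < k%:R :> R by rewrite ltr0n (leq_trans _ k2).
rewrite /circle eq_complex /= negb_and orbC gt_eqF// sin_gt0_pi//.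
have pi0 := pi_gt0 R; rewrite divr_gt0 ?mulr_gt0//=.
by rewrite ltr_pdivrMr// mulrC ltr_pM2l// ltr_nat.
Qed.

(** Factors z are divided out until the quotient is nonzero at 0. If this never stopped, the maximum
    principle would give |f(z)| <= M 2^-n for all n at a point z of half the radius, so f would
    vanish there as well as at 0. *)
Lemma inj_order (f : C -> C) r : 0 < r -> hol 0 r f -> f 0 = 0 ->
  (forall x y, cmod x < r -> cmod y < r -> f x = f y -> x = y) ->
  exists k (g : C -> C), [/\ hol 0 r g, g 0 != 0 & forall z, cmod z < r -> f z = z ^+ k * g z].
Proof.
move=> r0 hf f0 fi; pose g n := iter n (fun h => dquot h 0) f.
have hg n : hol 0 r (g n) by elim: n => // n; exact: hol_dquot.
have fE n : (forall i, (i < n)%N -> g i 0 = 0) -> forall z, f z = z ^+ n * g n z.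
  elim: n => [_ z|n IH gi z]; first by rewrite expr0 mul1r.
  rewrite IH; last by move=> i ni; apply: gi; rewrite ltnS ltnW.
  by rewrite (dquotE (g n) 0 z) gi// add0r subr0 exprSr mulrA.
have [n gn] : exists n, g n 0 != 0.
  apply: contrapT => ng; have gz n : g n 0 = 0.
    by apply/eqP/negPn/negP => h; apply: ng; exists n.
  pose q := r / 2; have q0 : 0 < q by rewrite divr_gt0.
  have qr : q < r by rewrite /q; lra.
  have [M hM] : circle_bounded q f.
    by apply: circle_bounded_der => // z zq; apply: hf; rewrite subr0 zq.
  have M0 : 0 <= M.
    by apply: le_trans (hM q%:C _); rewrite ?cmod_ge0// cmod_realE ger0_norm// ltW.
  pose z : C := (q / 2)%:C; have zE : cmod z = q / 2 by rewrite cmod_realE ger0_norm// divr_ge0 ?ltW.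
  have zq : cmod z < q by rewrite zE; lra.
  have gM n : cmod (g n z) <= M / q ^+ n.
    apply: (@max_modulus _ _ q) => // x xq.
      by apply: hg; rewrite subr0; exact: le_lt_trans qr.
    rewrite ler_pdivlMr ?exprn_gt0// mulrC -xq -cmodX -cmodM -fE//.
    exact: hM.
  have fz0 : f z = 0.
    apply/eqP; rewrite -cmod_eq0 eq_le cmod_ge0 andbT; apply/ler_addgt0Pr => e e0.
    have h2 : 0 <= 1 / 2 :> R by lra.
    have h3 : 1 / 2 < 1 :> R by lra.
    have M1 : 0 < M + 1 by rewrite ltr_wpDl.
    have [n hn] := expr_small h2 h3 (divr_gt0 e0 M1).
    rewrite add0r (fE n)// cmodM cmodX zE.
    apply: (@le_trans _ _ ((q / 2) ^+ n * (M / q ^+ n))).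
      by rewrite ler_wpM2l// exprn_ge0// divr_ge0// ltW.
    have -> : (q / 2) ^+ n * (M / q ^+ n) = (1 / 2) ^+ n * M.
      by rewrite !expr_div_n expr1n; field; rewrite !expf_neq0 ?gt_eqF.
    apply: (@le_trans _ _ ((1 / 2) ^+ n * (M + 1))).
      by rewrite ler_wpM2l ?exprn_ge0// lerDl.
    by rewrite -ler_pdivlMr// ltW.
  have z0 : z = 0.
    apply: fi; rewrite ?f0//; first exact: lt_trans qr.
    by rewrite cmod0.
  by move: zE; rewrite z0 cmod0; lra.
have [k gk kmin] := ex_minnP (ex_intro (fun n => g n 0 != 0) n gn).
exists k, (g k); split => // z _; apply: fE => i ik; apply/eqP/negPn/negP => h.
by have := kmin i h; rewrite leqNgt ik.
Qed.

(* If [f z = z ^+ k * g z] with [k >= 2], then [f] takes the value [g 0 * t ^+ k] near each of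
   the points [t * x], [x ^+ k = 1]. *)
Lemma inj_derive1_0 (f : C -> C) r : 0 < r -> hol 0 r f -> f 0 = 0 ->
  (forall x y, cmod x < r -> cmod y < r -> f x = f y -> x = y) -> derive1 f 0 != 0.
Proof.
move=> r0 hf f0 fi; apply/negP => /eqP d0.
have [k [g [hg g0 fE]]] := inj_order r0 hf f0 fi.
have c0 : cmod (0 : C) < r by rewrite cmod0.
have k2 : (2 <= k)%N.
  case: k fE => [|[|//]] fE; last first.
    have h : der f 0 (0 * derive1 g 0 + g 0 * 1).
      apply: (@der_near _ _ _ _ _ r) (derM (der_id 0) (hol_der hg _)) => //.
        by move=> w; rewrite subr0 => wr; rewrite fE// expr1.
      by rewrite subrr.
    by move: g0; rewrite -[g 0]mulr1 -[_ * _]add0r -[X in X + _](mul0r (derive1 g 0)) -(derE h) d0 eqxx.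
  by move: g0; rewrite -[g 0]mul1r -(expr0 (0 : C)) -fE// f0 eqxx.
have [x x1 xk] := root_unity_neq1 k2.
have cx : cmod x = 1.
  apply/eqP; rewrite -(@eqrXn2 _ k) ?cmod_ge0 ?expr1n// ?(leq_trans _ k2)//.
  by rewrite -cmodX xk cmod1.
have dk : der (fun y : C => y ^+ k) 1 k%:R.
  have := der_poly ('X^k) (1 : C); rewrite derivXn hornerMn hornerXn expr1n.
  by under eq_fun do rewrite hornerXn.
have kn0 : k%:R != 0 :> C by rewrite pnatr_eq0 -lt0n (leq_trans _ k2).
have [s s0 hs] := der_lower dk kn0.
(* This [q] keeps the discs of radius [t * q] about [T] and [T * x] disjoint, and keeps [v ^+ k - 1]
   bounded below on the circle of radius [q] about 1. *)
pose q := Num.min 1 (Num.min (s / 2) (cmod (x - 1) / 2)).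
have q0 : 0 < q by rewrite !lt_min ltr01 !divr_gt0// cmod_gt0 subr_eq0.
have q1 : q <= 1 by rewrite ge_min lexx.
have qs : q < s.
  apply: (@le_lt_trans _ _ (s / 2)); first by rewrite !ge_min lexx orbT.
  by rewrite ltr_pdivrMr// mulr_natr mulr2n ltrDl.
have qx : 2 * q <= cmod (x - 1).
  by rewrite mulrC -ler_pdivlMr// !ge_min lexx !orbT.
pose b := g 0; have b0 : 0 < cmod b by rewrite cmod_gt0.
(* With this [eta], replacing [g z] by [b] costs at most an eighth of [cmod b * q], against a main
   term of at least one half of it. *)
pose eta := cmod b * q / (8 * 2 ^+ k).
have eta0 : 0 < eta by rewrite divr_gt0 ?mulr_gt0 ?exprn_gt0.
have [d gd] : exists d, der g 0 d by apply: hg; rewrite subrr.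
have [s1 s10 hs1] := (contCP g 0).1 (der_cont gd) _ eta0.
pose t := Num.min s1 r / 4.
have t0 : 0 < t by rewrite divr_gt0// lt_min s10 r0.
have ts1 : 2 * t < s1.
  have : t <= s1 / 4 by rewrite /t ler_pM2r// ge_min lexx.
  lra.
have tr : 2 * t < r.
  have : t <= r / 4 by rewrite /t ler_pM2r// ge_min lexx orbT.
  lra.
pose T : C := t%:C; have cT : cmod T = t by rewrite cmod_realE gtr0_norm.
have T0 : T != 0 by rewrite -cmod_gt0 cT.
have twok : 1 <= 2 ^+ k :> R by rewrite exprn_ege1// ler1n.
have key y : y ^+ k = 1 -> cmod y = 1 -> exists2 z, cmod (z - T * y) < t * q & f z = b * T ^+ k.
  move=> yk cy; have y0 : y != 0 by rewrite -cmod_gt0 cy.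
  have small z : cmod (z - T * y) <= t * q -> cmod z <= 2 * t.
    move=> h; have := cmodD (z - T * y) (T * y); rewrite subrK cmodM cy cT mulr1.
    have : t * q <= t by rewrite ler_piMr// ltW.
    lra.
  apply: (@min_modulus _ f _ _ _ (t ^+ k * (cmod b * q / 4))); first by rewrite mulr_gt0.
  - by move=> z /small zt; apply: hf; rewrite subr0; exact: le_lt_trans tr.
  - have zt : cmod (T * y) <= 2 * t by apply: small; rewrite subrr cmod0 mulr_ge0 ?ltW.
    rewrite fE; last exact: le_lt_trans tr.
    have -> : (T * y) ^+ k * g (T * y) - b * T ^+ k = T ^+ k * (g (T * y) - b).
      by rewrite exprMn yk; ring.
    rewrite cmodM cmodX cT ltr_pM2l ?exprn_gt0//.
    have := hs1 (T * y); rewrite subr0 => /(_ (le_lt_trans zt ts1)) h.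
    apply: lt_trans h _; rewrite /eta.
    rewrite ltr_pM2l ?mulr_gt0// ltf_pV2 ?posrE ?mulr_gt0 ?exprn_gt0//.
    lra.
  - move=> z zq; have zt : cmod z <= 2 * t by apply: small; rewrite zq.
    rewrite fE; last exact: le_lt_trans tr.
    (* The substitution z = T y v turns both circles into the circle of radius [q] about 1, since
       [y ^+ k = 1]. *)
    pose v := z / (T * y); have zv : z = T * y * v by rewrite /v mulrC divfK// mulf_neq0.
    have vq : cmod (v - 1) = q.
      have : T * y * (v - 1) = z - T * y by rewrite mulrBr mulr1 -zv.
      move=> /(congr1 (@cmod R)); rewrite zq !cmodM cT cy mulr1.
      by apply: mulfI; rewrite gt_eqF.
    have v2 : cmod v <= 2.
      have := cmodD (v - 1) 1; rewrite subrK cmod1 vq; lra.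
    have := hs v; rewrite vq => /(_ qs) h1.
    have -> : z ^+ k * g z - b * T ^+ k = T ^+ k * (b * (v ^+ k - 1) + v ^+ k * (g z - b)).
      by rewrite [in X in X * g z]zv !exprMn yk; ring.
    rewrite cmodM cmodX cT ler_pM2l ?exprn_gt0//.
    have h2 : cmod (g z - b) <= eta by apply/ltW/hs1; rewrite subr0; exact: le_lt_trans ts1.
    have h3 : cmod (v ^+ k * (g z - b)) <= cmod b * q / 8.
      rewrite cmodM cmodX.
      apply: (@le_trans _ _ (2 ^+ k * eta)).
        apply: ler_pM; rewrite ?exprn_ge0 ?cmod_ge0//.
        by apply: lerXn2r; rewrite ?nnegrE ?cmod_ge0.
      rewrite /eta le_eqVlt; apply/orP; left; apply/eqP; field.
      by rewrite expf_neq0.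
    have h4 : cmod b * q / 2 <= cmod (b * (v ^+ k - 1)).
      rewrite cmodM -mulrA ler_pM2l//; move: h1; rewrite expr1n cmod_nat; apply: le_trans.
      rewrite mulrC ler_wpM2r// ?(ltW q0)// -[leLHS]mul1r ler_pM2r// ler1n.
      exact: leq_trans k2.
    have := cmod_dist (b * (v ^+ k - 1)) (- (v ^+ k * (g z - b))).
    rewrite opprK cmodN; move: h3 h4 (mulr_gt0 b0 q0).
    move: (cmod (v ^+ k * _)) (cmod (b * (v ^+ k - 1))) (cmod (_ + _)) (cmod b * q) => X1 X2 X3 X4.
    lra.
have [z1 h1 f1] := key 1 (expr1n _ _) (cmod1 R).
have [z2 h2 f2] := key x xk cx.
have inr z y : cmod y = 1 -> cmod (z - T * y) < t * q -> cmod z < r.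
  move=> cy h; apply: le_lt_trans tr.
  have := cmodD (z - T * y) (T * y); rewrite subrK cmodM cy cT mulr1.
  have : t * q <= t by rewrite ler_piMr// ltW.
  lra.
have z12 : z1 = z2 by apply: fi; rewrite ?f1 ?f2//; [exact: (inr _ 1 (cmod1 R))|exact: (inr _ x)].
have : cmod (T * x - T * 1) < 2 * (t * q).
  apply: le_lt_trans (cmod_tri z1 _ _) _; rewrite cmodB {1}z12; lra.
rewrite -mulrBr cmodM cT mulrCA ltr_pM2l//; lra.
Qed.

Lemma inj_derive1 (f : C -> C) c r : 0 < r -> hol c r f ->
  (forall x y, cmod (x - c) < r -> cmod (y - c) < r -> f x = f y -> x = y) -> derive1 f c != 0.
Proof.
move=> r0 hf fi; pose F x := f (c + x) - f c.
have hF : hol 0 r F.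
  move=> z zr; have [d hd] := hol_shift hf zr.
  by exists (d - 0); apply: derB hd _; exact: der_cst.
have fc : der f c (derive1 f c) by apply: (hol_der hf); rewrite subrr cmod0.
have : der F 0 (derive1 f c * (0 + 1) - 0).
  apply: derB; last exact: der_cst.
  apply: (der_comp (f := fun z => c + z)); last by rewrite addr0.
  by apply: derD; [exact: der_cst|exact: der_id].
rewrite add0r mulr1 subr0 => /derE <-.
apply: (inj_derive1_0 r0) => //; first by rewrite /F addr0 subrr.
move=> x y xr yr /addIr h; apply: (addrI c); apply: fi => //.
  by rewrite addrAC subrr add0r.
by rewrite addrAC subrr add0r.
Qed.

End LocalInverse.

(** * Mean value inequality and an injectivity criterion *)

Section MeanValue.
Variable R : realType.
Local Notation C := (Cplx R).

Lemma is_deriveR (phi : R -> R) (t d : R) :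
  (forall e : R, 0 < e -> exists2 s : R, 0 < s & forall h, `|h| < s ->
     `|phi (t + h) - phi t - d * h| <= e * `|h|) -> is_derive t (1 : R) phi d.
Proof.
move=> hd.
have cv : (fun h => h^-1 *: (phi (h *: 1 + t) - phi t)) @ 0^' --> d.
  apply/cvgrPdist_le => e e0; have [s s0 hs] := hd e e0.
  apply/nbhs_ballP; exists s => //= h; rewrite /ball /= sub0r normrN => hs' h0.
  have := hs h hs'; rewrite /GRing.scale/= mulr1 (addrC h) => H.
  rewrite -(ler_pM2r (_ : 0 < `|h|)) ?normr_gt0// -normrM mulrBl.
  by rewrite mulrAC mulVf// mul1r distrC.
split; first by apply/cvg_ex; exists d.
exact: cvg_lim cv.
Qed.

(** The real mean value theorem is applied along the segment to Re(conj(u) f), where u = f x - f y;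
    the increment of this function is |u|^2. *)
Lemma mean_value (f : C -> C) c r M : hol c r f ->
  (forall z, cmod (z - c) < r -> cmod (derive1 f z) <= M) ->
  forall x y, cmod (x - c) < r -> cmod (y - c) < r -> cmod (f x - f y) <= M * cmod (x - y).
Proof.
move=> hf fM x y xr yr; pose u := f x - f y.
pose z (t : R) := y + t%:C * (x - y).
have zr (t : R) : 0 <= t <= 1 -> cmod (z t - c) < r.
  move=> t01; have -> : z t - c = (1 - t)%:C * (y - c) + t%:C * (x - c).
    by rewrite /z rmorphB /=; ring.
  rewrite (le_lt_trans (cmodD _ _))// !cmodM !cmod_realE !ger0_norm; [|lra..].
  have [->|t0] := eqVneq t 0; first by rewrite subr0 mul1r mul0r addr0.
  have h1 : (1 - t) * cmod (y - c) <= (1 - t) * r by apply: ler_wpM2l; [lra|exact: ltW].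
  have h2 : t * cmod (x - c) < t * r.
    by rewrite ltr_pM2l// lt_def t0; case/andP: t01.
  rewrite (_ : r = (1 - t) * r + t * r); [lra|ring].
pose phi t := complex.Re (conjc u * f (z t)).
pose dphi t := complex.Re (conjc u * (derive1 f (z t) * (x - y))).
have dz (t : R) : 0 <= t <= 1 -> is_derive t (1 : R) phi (dphi t).
  move=> t01; apply: is_deriveR => e e0.
  have fz := hol_der hf (zr t t01).
  pose K := cmod u * cmod (x - y) + 1.
  have K0 : 0 < K by rewrite ltr_wpDl// mulr_ge0 ?cmod_ge0.
  have [s s0 hs] := fz (e / K) (divr_gt0 e0 K0).
  have D0 : 0 < cmod (x - y) + 1 by rewrite ltr_wpDl ?cmod_ge0.
  exists (s / (cmod (x - y) + 1)); first by rewrite divr_gt0.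
  move=> h; rewrite ltr_pdivlMr// => hs'.
  have zE : z (t + h) - z t = h%:C * (x - y) by rewrite /z rmorphD /=; ring.
  have ch : cmod (z (t + h) - z t) = `|h| * cmod (x - y) by rewrite zE cmodM cmod_realE.
  have hz : cmod (z (t + h) - z t) < s.
    by rewrite ch; apply: le_lt_trans hs'; rewrite ler_wpM2l// lerDl.
  have := hs _ hz; rewrite ch zE => H.
  have -> : phi (t + h) - phi t - dphi t * h =
    complex.Re (conjc u * (f (z (t + h)) - f (z t) - derive1 f (z t) * (h%:C * (x - y)))).
    have ReM (a : C) : complex.Re a * h = complex.Re (h%:C * a).
      by case: a => a b /=; ring.
    rewrite /phi /dphi ReM.
    by rewrite -!raddfB /=; congr complex.Re; ring.
  apply: le_trans (cmod_Re _) _; rewrite cmodM.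
  have -> : cmod (conjc u) = cmod u by rewrite /cmod normcJ.
  apply: le_trans (ler_wpM2l (cmod_ge0 u) H) _.
  rewrite (_ : cmod u * _ = (e / K * (cmod u * cmod (x - y))) * `|h|); last by ring.
  rewrite ler_wpM2r// mulrAC ler_pdivrMr// ler_wpM2l ?(ltW e0)//.
  by rewrite /K lerDl.
have phic : {within `[0, 1], continuous phi}.
  apply: continuous_in_subspaceT => t; rewrite inE /= in_itv /= => t01.
  by apply: differentiable_continuous; apply/derivable1_diffP; case: (dz t t01).
have dz' (t : R) : t \in `]0, 1[%R -> is_derive t (1 : R) phi (dphi t).
  by rewrite in_itv /= => /andP[a b]; apply: dz; rewrite !ltW.
have [t t01] := MVT ltr01 dz' phic; rewrite subr0 mulr1.
rewrite in_itv /= in t01.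
have z0 : z 0 = y by rewrite /z mul0r addr0.
have z1 : z 1 = x by rewrite /z mul1r addrC subrK.
have t01' : 0 <= t <= 1 by case/andP: t01 => a b; rewrite !ltW.
rewrite /phi z0 z1 => E.
have {}E : cmod u ^+ 2 = dphi t.
  by rewrite -E -raddfB -mulrBr -/u /= conjcM_cmod.
have : cmod u ^+ 2 <= cmod u * (M * cmod (x - y)).
  rewrite E; apply: le_trans (ler_norm _) _; apply: le_trans (cmod_Re _) _.
  have -> : cmod (conjc u * (derive1 f (z t) * (x - y))) = cmod u * (cmod (derive1 f (z t)) * cmod (x - y)).
    by rewrite !cmodM; congr (_ * _); rewrite /cmod normcJ.
  by rewrite ler_wpM2l ?cmod_ge0// ler_wpM2r ?cmod_ge0// fM// zr.
have [->|u0] := eqVneq (cmod u) 0.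
  have M0 : 0 <= M by apply: le_trans (fM x xr); exact: cmod_ge0.
  by rewrite mulr_ge0 ?cmod_ge0.
by rewrite expr2 ler_pM2l// lt_def u0 cmod_ge0.
Qed.

Lemma der0_cst (f : C -> C) c r : hol c r f ->
  (forall z, cmod (z - c) < r -> derive1 f z = 0) ->
  forall x y, cmod (x - c) < r -> cmod (y - c) < r -> f x = f y.
Proof.
move=> hf f0 x y xr yr; apply/eqP; rewrite -subr_eq0 -cmod_eq0 eq_le cmod_ge0 andbT.
have := mean_value hf (M := 0) _ xr yr; rewrite mul0r; apply.
by move=> z zr; rewrite f0// cmod0.
Qed.

(** The function f(z) - z is a contraction with factor 1/2, so f cannot identify two points. *)
Lemma near1_inj (f : C -> C) c r : hol c r f ->
  (forall z, cmod (z - c) < r -> cmod (derive1 f z - 1) <= 1 / 2) ->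
  forall x y, cmod (x - c) < r -> cmod (y - c) < r -> f x = f y -> x = y.
Proof.
move=> hf f1 x y xr yr fxy.
have dg z : cmod (z - c) < r -> der (fun z => f z - z) z (derive1 f z - 1).
  by move=> zr; apply: derB; [exact: hol_der hf zr|exact: der_id].
have hg : hol c r (fun z => f z - z).
  by move=> z zr; eexists; exact: dg.
have gM z : cmod (z - c) < r -> cmod (derive1 (fun z => f z - z) z) <= 1 / 2.
  by move=> zr; rewrite (derE (dg z zr)) f1.
have := mean_value hg gM xr yr; rewrite fxy.
have -> : f y - x - (f y - y) = - (x - y) by ring.
rewrite cmodN => h; have := cmod_ge0 (x - y) => h'.
by apply/eqP; rewrite -subr_eq0 -cmod_eq0; apply/eqP; lra.
Qed.

End MeanValue.

(** * Transition maps and their distance from the identity *)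

Section Transition.
Variable R : realType.
Local Notation C := (Cplx R).

Lemma hol_unit_disc (f : C -> C) : holomorphic_on (@unit_disc R) f <-> hol 0 1 f.
Proof.
split=> [hf z|hf z].
  by rewrite subr0 -unit_discE => /hf /differentiableCP.
by rewrite unit_discE => z1; apply/differentiableCP/hf; rewrite subr0.
Qed.

Lemma hol_univ (f : C -> C) : univalent f <->
  hol 0 1 f /\ forall x y, cmod x < 1 -> cmod y < 1 -> f x = f y -> x = y.
Proof.
split=> [[/hol_unit_disc hf fi]|[/hol_unit_disc hf fi]]; split => //.
  by move=> x y x1 y1 fxy; apply: fi => //; rewrite inE unit_discE.
by move=> x y; rewrite !inE !unit_discE; apply: fi.
Qed.

(** Preimages are chosen pointwise. Injectivity of [f] identifies the choice with the nearby
    preimage supplied by [local_surj], which gives continuity, and then the derivative. Applied to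
    two functions of the chain and, with [g] the identity, to invert a transition map. *)
Lemma transition (f g : C -> C) (r : R) : hol 0 1 f ->
  (forall x y, cmod x < 1 -> cmod y < 1 -> f x = f y -> x = y) -> hol 0 r g ->
  (forall z, cmod z < r -> exists2 y, cmod y < 1 & f y = g z) ->
  exists v : C -> C, [/\ forall z, cmod z < r -> cmod (v z) < 1,
    forall z, cmod z < r -> f (v z) = g z & hol 0 r v].
Proof.
move=> hf fi hg gf.
pose v z := xget (0 : C) [set y | cmod y < 1 /\ f y = g z].
have vP z : cmod z < r -> cmod (v z) < 1 /\ f (v z) = g z.
  move=> /gf[y y1 fy].
  exact: (@xgetPex _ (0 : C) (fun y => cmod y < 1 /\ f y = g z) (ex_intro _ y (conj y1 fy))).
exists v; split => [z /vP[]|z /vP[]|z]//; rewrite subr0 => zr.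
have [v1 fv] := vP z zr; pose y0 := v z; rewrite -/y0 in v1 fv.
have q0 : 0 < 1 - cmod y0 by rewrite subr_gt0.
have hf0 : hol y0 (1 - cmod y0) f by apply: hol_sub hf; rewrite subr0 addrC subrK.
have in1 x : cmod (x - y0) < 1 - cmod y0 -> cmod x < 1.
  by move=> h; have := cmodD (x - y0) y0; rewrite subrK; lra.
have d0 : derive1 f y0 != 0.
  by apply: (inj_derive1 q0 hf0) => x y /in1 x1 /in1 y1; apply: fi.
have df : der f y0 (derive1 f y0) by apply: (hol_der hf); rewrite subr0.
have dg : der g z (derive1 g z) by apply: (hol_der hg); rewrite subr0.
have vc : {for z, continuous v}.
  apply/contCP => e e0.
  pose e1 := Num.min e (1 - cmod y0).
  have e10 : 0 < e1 by rewrite lt_min e0.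
  have [s s0 hs] := local_surj q0 hf0 d0 e10.
  have [s1 s10 hs1] := (contCP g z).1 (der_cont dg) s s0.
  exists (Num.min s1 (r - cmod z)); first by rewrite lt_min s10 subr_gt0.
  move=> w; rewrite lt_min => /andP[ws1 wr].
  have wr' : cmod w < r by have := cmodD (w - z) z; rewrite subrK; lra.
  have [y ye fy] : exists2 y, cmod (y - y0) < e1 & f y = g w.
    by apply: hs; rewrite fv; apply: hs1.
  move: ye; rewrite lt_min => /andP[ye yq].
  have [vw1 fvw] := vP w wr'.
  by rewrite (_ : v w = y)// ; apply: fi => //; [exact: in1|rewrite fvw fy].
(* [f (v w) - f (v z) = g w - g z], and [f] is bounded below near [v z] *)
have [s s0 hs] := der_lower df d0.
pose D := cmod (derive1 f y0); have D0 : 0 < D by rewrite cmod_gt0.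
pose G := cmod (derive1 g z) + 1; have G0 : 0 < G by rewrite ltr_wpDl ?cmod_ge0.
exists (derive1 g z / derive1 f y0) => e e0.
(* After division by [D], the errors of [g] and of [f] amount to half of [e] each. *)
pose e1 := e * D / 2; have e10 : 0 < e1 by rewrite divr_gt0// mulr_gt0.
pose e2 := e * D * D / (4 * G); have e20 : 0 < e2 by rewrite divr_gt0 ?mulr_gt0.
have [a1 a10 h1] := dg e1 e10; have [a2 a20 h2] := df e2 e20.
have [a3 a30 h3] := dg 1 ltr01.
have m0 : 0 < Num.min s a2 by rewrite lt_min s0.
have [a4 a40 h4] := (contCP v z).1 vc _ m0.
exists (Num.min (Num.min a1 a3) (Num.min a4 (r - cmod z))).
  by rewrite !lt_min a10 a30 a40 subr_gt0.
move=> w; rewrite !lt_min => /andP[/andP[w1 w3] /andP[w4 wr]].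
have wr' : cmod w < r by have := cmodD (w - z) z; rewrite subrK; lra.
have [vw1 fvw] := vP w wr'.
have := h4 w w4; rewrite lt_min => /andP[ws wa2].
have b1 := h1 w w1; have b2 := h2 _ wa2; have b3 := hs _ ws.
have b4 : cmod (g w - g z) <= G * cmod (w - z).
  rewrite -[g w - g z](subrK (derive1 g z * (w - z))) (le_trans (cmodD _ _))//.
  rewrite cmodM /G mulrDl mul1r addrC lerD2l; apply: le_trans (h3 w w3) _.
  by rewrite mul1r.
rewrite fvw fv in b2 b3; rewrite -/y0 in b2 b3 *; rewrite -/D in b3.
have aux (d V a h G' : C) : d != 0 -> V - a / d * h = d^-1 * ((G' - a * h) - (G' - d * V)).
  by move=> ?; field.
rewrite (aux _ _ _ _ (g w - g z) d0).
rewrite cmodM cmodV -/D ler_pdivrMl//.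
apply: le_trans (cmodBD _ _) _; apply: le_trans (lerD b1 b2) _.
have b5 : cmod (v w - y0) <= 2 * G / D * cmod (w - z).
  rewrite mulrAC ler_pdivlMr//; lra.
apply: (@le_trans _ _ (e1 * cmod (w - z) + e2 * (2 * G / D * cmod (w - z)))).
  by rewrite lerD2l ler_pM2l.
rewrite /e1 /e2 le_eqVlt; apply/orP; left; apply/eqP; field.
by rewrite !gt_eqF.
Qed.

(** The quotient u = v(z)/z has u(0) = a, so [schwarz_pick0] gives |u - a| <= r |1 - a u|. The
    triangle inequality turns this into a linear inequality for |1 - u|. *)
Lemma near_id (v : C -> C) (a r : R) : hol 0 1 v -> (forall z, cmod z < 1 -> cmod (v z) <= 1) ->
  v 0 = 0 -> derive1 v 0 = a%:C -> 0 < a < 1 -> 0 < r < 1 ->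
  forall z, cmod z <= r -> cmod (v z - z) <= (1 - a) * ((1 + r) / (1 - r)).
Proof.
move=> hv v1 v0 va a01 r01 z zr.
have z1 : cmod z < 1 by lra.
have hu := hol_dquot hv; have u1 := schwarz hv v1 v0.
have u0 : dquot v 0 0 = a%:C by rewrite /dquot eqxx.
have ca : cmod a%:C = a by rewrite cmod_realE ger0_norm; lra.
have [] := schwarz_pick0 hu u1; first by rewrite u0 ca; lra.
move=> _ /(_ z z1); rewrite u0 conjc_real; set u := dquot v 0 z => H.
have vE : v z = z * u by rewrite {1}(dquotE v 0 z) v0 add0r subr0.
have h1 : cmod (1 - a%:C * u) <= cmod (1 - u) + (1 - a).
  have -> : 1 - a%:C * u = (1 - u) + (1 - a)%:C * u by rewrite rmorphB /=; ring.
  rewrite (le_trans (cmodD _ _))// lerD2l cmodM cmod_realE ger0_norm; last by lra.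
  by rewrite ler_piMr ?u1//; lra.
have h2 : cmod (1 - u) <= (1 - a) + cmod (u - a%:C).
  have -> : 1 - u = (1 - a)%:C - (u - a%:C) by rewrite rmorphB /=; ring.
  by rewrite (le_trans (cmodBD _ _))// cmod_realE ger0_norm//; lra.
have h3 : cmod (u - a%:C) <= r * (cmod (1 - u) + (1 - a)).
  apply: le_trans H _; apply: ler_pM => //; exact: cmod_ge0.
have h4 : cmod (1 - u) <= (1 - a) * ((1 + r) / (1 - r)).
  rewrite mulrA ler_pdivlMr; last by lra.
  by move: (cmod (1 - u)) (cmod (u - a%:C)) h2 h3 => X Y; nra.
rewrite vE -cmodN (_ : - (z * u - z) = z * (1 - u)); last by ring.
rewrite cmodM; apply: le_trans h4; rewrite ler_piMl ?cmod_ge0//; lra.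
Qed.

(** [rho] and [a0] are fixed before [v]: this uniformity allows a time interval to be cut into equal
    steps. *)
Lemma image_disc (r : R) : 0 < r < 1 -> exists rho a0 : R, [/\ r < rho, a0 < 1 &
  forall (v : C -> C) (a : R), hol 0 1 v -> (forall z, cmod z < 1 -> cmod (v z) <= 1) ->
  v 0 = 0 -> derive1 v 0 = a%:C -> 0 < a < 1 -> a0 < a ->
  forall w, cmod w < rho -> exists2 z, cmod z < 1 & v z = w].
Proof.
move=> r01; pose t := (1 - r) / 4; have t0 : 0 < t by rewrite /t; lra.
pose q := r + 2 * t; have q01 : 0 < q < 1 by rewrite /q /t; lra.
pose K := (1 + q) / (1 - q); have K0 : 0 < K by rewrite divr_gt0; lra.
(* On the disc of radius [q], [v] then moves points by at most [t / 4]. So [min_modulus] applies on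
   the circle of radius [t] about any [w] with modulus below [r + t], a circle that stays inside
   that disc. *)
exists (r + t), (1 - t / (4 * K)); split.
- by rewrite ltrDl.
- by rewrite ltrBlDr ltrDl; apply: divr_gt0 => //; apply: mulr_gt0.
move=> v a hv v1 v0 va a01 aa w wr.
have vz z : cmod z <= q -> cmod (v z - z) <= t / 4.
  move=> zq; apply: le_trans (near_id hv v1 v0 va a01 q01 zq) _; rewrite -/K.
  rewrite -ler_pdivlMr// -mulrA -invfM; lra.
have [|||z zt vzw] := @min_modulus _ v w w t (t / 2) t0.
- move=> z zt; apply: hv; rewrite subr0.
  by have := cmodD (z - w) w; rewrite subrK /q in q01 *; lra.
- by have := vz w; rewrite /q; lra.
- move=> z zt; have zq : cmod z <= q.
    by have := cmodD (z - w) w; rewrite subrK /q; lra.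
  have := vz z zq; have := cmod_dist (z - w) (z - v z).
  by rewrite zt (cmodB z (v z)) (_ : z - w - (z - v z) = v z - w); [lra|ring].
- by exists z => //; have := cmodD (z - w) w; rewrite subrK /q in q01 *; lra.
Qed.

End Transition.

(** * Density of the polynomials in a transition map *)

Section Density.
Variable R : realType.
Local Notation C := (Cplx R).

Lemma poly_bounded (p : {poly C}) (B : R) : exists2 M : R, 0 <= M &
  forall x, cmod x <= B -> cmod p.[x] <= M.
Proof.
elim/poly_ind: p => [|p c [M M0 hM]].
  by exists 0 => // x _; rewrite horner0 cmod0.
exists (M * `|B| + cmod c); first by rewrite addr_ge0 ?mulr_ge0 ?cmod_ge0.
move=> x xB; rewrite !hornerE (le_trans (cmodD _ _))// lerD2r cmodM.
by apply: ler_pM; rewrite ?cmod_ge0 ?hM// (le_trans xB)// ler_norm.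
Qed.

Lemma poly_lipschitz (p : {poly C}) (B : R) : exists2 K : R, 0 <= K &
  forall x y, cmod x <= B -> cmod y <= B -> cmod (p.[x] - p.[y]) <= K * cmod (x - y).
Proof.
elim/poly_ind: p => [|p c [K K0 hK]].
  by exists 0 => // x y _ _; rewrite !horner0 subrr cmod0 mul0r.
have [M M0 hM] := poly_bounded p B.
exists (K * `|B| + M); first by rewrite addr_ge0 ?mulr_ge0.
move=> x y xB yB; rewrite !hornerE.
have -> : p.[x] * x + c - (p.[y] * y + c) = (p.[x] - p.[y]) * x + p.[y] * (x - y) by ring.
rewrite (le_trans (cmodD _ _))// !cmodM mulrDl lerD ?ler_wpM2r ?cmod_ge0 ?hM//.
rewrite mulrAC; apply: ler_pM; rewrite ?cmod_ge0 ?hK//.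
by rewrite (le_trans xB)// ler_norm.
Qed.

Definition poly_dense (r : R) (u : C -> C) := forall h, hol 0 1 h -> forall e : R, 0 < e ->
  exists p : {poly C}, forall z, cmod z <= r -> cmod (h z - p.[u z]) <= e.

Lemma poly_dense_id r u : 0 < r < 1 -> (forall z, cmod z <= r -> u z = z) -> poly_dense r u.
Proof.
move=> /andP[r0 r1] uE h hh e e0; have [p hp] := poly_approx r0 r1 hh e0.
by exists p => z zr; rewrite uE// hp.
Qed.

Lemma schwarz_le (v : C -> C) : hol 0 1 v -> (forall z, cmod z < 1 -> cmod (v z) <= 1) ->
  v 0 = 0 -> forall z, cmod z < 1 -> cmod (v z) <= cmod z.
Proof.
move=> hv v1 v0 z z1; rewrite (dquotE v 0 z) v0 add0r subr0 cmodM.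
by rewrite ler_piMr ?cmod_ge0// (schwarz hv).
Qed.

(* [phi] is close to the identity, so that it has a holomorphic inverse on a disc of radius
   larger than [r], which is itself approximated by polynomials. *)
Lemma poly_dense_step r : 0 < r < 1 -> exists2 a0 : R, a0 < 1 &
  forall (u u' phi : C -> C) (a : R), hol 0 1 phi ->
    (forall x y, cmod x < 1 -> cmod y < 1 -> phi x = phi y -> x = y) ->
    (forall z, cmod z < 1 -> cmod (phi z) < 1) -> phi 0 = 0 -> derive1 phi 0 = a%:C ->
    0 < a < 1 -> a0 < a -> (forall z, cmod z <= r -> cmod (u z) <= r) ->
    (forall z, cmod z <= r -> u' z = phi (u z)) ->
    poly_dense r u -> poly_dense r u'.
Proof.
move=> r01; have [rho [a0 [rrho a01 H]]] := image_disc r01; exists a0 => //.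
move=> u u' phi a hphi phi_inj phi1 phi0 phia a1 aa ur u'E du h hh e e0.
have phi1' z : cmod z < 1 -> cmod (phi z) <= 1 by move=> /phi1/ltW.
have phi_surj := H phi a hphi phi1' phi0 phia a1 aa.
have hid : hol 0 rho (@id C) by move=> z _; exists 1; exact: der_id.
have [psi [psi1 psiK hpsi]] := transition hphi phi_inj hid phi_surj.
have [r0 r1] := andP r01.
have u1 z : cmod z <= r -> cmod (u z) < 1 by move=> /ur h'; exact: le_lt_trans r1.
have u'r z : cmod z <= r -> cmod (u' z) <= r.
  move=> zr; rewrite u'E//; apply: le_trans (ur z zr).
  by apply: schwarz_le => //; exact: u1.
have psiE z : cmod z <= r -> psi (u' z) = u z.
  move=> zr; have zrho : cmod (u' z) < rho by apply: le_lt_trans rrho; exact: u'r.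
  apply: phi_inj; [exact: psi1|exact: u1|].
  by rewrite psiK// u'E.
have e20 : 0 < e / 2 by rewrite divr_gt0.
have [p hp] := du h hh _ e20.
have [K K0 hK] := poly_lipschitz p (r + 1).
have K1 : 0 < K + 1 by rewrite ltr_wpDl.
(* The 1 keeps the values of [q] in the disc of radius [r + 1], where [K] is a Lipschitz constant of
   [p]. The approximant is then [p \Po q]: p(u) is close to h and q(u') to u. *)
have d0 : 0 < Num.min 1 (e / 2 / (K + 1)) by rewrite lt_min ltr01 divr_gt0.
have [q hq] := poly_approx r0 rrho hpsi d0.
exists (p \Po q) => z zr; rewrite horner_comp.
have D := hq _ (u'r z zr); rewrite psiE// le_min in D; case/andP: D => D1 D2.
have uz := ur z zr.
have qz : cmod q.[u' z] <= r + 1.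
  by have := cmodD (q.[u' z] - u z) (u z); rewrite subrK cmodB; lra.
rewrite -[h z](subrK p.[u z]) -addrA (le_trans (cmodD _ _))// (splitr e) lerD ?hp//.
apply: le_trans (hK _ _ _ qz) _; first by lra.
apply: (@le_trans _ _ (K * (e / 2 / (K + 1)))); first by rewrite ler_wpM2l.
rewrite mulrA ler_pdivrMr// mulrC ler_pM2l// lerDl; exact: ler01.
Qed.

End Density.

(** * Transition maps of the chain *)

Section LoewnerChain.
Variable R : realType.
Local Notation C := (Cplx R).
Variable ft : R -> C -> C.
Hypothesis chain : normalized_loewner_chain ft.

Lemma chain_facts s : 0 <= s -> [/\ hol 0 1 (ft s),
  forall x y, cmod x < 1 -> cmod y < 1 -> ft s x = ft s y -> x = y,
  ft s 0 = 0 & derive1 (ft s) 0 = (expR s)%:C].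
Proof.
case: chain => cu cS _ _ s0; have [h1 h2] := (hol_univ _).1 (cu s s0).
have [_ f0 f1] := cS s s0.
have e0 : (expR (- s))%:C != 0 :> C.
  by rewrite -cmod_gt0 cmod_realE normr_gt0 gt_eqF// expR_gt0.
have z1 : cmod (0 - 0 : C) < 1 by rewrite subr0 cmod0.
split => //.
  by apply: (mulfI e0); rewrite mulr0; exact: f0.
rewrite -(mulKf e0 (derive1 _ _)).
have -> : (expR (- s))%:C * derive1 (ft s) 0 = 1.
  by rewrite -f1; apply/esym/derE/derZ; apply: (hol_der h1).
by rewrite mulr1 expRN fmorphV invrK.
Qed.

Lemma chain_transition s t : 0 <= s -> s <= t -> exists phi : C -> C,
  [/\ hol 0 1 phi, forall x y, cmod x < 1 -> cmod y < 1 -> phi x = phi y -> x = y,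
      forall z, cmod z < 1 -> cmod (phi z) < 1,
      phi 0 = 0 /\ derive1 phi 0 = (expR (s - t))%:C &
      forall z, cmod z < 1 -> ft t (phi z) = ft s z].
Proof.
move=> s0 st; have t0 := le_trans s0 st.
have [hs si fs0 ds] := chain_facts s0; have [ht ti ft0 dt] := chain_facts t0.
have sub z : cmod z < 1 -> exists2 y, cmod y < 1 & ft t y = ft s z.
  move=> z1; have [_ _ im _] := chain; have [|y y1 fy] := im s t s0 st (ft s z).
    by exists z => //; rewrite unit_discE.
  by exists y => //; rewrite -unit_discE.
have [phi [phi1 phiK hphi]] := transition ht ti hs sub.
have z1 : cmod (0 : C) < 1 by rewrite cmod0.
have phi0 : phi 0 = 0 by apply: ti; rewrite ?phi1// phiK// fs0 ft0.
exists phi; split => //.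
  by move=> x y x1 y1 pxy; apply: si => //; rewrite -!phiK// pxy.
split => //.
have d1 : der phi 0 (derive1 phi 0) by apply: (hol_der hphi); rewrite subr0.
have d2 : der (ft t) (phi 0) (expR t)%:C.
  by rewrite phi0 -dt; apply: (hol_der ht); rewrite subr0.
have d3 : der (ft s) 0 (expR s)%:C by rewrite -ds; apply: (hol_der hs); rewrite subr0.
have d4 : der (ft s) 0 ((expR t)%:C * derive1 phi 0).
  apply: (@der_near _ _ _ _ _ 1) (der_comp d1 d2) => // w.
  by rewrite subr0 => w1; rewrite phiK.
have E := der_unique d3 d4.
have e0 : (expR t)%:C != 0 :> C.
  by rewrite -cmod_gt0 cmod_realE normr_gt0 gt_eqF// expR_gt0.
apply: (mulfI e0); rewrite -E -rmorphM /= -expRD; congr (expR _)%:C; ring.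
Qed.

Lemma chain_dense t v r : 0 <= t -> 0 < r < 1 -> (forall z, cmod z < 1 -> cmod (v z) < 1) ->
  (forall z, cmod z < 1 -> ft t (v z) = ft 0 z) -> poly_dense r v.
Proof.
move=> t0 r01 v1 vt; have [a0 a01 step] := poly_dense_step r01.
(* Each step has derivative exp(- t / N) at 0, which is at least 1 - t / N and hence exceeds
   [a0]. *)
have [N [N0 tN]] : exists N, (0 < N)%N /\ t / N%:R < 1 - a0.
  exists (Num.bound (t / (1 - a0))).+1; split => //.
  have b0 : 0 < 1 - a0 by rewrite subr_gt0.
  rewrite ltr_pdivrMr ?ltr0n// mulrC -ltr_pdivrMr//.
  apply: lt_trans (archi_boundP _) _; first by rewrite divr_ge0// ltW.
  by rewrite ltr_nat.
have N0' : 0 < N%:R :> R by rewrite ltr0n.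
have [r0 r1] := andP r01.
pose T k := t * (k%:R / N%:R).
have T0 k : 0 <= T k by rewrite /T mulr_ge0// divr_ge0.
have TS k : T k <= T k.+1.
  by rewrite /T ler_wpM2l// ler_pM2r ?invr_gt0// ler_nat.
have key k u : (forall z, cmod z < 1 -> cmod (u z) < 1) ->
    (forall z, cmod z < 1 -> ft (T k) (u z) = ft 0 z) -> poly_dense r u.
  elim: k u => [|k IH] u u1 uT.
    apply: poly_dense_id => // z zr; have z1 : cmod z < 1 by exact: le_lt_trans r1.
    have [_ ti _ _] := chain_facts (lexx (0 : R)).
    apply: ti; rewrite ?u1//; move: (uT z z1).
    by rewrite /T mul0r mulr0.
  have [u0 [h0 _ u01 [u00 _] u0E]] := chain_transition (lexx (0 : R)) (T0 k).
  have [phi [hphi phi_inj phi1 [phi0 phia] phiE]] := chain_transition (T0 k) (TS k).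
  (* For [t = 0] the transition map has derivative 1, which [step] excludes, but then all the times
     coincide. *)
  have [t00|tpos] := eqVneq t 0.
    apply: IH => // z z1; have := uT z z1; by rewrite /T t00 !mul0r.
  have Tlt : T k - T k.+1 = - (t / N%:R).
    rewrite /T -[in k.+1%:R]addn1 natrD; field; exact: lt0r_neq0.
  have tp : 0 < t / N%:R by rewrite divr_gt0// lt_def tpos.
  apply: (step u0 u phi _ hphi phi_inj phi1 phi0 phia).
  - by rewrite expR_gt0 expR_lt1 Tlt oppr_lt0.
  - rewrite Tlt; apply: lt_le_trans (expR_ge1Dx _); lra.
  - move=> z zr; apply: le_trans (zr); apply: schwarz_le => //.
      by move=> x /u01/ltW.
    exact: le_lt_trans r1.
  - move=> z zr; have z1 : cmod z < 1 by exact: le_lt_trans r1.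
    have [_ ti _ _] := chain_facts (T0 k.+1).
    by apply: ti; rewrite ?u1 ?phi1 ?u01// phiE ?u01// u0E// uT.
  - exact: IH.
apply: (key N) => // z z1.
by rewrite /T divff ?mulr1 ?vt// gt_eqF.
Qed.

End LoewnerChain.

(** * Square roots *)

Section SquareRoot.
Variable R : realType.
Local Notation C := (Cplx R).

Lemma hol_bounded (f : C -> C) (r : R) : hol 0 1 f -> 0 < r < 1 ->
  exists2 M : R, 0 <= M & forall z, cmod z <= r -> cmod (f z) <= M.
Proof.
move=> hf /andP[r0 r1]; have [s /andP[rs s1]] : exists s, r < s < 1 by exists ((r + 1) / 2); lra.
have s0 : 0 < s by exact: lt_trans rs.
have fd z : cmod z <= s -> exists d, der f z d.
  by move=> zs; apply: hf; rewrite subr0; exact: le_lt_trans s1.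
have [M hM] : circle_bounded s f.
  by apply: circle_bounded_der => // z zs; apply: fd; rewrite zs.
exists M; first by apply: le_trans (hM s%:C _); rewrite ?cmod_ge0// cmod_realE gtr0_norm.
by move=> z zr; apply: (max_modulus s0 fd hM); exact: le_lt_trans rs.
Qed.

Lemma sqrtc_Re_gt0 (x : C) : 0 < complex.Re x -> 0 < complex.Re (sqrtc x).
Proof.
case: x => a b /= a0; rewrite sqrtr_gt0 divr_gt0// ltr_wpDl// sqrtr_ge0.
Qed.

(** On the right half-plane principal roots have positive real part, so the denominator in sqrt y -
    sqrt x = (y - x)/(sqrt y + sqrt x) stays away from 0. *)
Lemma der_sqrtc (x : C) : 0 < complex.Re x -> exists d, der (@sqrtc R) x d.
Proof.
move=> x0; pose s := sqrtc x; have s0 : 0 < complex.Re s by exact: sqrtc_Re_gt0.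
pose c := complex.Re s.
have sc : c <= cmod s by rewrite (le_trans (ler_norm _))// cmod_Re.
have s0' : s != 0 by rewrite -cmod_gt0 (lt_le_trans s0).
exists (2 * s)^-1 => e e0.
exists (Num.min (complex.Re x) (e * (2 * c * c * c))).
  by rewrite lt_min x0/= !mulr_gt0.
move=> y; rewrite lt_min => /andP[yx ye].
have y0 : 0 < complex.Re y.
  have := cmod_Re (y - x); rewrite raddfB /=; move: (ler_norm (- (complex.Re y - complex.Re x))).
  rewrite normrN; lra.
pose t := sqrtc y; have t0 : 0 < complex.Re t by exact: sqrtc_Re_gt0.
have ts : c <= cmod (t + s).
  apply: (@le_trans _ _ (complex.Re (t + s))).
    by rewrite raddfD /= lerDr ltW.
  by rewrite (le_trans (ler_norm _))// cmod_Re.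
have ts0 : t + s != 0 by rewrite -cmod_gt0 (lt_le_trans s0).
have xE : x = s ^+ 2 by rewrite sqr_sqrtc.
have yE : y = t ^+ 2 by rewrite sqr_sqrtc.
rewrite -/s -/t.
have -> : t - s - (2 * s)^-1 * (y - x) = - (y - x) ^+ 2 / (2 * s * (t + s) ^+ 2).
  by rewrite yE xE; field; rewrite s0' ts0.
pose D := cmod (2 * s * (t + s) ^+ 2).
have cE : cmod (- (y - x) ^+ 2 / (2 * s * (t + s) ^+ 2)) = cmod (y - x) / D * cmod (y - x).
  by rewrite cmodM cmodN cmodV cmodX -/D; ring.
have DE : D = 2 * cmod s * (cmod (t + s) * cmod (t + s)).
  by rewrite /D !cmodM cmod_nat.
have c2 : c * c <= cmod (t + s) * cmod (t + s) by apply: ler_pM => //; exact: ltW.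
have Dc : 2 * c * c * c <= D.
  rewrite DE -(mulrA (2 * c)); apply: ler_pM => //; rewrite ?mulr_ge0 ?(ltW s0)//.
  by rewrite ler_pM2l.
have D0 : 0 < D by apply: lt_le_trans Dc; rewrite !mulr_gt0.
rewrite cE ler_wpM2r ?cmod_ge0// ler_pdivrMr// (le_trans (ltW ye))//.
by rewrite ler_pM2l.
Qed.

(** No logarithm is used: f(z) is the telescoping product of the ratios f(z (k+1)/N) / f(z k/N),
    which lie within 1 of 1 for large N, so each has a holomorphic principal root. *)
Lemma sqrt_on_disc (f : C -> C) (r : R) : hol 0 1 f -> (forall z, cmod z < 1 -> f z != 0) ->
  f 0 = 1 -> 0 < r < 1 ->
  exists h, [/\ hol 0 r h, h 0 = 1 & forall z, cmod z < r -> h z ^+ 2 = f z].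
Proof.
move=> hf fn0 f0 r01; have [r0 r1] := andP r01.
have [K K0 hK] := hol_bounded (hol_derive1 hf) r01.
have hfV : hol 0 1 (fun z => (f z)^-1).
  move=> z z1; have [d hd] := hf z z1; eexists; apply: derV hd.
  by apply: fn0; rewrite -[z]subr0.
have [B B0 hB] := hol_bounded hfV r01.
pose N := (Num.bound (K * B)).+1.
have N0 : 0 < N%:R :> R by rewrite ltr0n.
have KB : K * B / N%:R < 1.
  rewrite ltr_pdivrMr// mul1r; apply: lt_le_trans (archi_boundP _) _; first by rewrite mulr_ge0.
  by rewrite ler_nat.
pose q k : C := (k%:R / N%:R)%:C.
pose ratio k z := f (z * q k.+1) / f (z * q k).
have qle k : (k <= N)%N -> cmod (q k) <= 1.
  by move=> kN; rewrite cmod_realE ger0_norm ?divr_ge0// ler_pdivrMr// mul1r ler_nat.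
have zq z k : cmod z < r -> (k <= N)%N -> cmod (z * q k) < r.
  by move=> zr kN; apply: le_lt_trans zr; rewrite cmodM ler_piMr ?cmod_ge0// qle.
have hfr : hol 0 r f by apply: hol_sub hf; rewrite subrr cmod0 add0r ltW.
have ratio1 k z : (k < N)%N -> cmod z < r -> 0 < complex.Re (ratio k z).
  move=> kN zr; have h1 := zq z k.+1 zr kN; have h2 := zq z k zr (ltnW kN).
  have f20 : f (z * q k) != 0 by apply: fn0; exact: lt_trans r1.
  have : cmod (ratio k z - 1) < 1.
    have -> : ratio k z - 1 = (f (z * q k.+1) - f (z * q k)) * (f (z * q k))^-1.
      by rewrite /ratio; field.
    rewrite cmodM; apply: le_lt_trans KB.
    rewrite mulrAC; apply: ler_pM; rewrite ?cmod_ge0 ?hB ?(ltW h2)//.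
    apply: le_trans (mean_value hfr (M := K) _ _ _) _; rewrite ?subr0//.
      by move=> x; rewrite subr0 => /ltW; exact: hK.
    rewrite ler_wpM2l// -mulrBr cmodM /q -rmorphB /= cmod_realE.
    have -> : k.+1%:R / N%:R - k%:R / N%:R = N%:R^-1 :> R.
      by rewrite -mulrBl -natrB// subSn// subnn mul1r.
    by rewrite ger0_norm ?invr_ge0// ler_piMl ?invr_ge0// ltW// (lt_trans zr).
  have := cmod_Re (ratio k z - 1); rewrite raddfB /=.
  move: (ler_norm (- (complex.Re (ratio k z) - 1))); rewrite normrN; lra.
pose H n z : C := \prod_(k < n) sqrtc (ratio k z).
have hH n : (n <= N)%N -> hol 0 r (H n).
  elim: n => [_|n IH nN] z zr.
    exists 0; rewrite (_ : H 0 = fun=> 1); first exact: der_cst.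
    by apply/funext => x; rewrite /H big_ord0.
  have [d hd] := IH (ltnW nN) z zr; rewrite subr0 in zr.
  rewrite (_ : H n.+1 = fun x => H n x * sqrtc (ratio n x)); last first.
    by apply/funext => x; rewrite /H big_ord_recr.
  have [d2 hd2] := der_sqrtc (ratio1 n z nN zr).
  have dq k : (k <= N)%N -> exists d, der (fun x => f (x * q k)) z d.
    move=> kN; have [d3 hd3] : exists d, der f (z * q k) d by apply: hfr; rewrite subr0 zq.
    exists (d3 * (z * 0 + q k * 1)); apply: (der_comp (f := fun x => x * q k)) hd3.
    by apply: derM; [exact: der_id|exact: der_cst].
  have [d4 hd4] := dq n.+1 nN; have [d5 hd5] := dq n (ltnW nN).
  have f20 : f (z * q n) != 0 by apply: fn0; apply: lt_trans r1; apply: zq => //; exact: ltnW.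
  eexists; apply: derM; first exact: hd.
  apply: (der_comp (f := ratio n)) hd2; apply: derM; first exact: hd4.
  exact: derV hd5.
have HE n z : (n <= N)%N -> cmod z < r -> H n z ^+ 2 = f (z * q n).
  move=> + zr; elim: n => [_|n IH nN].
    by rewrite /H big_ord0 expr1n /q mul0r mulr0 f0.
  rewrite /H big_ord_recr /= exprMn -/(H n z) IH ?(ltnW nN)// sqr_sqrtc /ratio mulrC divfK//.
  by apply: fn0; apply: lt_trans r1; apply: zq => //; exact: ltnW.
exists (H N); split; first exact: hH.
  rewrite /H big1// => k _; rewrite /ratio !mul0r f0 divr1.
  exact: sqrtc1.
by move=> z zr; rewrite HE// /q divff ?gt_eqF// mulr1.
Qed.

(** The quotient of two roots has square 1, hence derivative 0. *)
Lemma sqrt_unique (r : R) (h1 h2 : C -> C) : 0 < r -> hol 0 r h1 -> hol 0 r h2 ->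
  (forall z, cmod z < r -> h1 z != 0) -> (forall z, cmod z < r -> h1 z ^+ 2 = h2 z ^+ 2) ->
  h1 0 = h2 0 -> forall z, cmod z < r -> h1 z = h2 z.
Proof.
move=> r0 hh1 hh2 h10 h12 h0.
pose q z := h2 z / h1 z.
have q2 z : cmod z < r -> q z ^+ 2 = 1.
  by move=> zr; rewrite /q expr_div_n h12// divff// -h12// expf_neq0// h10.
have hq : hol 0 r q.
  move=> z zr; have [d1 hd1] := hh1 z zr; have [d2 hd2] := hh2 z zr; rewrite subr0 in zr.
  by eexists; apply: derM; [exact: hd2|apply: derV hd1; exact: h10].
have q0 z : cmod (z - 0) < r -> derive1 q z = 0.
  move=> zr; have d := hol_der hq zr; rewrite subr0 in zr.
  have d2 : der (fun x => q x * q x) z 0.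
    apply: (@der_near _ (fun=> 1) _ _ _ (r - cmod z)); rewrite ?subr_gt0//; last exact: der_cst.
    move=> w wz; rewrite -expr2 q2//.
    by have := cmodD (w - z) z; rewrite subrK; lra.
  have := der_unique (derM d d) d2; rewrite -mulr2n => /eqP.
  rewrite mulrn_eq0 /= mulf_eq0 => /orP[/eqP qz|/eqP//].
  by have := q2 z zr; rewrite qz expr0n /= => /eqP; rewrite eq_sym oner_eq0.
have c0 : cmod (0 : C) < r by rewrite cmod0.
move=> z zr; have : q z = q 0 by apply: (der0_cst hq q0); rewrite subr0.
rewrite /q -h0 divff ?h10// => h.
by rewrite -[h2 z](divfK (h10 z zr)) h mul1r.
Qed.

Lemma sqrt_exists (f : C -> C) : hol 0 1 f -> (forall z, cmod z < 1 -> f z != 0) ->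
  f 0 = 1 ->
  exists h, [/\ hol 0 1 h, h 0 = 1 & forall z, cmod z < 1 -> h z ^+ 2 = f z].
Proof.
move=> hf fn0 f0.
pose P (r : R) (h : C -> C) := [/\ hol 0 r h, h 0 = 1 & forall z, cmod z < r -> h z ^+ 2 = f z].
have ex r : exists h, 0 < r < 1 -> P r h.
  have [r01|nr] := boolP (0 < r < 1); last by exists id.
  by have [h hh] := sqrt_on_disc hf fn0 f0 r01; exists h.
have [H HP] := choice ex.
have agree r s z : 0 < r < 1 -> 0 < s < 1 -> r <= s -> cmod z < r -> H r z = H s z.
  move=> r01 s01 rs zr; have [hr r1 rE] := HP r r01; have [hs s1 sE] := HP s s01.
  have rsub x : cmod x < r -> cmod x < 1 by case/andP: r01 => _ r1' xr; exact: lt_trans r1'.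
  have hsr : hol 0 r (H s) by apply: hol_sub hs; rewrite subrr cmod0 add0r.
  apply: (sqrt_unique _ hr hsr) => //; first by case/andP: r01.
  - move=> x xr; have := fn0 x (rsub x xr); rewrite -(rE x xr).
    by rewrite expf_eq0.
  - by move=> x xr; rewrite rE// sE// (lt_le_trans xr).
  - by rewrite r1 s1.
(* The roots on smaller discs agree by uniqueness, so the value at [z] may be read off any disc
   containing [z]; [rho z] is one such radius. *)
pose rho (z : C) : R := (cmod z + 1) / 2.
have rho01 z : cmod z < 1 -> 0 < rho z < 1 /\ cmod z < rho z.
  by move=> z1; have := cmod_ge0 z; rewrite /rho; split; lra.
pose h z := H (rho z) z.
have hE r z : 0 < r < 1 -> cmod z < r -> h z = H r z.
  move=> r01 zr; have z1 : cmod z < 1 by case/andP: r01 => _; exact: lt_trans.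
  have [rh zrh] := rho01 z z1; rewrite /h; have [rr|/ltW rr] := leP (rho z) r.
    exact: agree.
  by apply/esym; exact: agree.
have half : 0 < (1 / 2 : R) < 1 by lra.
exists h; split.
- move=> z; rewrite subr0 => z1; have [rh zrh] := rho01 z z1.
  have [hr _ _] := HP _ rh; have [|d hd] := hr z; first by rewrite subr0.
  exists d; apply: (@der_near _ _ _ _ _ (rho z - cmod z)) hd; first by rewrite subr_gt0.
  move=> w wz; apply/esym/hE => //.
  by have := cmodD (w - z) z; rewrite subrK; lra.
- rewrite (hE _ _ half); last by rewrite cmod0; lra.
  by case: (HP _ half).
- move=> z z1; have [rh zrh] := rho01 z z1; have [_ _ ->//] := HP _ rh.
Qed.

End SquareRoot.

(** * Functionals on the holomorphic maps of the ball *)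

Section CompactConvergence.
Variables (R : realType) (n : nat).
Local Notation C := (Cplx R).
Local Notation Cn := 'rV[C]_n.

Lemma rV_entourageP (E : set (Cn * Cn)) : entourage E <->
  exists2 r : R, 0 < r & forall x y : Cn, (forall j, cmod (x 0 j - y 0 j) < r) -> E (x, y).
Proof.
rewrite -entourage_ballE; split=> [[e /= e0 eE]|[r r0 rE]].
  have [r r0 er] := posCP e0; exists r => // x y xy; apply: eE => /=.
  split => // i j; rewrite !ord1 /ball /= er normC_ltP.
  exact: xy.
exists r%:C => /=; first by rewrite ltcR.
move=> [x y] [_ xy]; apply: rE => j; have := xy 0 j.
by rewrite /ball /= normC_ltP.
Qed.

Definition unif_close (K : set Cn) (r : R) (F G : Cn -> Cn) :=
  forall z, K z -> forall j, cmod (F z 0 j - G z 0 j) < r.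

Lemma close_nbhs (K : set Cn) (r : R) (F : compact_convergence R n) :
  compacts_of_ball K -> 0 < r -> nbhs F [set G | unif_close K r F G].
Proof.
move=> cK r0.
have := @fam_nbhs Cn Cn (@compacts_of_ball R n) K
  [set xy : Cn * Cn | forall j, cmod (xy.1 0 j - xy.2 0 j) < r] F _ cK.
by apply; apply/rV_entourageP; exists r.
Qed.

Lemma cvg_compactP (W : set_system (Cn -> Cn)) (F : Cn -> Cn) : Filter W ->
  (W --> (F : compact_convergence R n)) <->
  (forall K r, compacts_of_ball K -> 0 < r -> W [set G | unif_close K r F G]).
Proof.
move=> FW; split => [h K r cK r0|h].
  by apply: (h [set G | unif_close K r F G]); exact: close_nbhs.
apply/fam_cvgP => K cK P /uniform_nbhs[E [/rV_entourageP[r r0 rE] EP]].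
by apply: filterS (h K r cK r0) => G cG; apply: EP => y Ky; apply: rE; exact: cG.
Qed.

Lemma continuous_on_holoP (L : compact_convergence R n -> C) :
  {within (@holo_maps R n : set (compact_convergence R n)), continuous L} <->
  (forall F, holo_maps F -> L @ within (@holo_maps R n) (nbhs (F : compact_convergence R n)) --> L F).
Proof. exact: subspace_continuousP. Qed.

Lemma continuous_on_holo_approx (L : compact_convergence R n -> C) (F : Cn -> Cn) (k : C) :
  {within (@holo_maps R n : set (compact_convergence R n)), continuous L} ->
  holo_maps F ->
  (forall K r, compacts_of_ball K -> 0 < r -> exists G, [/\ holo_maps G, unif_close K r F G & L G = k]) ->
  L F = k.
Proof.
move=> /continuous_on_holoP Lc hF app.
pose W := filter_from [set Kr : set Cn * R | compacts_of_ball Kr.1 /\ 0 < Kr.2]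
  (fun Kr => [set G | [/\ holo_maps G, unif_close Kr.1 Kr.2 F G & L G = k]]).
have FW : Filter W.
  apply: filter_from_filter.
    by exists (set0, 1); split => //; split; [exact: compact0|].
  move=> [K r] [K' r'] /= [[cK sK] r0] [[cK' sK'] r'0].
  exists (K `|` K', Num.min r r') => /=.
    split; last by rewrite lt_min r0.
    split; first exact: compactU.
    by move=> z [/sK|/sK'].
  move=> G [hG cG LG]; split; split => // z Kz j.
    by have := cG z (or_introl Kz) j; rewrite lt_min => /andP[].
  by have := cG z (or_intror Kz) j; rewrite lt_min => /andP[].
have PW : ProperFilter W.
  by apply: filter_from_proper => -[K r] /= [cK r0]; have [G hG] := app K r cK r0; exists G.
have WF : W --> (F : compact_convergence R n).
  apply/cvg_compactP => K r cK r0.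
  by exists (K, r) => // G [].
have Wh : W (@holo_maps R n).
  exists (set0, 1) => /=; last by move=> G [].
  by split => //; split; [exact: compact0|].
have LW : L @ W --> L F.
  move=> A /(Lc F hF) /= hA; have : W [set G | holo_maps G -> A (L G)] by exact: WF.
  by apply: filter_app; apply: filterS Wh => G hG; apply.
apply/eqP/negPn/negP => neq.
have e0 : 0 < cmod (L F - k) by rewrite cmod_gt0 subr_eq0.
have /cvgCP/(_ _ e0) hW := LW.
have : W [set G | L G = k].
  exists (set0, 1) => /=; last by move=> G [].
  by split => //; split; [exact: compact0|].
move=> hk; have H : W ([set G | cmod (L G - L F) < cmod (L F - k)] `&` [set G | L G = k]).
  exact: filterI.
have [G [/= h1 h2]] := filter_ex H.
by move: h1; rewrite h2 cmodB ltxx.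
Qed.

Lemma continuous_functional_comp (L : compact_convergence R n -> C) (T : (Cn -> Cn) -> Cn -> Cn) :
  continuous_linear_functional L ->
  (forall F, holo_maps F -> holo_maps (T F)) ->
  (forall (a : C) F G, holo_maps F -> holo_maps G -> T (a *: F + G) = a *: T F + T G) ->
  (forall K r, compacts_of_ball K -> 0 < r -> exists K' r',
     [/\ compacts_of_ball K', 0 < r' & forall F G, unif_close K' r' F G -> unif_close K r (T F) (T G)]) ->
  continuous_linear_functional (L \o T : compact_convergence R n -> C).
Proof.
move=> [Ll Lc] Th Tl Tc; split => [a F G hF hG /=|].
  by rewrite Tl// Ll//; exact: Th.
apply/continuous_on_holoP => F hF; move/continuous_on_holoP: Lc => /(_ _ (Th F hF)) Lc.
have TW : T @ within (@holo_maps R n) (nbhs (F : compact_convergence R n)) -->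
    (T F : compact_convergence R n).
  apply/cvg_compactP => K r cK r0; have [K' [r' [cK' r'0 h]]] := Tc K r cK r0.
  have := close_nbhs F cK' r'0; apply: filterS => G cG _.
  exact: h.
move=> A /Lc hA.
have hT : nbhs (F : compact_convergence R n)
  (fun G => holo_maps G -> holo_maps (T G) -> A (L (T G))) by exact: (TW _ hA).
change (nbhs (F : compact_convergence R n) (fun G => holo_maps G -> A (L (T G)))).
by apply: filterS hT => G hTG hG; exact: hTG hG (Th G hG).
Qed.

End CompactConvergence.

(** * Maps of Roper-Suffridge form and composition with them *)

Section Shear.
Variables (R : realType) (n : nat).
Local Notation C := (Cplx R).
Local Notation Cn := 'rV[C]_n.+1.
Local Notation ball := (@unit_ball R n.+1).

(** Differentiability is local; this handles maps that are patched by 0 outside the ball. *)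
Lemma near_eq_differentiable (V W : normedModType C) (f g : V -> W) x :
  (\forall y \near x, f y = g y) -> differentiable f x -> differentiable g x.
Proof.
move=> fg df; have [dc dE] := (diff_locallyP _ _).1 df.
have fgx : f x = g x by exact: (nbhs_singleton fg).
have H : g \o shift x = cst (g x) + 'd f x +o_ 0 id.
  apply/eqaddoP => e e0; have := (eqaddoP _ _ _ _).1 dE e e0.
  have fg0 : \forall h \near (0 : V), f (h + x) = g (h + x).
    have := fg; rewrite (near_shift (0 : V)) /=.
    by apply: filterS => h; rewrite /= subr0.
  apply: filter_app; apply: filterS fg0 => h /= hE; rewrite -fgx.
  by rewrite /GRing.add /= /GRing.opp /= /shift /= hE.
apply/diff_locallyP; rewrite (diff_unique dc H); split; [exact: dc|exact: H].
Qed.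

Lemma unit_ballE (z : Cn) : ball z = is_true (\sum_j cmod (z 0 j) ^+ 2 < 1).
Proof.
rewrite /unit_ball /= -ltcR rmorph_sum /=; congr (is_true (_ < _)).
by apply: eq_bigr => j _; rewrite normE rmorphXn.
Qed.

Lemma unit_ball_coord (z : Cn) j : ball z -> cmod (z 0 j) < 1.
Proof.
rewrite unit_ballE (bigD1 j)//= => h.
have : 0 <= \sum_(i < n.+1 | i != j) cmod (z 0 i) ^+ 2 by apply: sumr_ge0 => i _; exact: sqr_ge0.
move=> h'; rewrite -(@expr_lt1 _ 2)// ?cmod_ge0//; lra.
Qed.

Lemma cmod_coord_continuous (c : C) (j : 'I_n.+1) : continuous (fun z : Cn => cmod (z 0 j - c)).
Proof.
move=> z; apply: (@continuous_comp _ _ _ (fun z : Cn => z 0 j) (fun x => cmod (x - c))).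
  exact: coord_continuous.
exact: cmod_dist_continuous.
Qed.

Lemma unit_ball_open (z : Cn) : ball z -> nbhs z ball.
Proof.
move=> bz; have cont : continuous (fun z : Cn => \sum_j cmod (z 0 j - 0) ^+ 2).
  rewrite (_ : index_enum _ = index_enum 'I_n.+1)//.
  elim: (index_enum _) => [|j s IH] x.
    rewrite (_ : (fun _ => _) = fun=> 0); first exact: cst_continuous.
    by apply/funext => y; rewrite big_nil.
  rewrite (_ : (fun _ => _) = fun y : Cn => cmod (y 0 j - 0) * cmod (y 0 j - 0) +
      \sum_(i <- s) cmod (y 0 i - 0) ^+ 2); last first.
    by apply/funext => y; rewrite big_cons expr2.
  have cj := @cmod_coord_continuous 0 j x.
  exact: (cvgD (cvgM cj cj) (IH x)).
have : open [set x : Cn | \sum_j cmod (x 0 j - 0) ^+ 2 < 1].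
  apply: (@open_comp _ _ (fun x : Cn => \sum_j cmod (x 0 j - 0) ^+ 2) [set y : R | y < 1]).
    by move=> x _; exact: cont.
  exact: open_lt.
rewrite openE => /(_ z) /=; rewrite /interior => h.
have E : ball = [set x : Cn | \sum_j cmod (x 0 j - 0) ^+ 2 < 1].
  apply/funext => x; rewrite unit_ballE /=; congr (is_true (_ < _)).
  by apply: eq_bigr => j _; rewrite subr0.
by rewrite E in bz *; exact: h.
Qed.

(** The common form of [Psi f], with [sigma] a root of the derivative of [f], and of the self-map V
    of the ball. Unlike [Psi], it is linear in its pair of arguments. *)
Definition shear (phi sigma : C -> C) : Cn -> Cn :=
  patch (fun=> 0) ball
    (fun z => \row_j if j == ord0 then phi (z 0 ord0) else z 0 j * sigma (z 0 ord0)).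

Lemma shear_in phi sigma z j : ball z -> shear phi sigma z 0 j =
  if j == ord0 then phi (z 0 ord0) else z 0 j * sigma (z 0 ord0).
Proof. by move=> bz; rewrite /shear /patch mem_set// mxE. Qed.

Lemma shear_out phi sigma z : ~ ball z -> shear phi sigma z = 0.
Proof. by move=> bz; rewrite /shear /patch memNset. Qed.

Lemma roper_suffridge_shear (f : C -> C) : roper_suffridge n f = shear f (sqrt_branch (derive1 f)).
Proof. by []. Qed.

Lemma eq_shear phi sigma phi' sigma' : (forall z, cmod z < 1 -> phi z = phi' z) ->
  (forall z, cmod z < 1 -> sigma z = sigma' z) -> shear phi sigma = shear phi' sigma'.
Proof.
move=> hp hs; apply/funext => z; have [bz|bz] := pselect (ball z); last by rewrite !shear_out.
apply/rowP => j; rewrite !shear_in//; have z0 := unit_ball_coord ord0 bz.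
by rewrite hp// hs.
Qed.

Lemma shear_linear (a : C) phi sigma phi' sigma' :
  shear (fun z => a * phi z + phi' z) (fun z => a * sigma z + sigma' z) =
  a *: shear phi sigma + shear phi' sigma'.
Proof.
apply/funext => z; rewrite [RHS](_ : _ = a *: shear phi sigma z + shear phi' sigma' z)//.
have [bz|bz] := pselect (ball z); last by rewrite !shear_out// scaler0 addr0.
apply/rowP => j; rewrite 2!mxE !shear_in//; case: eqP => // _.
by ring.
Qed.

Lemma differentiable_row (g : 'I_n.+1 -> Cn -> C) (z : Cn) :
  (forall j, differentiable (g j) z) -> differentiable (fun x : Cn => \row_j g j x : Cn) z.
Proof.
move=> dg; rewrite (_ : (fun _ => _) = \sum_(j < n.+1) (fun x : Cn => g j x *: (delta_mx 0 j : Cn))).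
  by apply: differentiable_sum => j; exact: differentiableZl.
apply/funext => x; rewrite fct_sumE; apply/rowP => j; rewrite mxE summxE (bigD1 j)//=.
rewrite big1 ?addr0 => [|i ij]; rewrite !mxE ?eqxx ?mulr1//.
by rewrite eq_sym (negPf ij) mulr0.
Qed.

Lemma holo_shear phi sigma : hol 0 1 phi -> hol 0 1 sigma -> holo_maps (shear phi sigma).
Proof.
move=> hp hs; split; last exact: shear_out.
move=> z bz; have z0 : cmod (z 0 ord0 - 0) < 1 by rewrite subr0 unit_ball_coord.
apply: (@near_eq_differentiable _ _ (fun z : Cn => \row_j
    if j == ord0 then phi (z 0 ord0) else z 0 j * sigma (z 0 ord0))).
  apply: filterS (unit_ball_open bz) => x bx.
  by rewrite /shear /patch mem_set.
have dc j : differentiable (fun x : Cn => x 0 j) z by exact: differentiable_coord.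
apply: (@differentiable_row (fun j x => if j == ord0 then phi (x 0 ord0) else x 0 j * sigma (x 0 ord0))) => j.
case: eqP => _.
  apply: (@differentiable_comp _ _ _ _ (fun x : Cn => x 0 ord0) phi) => //.
  by apply/differentiableCP; exact: hp.
apply: differentiableM => //.
apply: (@differentiable_comp _ _ _ _ (fun x : Cn => x 0 ord0) sigma) => //.
by apply/differentiableCP; exact: hs.
Qed.

Section Pullback.
Variables (E : C) (v tau : C -> C).
Hypothesis hv : hol 0 1 v.
Hypothesis htau : hol 0 1 tau.
Hypothesis v1 : forall z, cmod z < 1 -> cmod (v z) < 1.
Hypothesis tau1 : forall z, cmod z < 1 ->
  cmod (tau z) ^+ 2 * (1 - cmod z ^+ 2) <= 1 - cmod (v z) ^+ 2.

(** The coordinates other than the first contribute less than |tau|^2 (1 - |z_1|^2), which [tau1]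
    bounds by 1 - |v(z_1)|^2. Where tau vanishes, strictness comes from [v1] instead. *)
Lemma shear_ball z : ball z -> ball (shear v tau z).
Proof.
move=> bz; have z1 := unit_ball_coord ord0 bz.
have := bz; rewrite (unit_ballE z) (bigD1 ord0)//= => h.
rewrite (unit_ballE (shear v tau z)) (bigD1 ord0)//= shear_in// eqxx.
rewrite (eq_bigr (fun j => cmod (z 0 j) ^+ 2 * cmod (tau (z 0 ord0)) ^+ 2)); last first.
  by move=> j /negPf j0; rewrite shear_in// j0 cmodM exprMn.
rewrite -mulr_suml; set S := \sum_(_ | _) _ in h *; rewrite -ltrBrDl.
have [t0|t0] := eqVneq (cmod (tau (z 0 ord0))) 0.
  by rewrite t0 expr0n mulr0 subr_gt0 expr_lt1// ?cmod_ge0// v1.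
apply: lt_le_trans (tau1 z1); rewrite mulrC ltr_pM2l ?exprn_gt0 ?lt_def ?t0 ?cmod_ge0//.
lra.
Qed.

Definition pullback (H : Cn -> Cn) : Cn -> Cn :=
  patch (fun=> 0) ball (fun z => E *: H (shear v tau z)).

Lemma pullback_in H z : ball z -> pullback H z = E *: H (shear v tau z).
Proof. by move=> bz; rewrite /pullback /patch mem_set. Qed.

Lemma pullback_out H z : ~ ball z -> pullback H z = 0.
Proof. by move=> bz; rewrite /pullback /patch memNset. Qed.

Lemma pullback_shear phi sigma : pullback (shear phi sigma) =
  shear (fun z => E * phi (v z)) (fun z => E * (tau z * sigma (v z))).
Proof.
apply/funext => z; have [bz|bz] := pselect (ball z); last first.
  by rewrite pullback_out// shear_out.
apply/rowP => j; have bv := shear_ball bz.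
rewrite pullback_in// mxE !shear_in//= ?eqxx; case: eqP => // _.
by ring.
Qed.

Lemma pullback_linear (a : C) F G : pullback (a *: F + G) = a *: pullback F + pullback G.
Proof.
apply/funext => z; rewrite [RHS](_ : _ = a *: pullback F z + pullback G z)//.
have [bz|bz] := pselect (ball z); last by rewrite !pullback_out// scaler0 addr0.
rewrite !pullback_in// [X in E *: X](_ : _ = a *: F (shear v tau z) + G (shear v tau z))//.
by rewrite scalerDr !scalerA mulrC.
Qed.

Lemma holo_pullback H : holo_maps H -> holo_maps (pullback H).
Proof.
move=> [hH _]; split; last exact: pullback_out.
move=> z bz; apply: (@near_eq_differentiable _ _ (E \*: (H \o shear v tau))).
  apply: filterS (unit_ball_open bz) => x bx.
  by rewrite pullback_in.
apply: differentiableZ; apply: differentiable_comp.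
  by case: (holo_shear hv htau) => + _; apply.
by apply: hH; exact: shear_ball.
Qed.

Lemma pullback_close (K : set Cn) (r : R) : compacts_of_ball K -> 0 < r ->
  exists (K' : set Cn) (r' : R),
  [/\ compacts_of_ball K', 0 < r' & forall F G : Cn -> Cn, unif_close K' r' F G ->
    unif_close K r (pullback F) (pullback G)].
Proof.
move=> [cK Kb] r0; exists (shear v tau @` K), (r / (cmod E + 1)).
have E1 : 0 < cmod E + 1 by rewrite ltr_wpDl ?cmod_ge0.
split; [split|by rewrite divr_gt0|].
- apply: continuous_compact => //; apply: continuous_in_subspaceT => z; rewrite inE => Kz.
  apply: differentiable_continuous.
  by case: (holo_shear hv htau) => + _; apply; exact: Kb.
- by move=> _ [z Kz <-]; apply: shear_ball; exact: Kb.
move=> F G FG z Kz j; rewrite !pullback_in//; [|exact: Kb..].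
rewrite !mxE -mulrBr cmodM; have := FG (shear v tau z) (ex_intro2 _ _ z Kz erefl) j.
rewrite ltr_pdivlMr//; apply: le_lt_trans.
by rewrite mulrC ler_wpM2l ?cmod_ge0// lerDl.
Qed.

End Pullback.

(** This reduces uniform estimates on [K] to estimates on a disc for functions of the first
    coordinate. *)
Lemma compact_in_ball (K : set Cn) : compacts_of_ball K -> exists2 r : R, 0 < r < 1 &
  forall z : Cn, K z -> cmod (z 0 ord0) <= r.
Proof.
move=> [cK Kb]; have [[z Kz]|nK] := pselect (K !=set0); last first.
  by exists (1 / 2); [lra|move=> z Kz; exfalso; apply: nK; exists z].
have [c cKc hc] := @compact_EVT_max _ R (fun z : Cn => cmod (z 0 ord0 - 0)) K
  (ex_intro _ z Kz) cK (continuous_subspaceT (@cmod_coord_continuous 0 ord0)).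
rewrite inE in cKc; have c1 := unit_ball_coord ord0 (Kb c cKc).
have c0 := cmod_ge0 (c 0 ord0).
exists ((cmod (c 0 ord0) + 1) / 2); first lra.
move=> x Kx; have := hc x; rewrite inE => /(_ Kx); rewrite !subr0; lra.
Qed.

End Shear.

(** * The Roper-Suffridge operator and support points *)

Section ClassS.
Variable R : realType.
Local Notation C := (Cplx R).

Lemma class_SP (f : C -> C) : class_S f <-> [/\ hol 0 1 f,
  forall x y, cmod x < 1 -> cmod y < 1 -> f x = f y -> x = y, f 0 = 0 & derive1 f 0 = 1].
Proof.
split=> [[/hol_univ[h1 h2] f0 f1]|[h1 h2 f0 f1]]; first by split.
by split => //; apply/hol_univ.
Qed.

Lemma univ_derive1 (f : C -> C) : hol 0 1 f ->
  (forall x y, cmod x < 1 -> cmod y < 1 -> f x = f y -> x = y) ->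
  forall z, cmod z < 1 -> derive1 f z != 0.
Proof.
move=> hf fi z z1; have q0 : 0 < 1 - cmod z by rewrite subr_gt0.
have hz : hol z (1 - cmod z) f by apply: hol_sub hf; rewrite subr0 addrC subrK.
have in1 x : cmod (x - z) < 1 - cmod z -> cmod x < 1.
  by move=> h; have := cmodD (x - z) z; rewrite subrK; lra.
by apply: (inj_derive1 q0 hz) => x y /in1 x1 /in1 y1; apply: fi.
Qed.

Lemma sqrt_branchP (g : C -> C) : hol 0 1 g -> (forall z, cmod z < 1 -> g z != 0) ->
  g 0 = 1 -> [/\ hol 0 1 (sqrt_branch g), sqrt_branch g 0 = 1 &
    forall z, cmod z < 1 -> sqrt_branch g z ^+ 2 = g z].
Proof.
move=> hg gn0 g0; have [h [hh h0 hE]] := sqrt_exists hg gn0 g0.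
pose P := [set h : C -> C | [/\ holomorphic_on (@unit_disc R) h, h 0 = 1 &
  forall z, unit_disc z -> h z ^+ 2 = g z]].
have Ph : P h by split => //; [exact/hol_unit_disc|move=> z; rewrite unit_discE; exact: hE].
have [s1 s0 sE] : P (sqrt_branch g) by exact: (@getPex _ P (ex_intro _ h Ph)).
split => //; first exact/hol_unit_disc.
by move=> z z1; apply: sE; rewrite unit_discE.
Qed.

(** Frees later arguments from the branch chosen by [get]: any holomorphic root with value 1 at 0
    may be used. *)
Lemma roper_suffridge_eq n (f s : C -> C) : class_S f -> hol 0 1 s -> s 0 = 1 ->
  (forall z, cmod z < 1 -> s z ^+ 2 = derive1 f z) ->
  roper_suffridge n f = @shear R n f s.
Proof.
move=> /class_SP[hf fi f0 f1] hs s0 sE; rewrite roper_suffridge_shear.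
have d0 := univ_derive1 hf fi.
have [h1 h2 h3] := sqrt_branchP (hol_derive1 hf) d0 f1.
apply: eq_shear => // z z1; apply: (sqrt_unique ltr01 h1 hs) => //.
- by move=> x x1; have := d0 x x1; rewrite -h3// expf_eq0.
- by move=> x x1; rewrite h3// sE.
- by rewrite h2 s0.
Qed.

Lemma class_S_sqrt (f : C -> C) : class_S f -> exists s : C -> C,
  [/\ hol 0 1 s, s 0 = 1, forall z, cmod z < 1 -> s z ^+ 2 = derive1 f z &
      forall n, roper_suffridge n f = @shear R n f s].
Proof.
move=> fS; have /class_SP[hf fi f0 f1] := fS.
have [s [hs s0 sE]] := sqrt_exists (hol_derive1 hf) (univ_derive1 hf fi) f1.
by exists s; split => // n; exact: roper_suffridge_eq.
Qed.

Lemma eq_derive1 (f g : C -> C) : hol 0 1 f -> (forall z, cmod z < 1 -> f z = g z) ->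
  hol 0 1 g /\ forall z, cmod z < 1 -> derive1 g z = derive1 f z.
Proof.
move=> hf fg.
have D z : cmod z < 1 -> der g z (derive1 f z).
  move=> z1; apply: (@der_near _ f _ _ _ (1 - cmod z)); first by rewrite subr_gt0.
    move=> w wz; apply: fg; have := cmodD (w - z) z; rewrite subrK; lra.
  by apply: (hol_der hf); rewrite subr0.
split=> [z|z z1]; last exact: derE (D z z1).
by rewrite subr0 => z1; eexists; exact: D.
Qed.

Lemma eq_roper_suffridge n (f g : C -> C) : class_S f -> (forall z, cmod z < 1 -> f z = g z) ->
  class_S g /\ roper_suffridge n f = roper_suffridge n g.
Proof.
move=> fS fg; have /class_SP[hf fi f0 f1] := fS.
have [hg gE] := eq_derive1 hf fg.
have c0 : cmod (0 : C) < 1 by rewrite cmod0.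
have gS : class_S g.
  apply/class_SP; split; first exact: hg.
  - by move=> x y x1 y1; rewrite -(fg x x1) -(fg y y1); exact: fi.
  - by rewrite -(fg 0 c0).
  - by rewrite (gE 0 c0).
split; first exact: gS.
have [s [hs s0 sE ->]] := class_S_sqrt fS.
have sE' z : cmod z < 1 -> s z ^+ 2 = derive1 g z.
  by move=> z1; rewrite (sE z z1) (gE z z1).
have E : roper_suffridge n g = @shear R n g s by exact: (roper_suffridge_eq n gS hs s0 sE').
rewrite E.
by apply: eq_shear => z z1; [exact: fg|].
Qed.

End ClassS.

(** * Testing a functional on perturbations of the identity *)

Section Perturbation.
Variables (R : realType) (n : nat).
Local Notation C := (Cplx R).
Local Notation Psi := (@roper_suffridge R n).

Definition primitive (p : {poly C}) : {poly C} :=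
  \poly_(i < (size p).+1) (if i is j.+1 then p`_j / j.+1%:R else 0).

Lemma primitive_deriv p : (primitive p)^`() = p.
Proof.
apply/polyP => i; rewrite coef_deriv coef_poly ltnS.
case: ltnP => [ip|pi]; last by rewrite mul0rn nth_default.
by rewrite /= -(mulr_natr (_ / _)) divfK// pnatr_eq0.
Qed.

Lemma der_primitive p z : der (fun z => (primitive p).[z]) z p.[z].
Proof. by have := der_poly (primitive p) z; rewrite primitive_deriv. Qed.

Lemma primitive0 p : (primitive p).[0] = 0.
Proof. by rewrite horner_coef0 coef_poly. Qed.

Lemma hol_poly (p : {poly C}) c r : hol c r (fun z => p.[z]).
Proof. by move=> z _; exists p^`().[z]; exact: der_poly. Qed.

(** The primitive of (1 + p)^2, split into terms of degree 0, 1 and 2 in p, so that scaling p by e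
    yields a polynomial in e. *)
Definition square_primitive (p : {poly C}) : {poly C} :=
  'X + (2%:P * primitive p + primitive (p ^+ 2)).

Lemma der_square_primitive (p : {poly C}) z :
  der (fun z => (square_primitive p).[z]) z ((1 + p.[z]) ^+ 2).
Proof.
have dP2 := der_primitive (p ^+ 2) z; rewrite horner_exp in dP2.
have := derD (der_id z) (derD (derZ 2 (der_primitive p z)) dP2).
rewrite (_ : (fun _ => _) = fun z => (square_primitive p).[z]); last first.
  by apply/funext => x; rewrite /square_primitive hornerD hornerX hornerD hornerM hornerC.
by congr der; ring.
Qed.

Lemma square_primitive0 (p : {poly C}) : (square_primitive p).[0] = 0.
Proof.
by rewrite /square_primitive hornerD hornerX hornerD hornerM !primitive0 mulr0 !addr0.
Qed.

Lemma Re_quadratic0 (d : R) (a b : C) : 0 < d ->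
  (forall e : C, cmod e <= d -> complex.Re (e * a + e ^+ 2 * b) = 0) -> a = 0 /\ b = 0.
Proof.
move=> d0 h; pose s := d / 2; have s0 : 0 < s by rewrite divr_gt0.
(* The values s and -s determine the real parts of a and b, then i s the imaginary part of a, and s
   + i s, whose square is purely imaginary, that of b. *)
have c1 : cmod (s%:C : C) <= d by rewrite cmod_realE gtr0_norm// /s; lra.
have c2 : cmod (- s%:C : C) <= d by rewrite cmodN.
have c3 : cmod (Complex 0 s : C) <= d.
  by rewrite (le_trans (cmod_ReIm _))//= normr0 add0r gtr0_norm// /s; lra.
have c4 : cmod (Complex s s : C) <= d.
  by rewrite (le_trans (cmod_ReIm _))//= gtr0_norm// /s; lra.
have := h _ c1; have := h _ c2; have := h _ c3; have := h _ c4.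
rewrite !expr2; case: a b {h} => [a1 a2] [b1 b2] /= h4 h3 h2 h1.
have sn : s != 0 by rewrite gt_eqF.
have ss : s * s != 0 by rewrite mulf_neq0.
have b10 : b1 = 0 by apply: (mulfI ss); lra.
have a10 : a1 = 0 by apply: (mulfI sn); lra.
have a20 : a2 = 0.
  by apply: (mulfI sn); move: h3; rewrite b10; lra.
have b20 : b2 = 0.
  by apply: (mulfI ss); move: h4; rewrite b10 a10 a20; lra.
by rewrite a10 a20 b10 b20.
Qed.

Variable L : compact_convergence R n.+1 -> C.
Hypothesis L_lin : forall (a : C) F G, holo_maps F -> holo_maps G -> L (a *: F + G) = a * L F + L G.
Hypothesis L_cst : forall f g : C -> C, class_S f -> class_S g ->
  complex.Re (L (Psi f)) = complex.Re (L (Psi g)).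

(* The primitive of [(1 + e p)^2] is univalent for small [e], and its image under the
   Roper-Suffridge operator is polynomial in [e]. *)
Lemma L_poly (p : {poly C}) : p.[0] = 0 ->
  L (@shear R n (fun z => (square_primitive p).[z]) (fun z => 1 + p.[z])) =
  L (Psi id).
Proof.
move=> p0; pose P1 (z : C) := 2 * (primitive p).[z]; pose P2 := primitive (p ^+ 2).
have h0 (q : {poly C}) : hol 0 1 (fun z => q.[z]) by exact: hol_poly.
have hc (c : C) : hol 0 1 (fun=> c) by move=> z _; exists 0; exact: der_cst.
pose I0 := @shear R n (fun z : C => z) (fun=> 1).
pose A := @shear R n P1 (fun z => p.[z]).
pose B := @shear R n (fun z => P2.[z]) (fun=> 0).
have hid : hol 0 1 (@id C) by move=> z _; exists 1; exact: der_id.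
have hI : holo_maps I0 by apply: holo_shear.
have dP1' : hol 0 1 P1 by move=> z _; eexists; apply: derZ; exact: der_primitive.
have hA : holo_maps A by exact: holo_shear.
have hB : holo_maps B by apply: holo_shear.
pose H (e z : C) : C := z + (e * P1 z + e ^+ 2 * P2.[z]).
have HE e : @shear R n (H e) (fun z => 1 + e * p.[z]) = e *: A + (e ^+ 2 *: B + I0).
  rewrite /A /B /I0 -!shear_linear; apply: eq_shear => z _; last by ring.
  by rewrite /H; ring.
have holB e : holo_maps (e ^+ 2 *: B + I0).
  rewrite /B /I0 -shear_linear; apply: holo_shear => z z1; eexists.
    by apply: derD; [apply: derZ; exact: der_poly|exact: der_id].
  by apply: derD; [apply: derZ; exact: der_cst|exact: der_cst].
have LE e : L (@shear R n (H e) (fun z => 1 + e * p.[z])) =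
    e * L A + (e ^+ 2 * L B + L I0).
  by rewrite HE L_lin// L_lin.
have dP1 z : der P1 z (2 * p.[z]) by apply: derZ; exact: der_primitive.
have dP2 z : der (fun z => P2.[z]) z (p.[z] ^+ 2).
  by rewrite -horner_exp; exact: der_primitive.
have dd e z : der (H e) z ((1 + e * p.[z]) ^+ 2).
  have := derD (der_id z) (derD (derZ e (dP1 z)) (derZ (e ^+ 2) (dP2 z))).
  by congr der; ring.
have idS : class_S (@id C).
  by apply/class_SP; split => //; apply: derE; exact: der_id.
have idE : Psi id = I0.
  rewrite (roper_suffridge_eq n idS (hc 1))// => z _; rewrite expr1n.
  by apply/esym/derE; exact: der_id.
have [M M0 hM] := poly_bounded p 1.
have M1 : 0 < 2 * (2 * M + M ^+ 2 + 1).
  by have := sqr_ge0 M; lra.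
(* For |e| <= d the derivative of [H e] is within 1/2 of 1, as [near1_inj] demands. *)
pose d := Num.min 1 (2 * (2 * M + M ^+ 2 + 1))^-1.
have d0 : 0 < d by rewrite lt_min ltr01 invr_gt0.
have HS e : cmod e <= d -> class_S (H e) /\
    Psi (H e) = @shear R n (H e) (fun z => 1 + e * p.[z]).
  move=> ed.
  have e1 : cmod e <= 1 by apply: le_trans ed _; rewrite ge_min lexx.
  have e2 : cmod e * (2 * M + M ^+ 2) <= 1 / 2.
    have : cmod e * (2 * (2 * M + M ^+ 2 + 1)) <= 1.
      by rewrite -ler_pdivlMr// mul1r (le_trans ed)// ge_min lexx orbT.
    by have := cmod_ge0 e; lra.
  have S : class_S (H e).
    apply/class_SP; split.
    - by move=> z _; eexists; exact: dd.
    - have hH : hol 0 1 (H e) by move=> z _; eexists; exact: dd.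
      move=> x y x1 y1; apply: (near1_inj hH); rewrite ?subr0// => z.
      rewrite subr0 => z1; rewrite (derE (dd e z)).
      have -> : (1 + e * p.[z]) ^+ 2 - 1 = e * (2 * p.[z] + e * p.[z] ^+ 2) by ring.
      rewrite cmodM; apply: le_trans e2; rewrite ler_wpM2l ?cmod_ge0//.
      rewrite (le_trans (cmodD _ _))// lerD//.
        by rewrite cmodM cmod_nat ler_pM2l// hM// ltW.
      rewrite cmodM -[leRHS]mul1r; apply: ler_pM; rewrite ?cmod_ge0// cmodX.
      by apply: lerXn2r; rewrite ?nnegrE ?cmod_ge0// hM// ltW.
    - by rewrite /H /P1 !primitive0 !(mulr0, addr0).
    - by rewrite (derE (dd e 0)) p0 mulr0 addr0 expr1n.
  split => //; apply: roper_suffridge_eq => //.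
  - move=> z _; eexists; apply: derD; [exact: der_cst|apply: derZ; exact: der_poly].
  - by rewrite p0 mulr0 addr0.
  - by move=> z z1; rewrite (derE (dd e z)).
have [a0 b0] : L A = 0 /\ L B = 0.
  apply: (Re_quadratic0 d0) => e ed; have [S E] := HS e ed.
  have := L_cst S idS; rewrite E idE LE addrA raddfD /= => /eqP.
  by rewrite -subr_eq0 addrK => /eqP.
(* [LE] is an algebraic identity, valid for every [e]; univalence was needed only to find that [L A]
   and [L B] vanish. *)
have := LE 1; rewrite a0 b0 !mulr0 !add0r idE => <-; congr L.
apply: eq_shear => z _; last by rewrite mul1r.
by rewrite /H /P1 hornerD hornerX hornerD hornerM hornerC expr1n !mul1r.
Qed.

End Perturbation.

Section SupportPoints.
Variable R : realType.
Local Notation C := (Cplx R).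

(** With 1 + p(v) close to s/sg, the derivative s^2 - sg^2 (1 + p(v))^2 of the difference of the
    functions factors, and one factor is the small difference of the roots. The mean value
    inequality then controls the functions. *)
Lemma square_approx (E : C) (h s sg v : C -> C) (r0 e : R) :
  hol 0 1 h -> hol 0 1 s -> hol 0 1 sg -> hol 0 1 v ->
  (forall z, cmod z < 1 -> s z ^+ 2 = derive1 h z) ->
  (forall z, cmod z < 1 -> sg z ^+ 2 = E * derive1 v z) ->
  (forall z, cmod z < 1 -> sg z != 0) ->
  h 0 = 0 -> s 0 = 1 -> sg 0 = 1 -> v 0 = 0 ->
  0 < r0 < 1 -> (forall r, 0 < r < 1 -> poly_dense r v) -> 0 < e ->
  exists2 p : {poly C}, p.[0] = 0 & forall z, cmod z <= r0 ->
    cmod (h z - E * (square_primitive p).[v z]) < e /\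
    cmod (s z - sg z * (1 + p.[v z])) < e.
Proof.
move=> hh hs hsg hv sE sgE sgn0 h0 s0 sg0 v0 r01 dense e0.
have [r [rr0 r01']] : exists r, r0 < r /\ 0 < r < 1 by exists ((r0 + 1) / 2); split; lra.
have [r_gt0 r1] := andP r01'.
have [Ms Ms0 hMs] := hol_bounded hs r01'.
have [Mg Mg0 hMg] := hol_bounded hsg r01'.
pose k z := s z / sg z.
have hk : hol 0 1 k.
  move=> z z1; have [d1 hd1] := hs z z1; have [d2 hd2] := hsg z z1; rewrite subr0 in z1.
  by eexists; apply: derM; [exact: hd1|apply: derV hd2; exact: sgn0].
(* [eta] times the first summand bounds the derivative of [D], and [eta] times the second the error
   of the roots. *)
pose cst := 2 * Mg * (2 * Ms + 2 * Mg) + 2 * Mg + 1.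
have cst0 : 0 < cst by rewrite ltr_wpDl// addr_ge0// mulr_ge0// ?addr_ge0// mulr_ge0.
pose eta := Num.min 1 (e / (2 * cst)).
have eta0 : 0 < eta by rewrite lt_min ltr01 divr_gt0// mulr_gt0.
have eta1 : eta <= 1 by rewrite ge_min lexx.
have etae : eta * cst < e.
  apply: (@le_lt_trans _ _ (e / 2)); last by rewrite ltr_pdivrMr// mulr_natr mulr2n ltrDl.
  have : eta <= e / (2 * cst) by rewrite ge_min lexx orbT.
  rewrite ler_pdivlMr ?mulr_gt0//; lra.
have [q hq] := dense r r01' k hk eta eta0.
(* Since k(0) = 1, the value of [q] at 0 is within [eta] of 1; normalizing it to exactly 1 doubles
   the error. *)
pose p := q - (q.[0])%:P.
have pE z : p.[z] = q.[z] - q.[0] by rewrite /p hornerD hornerN hornerC.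
have p0 : p.[0] = 0 by rewrite pE subrr.
have kp z : cmod z <= r -> cmod (k z - (1 + p.[v z])) <= 2 * eta.
  move=> zr; have h1 := hq z zr.
  have := hq 0; rewrite cmod0 v0 {1}/k s0 sg0 divr1 => /(_ (ltW r_gt0)) h2.
  rewrite pE (_ : k z - _ = (k z - q.[v z]) - (1 - q.[0])); last by ring.
  by rewrite (le_trans (cmodBD _ _))// mulrC mulr_natr mulr2n lerD.
have sp z : cmod z <= r -> cmod (s z - sg z * (1 + p.[v z])) <= Mg * (2 * eta).
  move=> zr; have z1 : cmod z < 1 by exact: le_lt_trans r1.
  have -> : s z - sg z * (1 + p.[v z]) = sg z * (k z - (1 + p.[v z])).
    by rewrite /k mulrBr; congr (_ - _); rewrite mulrC divfK// sgn0.
  by rewrite cmodM; apply: ler_pM; rewrite ?cmod_ge0 ?hMg ?kp.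
pose D z := h z - E * (square_primitive p).[v z].
have dD z : cmod z < 1 -> der D z
    ((s z - sg z * (1 + p.[v z])) * (s z + sg z * (1 + p.[v z]))).
  move=> z1; have z1' : cmod (z - 0) < 1 by rewrite subr0.
  have := derB (hol_der hh z1') (derZ E (der_comp (hol_der hv z1')
    (der_square_primitive p (v z)))).
  have swap (a b c : C) : a * (b * c) = (a * c) * b by ring.
  by congr der; rewrite -(sE z z1) swap -(sgE z z1); ring.
have hD : hol 0 r D.
  by move=> z; rewrite subr0 => zr; eexists; apply: dD; exact: lt_trans r1.
pose B := Mg * (2 * eta) * (2 * Ms + 2 * Mg).
have DB z : cmod (z - 0) < r -> cmod (derive1 D z) <= B.
  rewrite subr0 => zr; have zr' := ltW zr; rewrite (derE (dD z (lt_trans zr r1))) cmodM.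
  apply: ler_pM; rewrite ?cmod_ge0 ?sp//.
  have -> : s z + sg z * (1 + p.[v z]) = 2 * s z - (s z - sg z * (1 + p.[v z])) by ring.
  rewrite (le_trans (cmodBD _ _))// lerD//.
    by rewrite cmodM cmod_nat ler_pM2l// hMs.
  apply: le_trans (sp z zr') _; rewrite mulrCA ler_pM2l// ler_piMr//.
have B0 : 0 <= B by rewrite !mulr_ge0 ?addr_ge0 ?mulr_ge0 ?(ltW eta0).
exists p => // z zr0; have zr : cmod z < r by exact: le_lt_trans rr0.
have z1 : cmod z < 1 by exact: lt_trans r1.
split.
  have c0 : cmod (0 - 0 : C) < r by rewrite subr0 cmod0.
  have := mean_value hD DB (_ : cmod (z - 0) < r) c0.
  rewrite subr0 => /(_ zr); rewrite {2}/D v0 square_primitive0 h0 mulr0 !subr0 -/(D z) => H.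
  apply: le_lt_trans etae; apply: le_trans H _.
  apply: (@le_trans _ _ B); first by rewrite ler_piMr// ltW.
  have -> : B = eta * (2 * Mg * (2 * Ms + 2 * Mg)) by rewrite /B; ring.
  rewrite ler_pM2l// /cst -addrA lerDl addr_ge0// mulr_ge0//.
apply: le_lt_trans etae; apply: le_trans (sp z (ltW zr)) _.
have -> : Mg * (2 * eta) = eta * (2 * Mg) by ring.
rewrite ler_pM2l// /cst addrAC lerDr addr_ge0// !mulr_ge0// addr_ge0// mulr_ge0//.
Qed.

End SupportPoints.

(** * The pulled back functional *)

Section SubordinationPullback.
Variables (R : realType) (n : nat).
Local Notation C := (Cplx R).
Local Notation Psi := (@roper_suffridge R n).
Variables (E : R) (v sg : C -> C).
Hypothesis E1 : 1 <= E.
Hypothesis hv : hol 0 1 v.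
Hypothesis v_inj : forall x y, cmod x < 1 -> cmod y < 1 -> v x = v y -> x = y.
Hypothesis v1 : forall z, cmod z < 1 -> cmod (v z) < 1.
Hypothesis v0 : v 0 = 0.
Hypothesis dv0 : derive1 v 0 = (E^-1)%:C.
Hypothesis hsg : hol 0 1 sg.
Hypothesis sg0 : sg 0 = 1.
Hypothesis sgE : forall z, cmod z < 1 -> sg z ^+ 2 = E%:C * derive1 v z.

(** The factor 1/E makes |tau|^2 = |v'|/E <= |v'|, so that Schwarz-Pick applies, and it cancels in E
    tau s(v) = sg s(v), a root of the derivative of E h(v). *)
Let tau (z : C) : C := E%:C^-1 * sg z.
Let T := pullback E%:C v tau : ('rV[C]_n.+1 -> 'rV[C]_n.+1) -> _.

Lemma factor_gt0 : 0 < E.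
Proof. exact: lt_le_trans E1. Qed.

Lemma factor_neq0 : E%:C != 0 :> C.
Proof. by rewrite -cmod_gt0 cmod_realE normr_gt0 gt_eqF// factor_gt0. Qed.

Lemma sg_neq0 z : cmod z < 1 -> sg z != 0.
Proof.
move=> z1; have : sg z ^+ 2 != 0.
  by rewrite (sgE z1) mulf_neq0 ?factor_neq0// (univ_derive1 hv).
by rewrite expf_eq0.
Qed.

Lemma holo_tau : hol 0 1 tau.
Proof. by move=> z z1; have [d hd] := hsg z1; eexists; exact: derZ hd. Qed.

Lemma tau_bound z : cmod z < 1 -> cmod (tau z) ^+ 2 * (1 - cmod z ^+ 2) <= 1 - cmod (v z) ^+ 2.
Proof.
move=> z1; apply: le_trans (schwarz_pick hv v1 z1).
rewrite ler_wpM2r//; first by rewrite subr_ge0 ltW// expr_lt1// cmod_ge0.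
rewrite -cmodX /tau exprMn (sgE z1) expr2 -!mulrA mulKf ?factor_neq0//.
rewrite cmodM cmodV cmod_realE ger0_norm ?(ltW factor_gt0)// ler_piMl ?cmod_ge0//.
by rewrite invf_le1// factor_gt0.
Qed.

Lemma pullback_Psi h : class_S h -> class_S (fun z => E%:C * h (v z)) /\
  T (Psi h) = Psi (fun z => E%:C * h (v z)).
Proof.
move=> hS; have /class_SP[hh hi h0 h1] := hS.
have [s [hs s0 sE rsE]] := class_S_sqrt hS.
have dk z : cmod z < 1 -> der (fun z => E%:C * h (v z)) z (E%:C * (derive1 h (v z) * derive1 v z)).
  move=> z1; apply: derZ; apply: der_comp; first by apply: (hol_der hv); rewrite subr0.
  by apply: (hol_der hh); rewrite subr0 v1.
have c0 : cmod (0 : C) < 1 by rewrite cmod0.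
have kS : class_S (fun z => E%:C * h (v z)).
  apply/class_SP; split.
  - by move=> z; rewrite subr0 => z1; eexists; exact: dk.
  - move=> x y x1 y1 /(mulfI factor_neq0) hxy; apply: v_inj => //.
    by apply: hi => //; exact: v1.
  - by rewrite v0 h0 mulr0.
  - rewrite (derE (dk 0 c0)) v0 h1 mul1r dv0 -rmorphM /= divff//.
    by rewrite gt_eqF// factor_gt0.
split; first exact: kS.
have hsv : hol 0 1 (fun z => sg z * s (v z)).
  move=> z zr; have [d hd] := hsg zr; rewrite subr0 in zr.
  eexists; apply: derM; first exact: hd.
  apply: der_comp; first by apply: (hol_der hv); rewrite subr0.
  by apply: (hol_der hs); rewrite subr0 v1.
have sv0 : sg 0 * s (v 0) = 1 by rewrite v0 sg0 s0 mulr1.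
have svE z : cmod z < 1 -> (sg z * s (v z)) ^+ 2 = derive1 (fun z => E%:C * h (v z) : C) z.
  move=> z1; rewrite exprMn (sgE z1) (sE _ (v1 z1)) (derE (dk z z1)).
  by rewrite mulrAC mulrA.
rewrite (roper_suffridge_eq n kS hsv sv0 svE) rsE /T (@pullback_shear R n E%:C v tau v1 tau_bound).
apply: eq_shear => z _; first by [].
by rewrite /tau !mulrA mulfV ?mul1r ?factor_neq0.
Qed.

Variable L : compact_convergence R n.+1 -> C.
Hypothesis L_clf : continuous_linear_functional L.

Lemma functional_pullback : continuous_linear_functional (L \o T : compact_convergence R n.+1 -> C).
Proof.
apply: continuous_functional_comp => //.
- by move=> F; apply: holo_pullback => //; [exact: holo_tau|exact: tau_bound].
- by move=> a F G _ _; exact: pullback_linear.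
- by move=> K r; apply: pullback_close => //; [exact: holo_tau|exact: tau_bound].
Qed.

Hypothesis v_dense : forall r, 0 < r < 1 -> poly_dense r v.

(** [L_poly] for [L \o T] shows that [L] has the same value at all the approximants [T (shear ...)].
    Continuity carries this value over to [Psi h], whatever [h] is. *)
Lemma pullback_cst :
  (forall f g : C -> C, class_S f -> class_S g ->
     complex.Re ((L \o T) (Psi f)) = complex.Re ((L \o T) (Psi g))) ->
  forall h, class_S h -> L (Psi h) = L (T (Psi id)).
Proof.
move=> cst h hS; have /class_SP[hh hi h0 h1] := hS.
have [s [hs s0 sE rsE]] := class_S_sqrt hS.
have [L_lin L_cont] := L_clf; have [T_lin _] := functional_pullback.
apply: (continuous_on_holo_approx L_cont); first by rewrite rsE; exact: holo_shear.
move=> K r Kb r0; have [r1 r1' Kr] := compact_in_ball Kb.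
have [p p0 hp] := square_approx hh hs hsg hv sE sgE sg_neq0 h0 s0 sg0 v0 r1' v_dense r0.
have hG : holo_maps (@shear R n (fun z => (square_primitive p).[z]) (fun z => 1 + p.[z])).
  apply: holo_shear; first exact: hol_poly.
  move=> z _; eexists; apply: derD; [exact: der_cst|exact: der_poly].
exists (T (@shear R n (fun z => (square_primitive p).[z]) (fun z => 1 + p.[z]))); split.
- by apply: holo_pullback => //; [exact: holo_tau|exact: tau_bound].
- move=> z Kz j; have bz : unit_ball z by case: Kb => _; apply.
  rewrite rsE /T (@pullback_shear R n E%:C v tau v1 tau_bound) !shear_in//.
  have [hp1 hp2] := hp _ (Kr z Kz); case: eqP => // _.
  (* In the coordinates other than the first, the error of the roots is multiplied by a coordinate
     of modulus less than 1. *)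
  rewrite /tau -mulrA mulVKf ?factor_neq0// -mulrBr cmodM; apply: le_lt_trans hp2.
  by rewrite ler_piMl ?cmod_ge0// ltW// unit_ball_coord.
- exact: (L_poly T_lin cst p0).
Qed.

End SubordinationPullback.

Theorem theorem2p8p4 (R : realType) (n : nat) (hn : (2 <= n.+1)%N)
    (f : Cplx R -> Cplx R) (hf : class_S f)
    (F : 'rV[Cplx R]_n.+1 -> 'rV[Cplx R]_n.+1) (hF : F = roper_suffridge n f)
    (ft : R -> Cplx R -> Cplx R) (hft : normalized_loewner_chain ft)
    (hf0 : forall z, @unit_disc R z -> ft 0 z = f z)
    (Ft : R -> 'rV[Cplx R]_n.+1 -> 'rV[Cplx R]_n.+1)
    (hFt : forall t, 0 <= t ->
       Ft t = (expR t)%:C *: roper_suffridge n ((expR (- t))%:C *: ft t)) :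
  support_point (roper_suffridge n @` @class_S R) F ->
  forall t, 0 <= t ->
    support_point (roper_suffridge n @` @class_S R) ((expR (- t))%:C *: Ft t).
Proof.
move=> [_ [L [L_clf [_ [_ [[f1 f1S <-] [f2 f2S <-] neq]]] maxL]]] t t0.
pose g : Cplx R -> Cplx R := (expR (- t))%:C *: ft t.
have scale (G : 'rV[Cplx R]_n.+1 -> 'rV[Cplx R]_n.+1) :
    (expR (- t))%:C *: ((expR t)%:C *: G) = G.
  apply/funext => z; change ((expR (- t))%:C *: ((expR t)%:C *: G z) = G z).
  by rewrite scalerA -rmorphM /= -expRD addNr expR0 scale1r.
rewrite (hFt t t0) scale.
have gS : class_S g by case: hft => _ /(_ t t0).
have [v [hv v_inj v1 [v0 dv] vE]] := chain_transition hft (lexx 0) t0.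
rewrite sub0r expRN in dv.
pose E := expR t; have E1 : 1 <= E by rewrite leNgt expR_lt1 -leNgt.
have E0 : E%:C != 0 :> Cplx R := factor_neq0 E1.
have hv' : hol 0 1 (fun z => E%:C * derive1 v z).
  by move=> z /(hol_derive1 hv)[d hd]; eexists; exact: derZ hd.
have v'0 z : cmod z < 1 -> E%:C * derive1 v z != 0.
  by move=> z1; apply: mulf_neq0; [exact: E0|exact: (univ_derive1 hv v_inj z1)].
have v'1 : E%:C * derive1 v 0 = 1 by rewrite dv -rmorphM /= (divff (lt0r_neq0 (expR_gt0 t))).
have [sg [hsg sg0 sgE]] := sqrt_exists hv' v'0 v'1.
have pull := pullback_Psi n E1 hv v_inj v1 v0 dv hsg sg0 sgE.
(* Thus [F] is the image of [Psi g] under the pullback, so that the value of [L] at [F] is that of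
   the new functional at [Psi g]. *)
have fE : roper_suffridge n f = roper_suffridge n (fun z => E%:C * g (v z)).
  suff fgv z : cmod z < 1 -> f z = E%:C * g (v z) by have [] := eq_roper_suffridge n hf fgv.
  move=> z1; have uz : unit_disc z by rewrite unit_discE.
  rewrite -(hf0 z uz) -(vE z z1).
  change (ft t (v z) = E%:C * ((expR (- t))%:C * ft t (v z))).
  by rewrite mulrA -rmorphM /= -expRD subrr expR0 mul1r.
split; first exact: (ex_intro2 _ _ g gS erefl).
exists (L \o pullback E%:C v (fun z => E%:C^-1 * sg z)); split.
- exact: (functional_pullback E1 hv v1 hsg sgE L_clf).
- apply: contrapT => cst.
  have {}cst (h k : Cplx R -> Cplx R) : class_S h -> class_S k ->
    complex.Re ((L \o pullback E%:C v (fun z => E%:C^-1 * sg z)) (roper_suffridge n h)) =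
    complex.Re ((L \o pullback E%:C v (fun z => E%:C^-1 * sg z)) (roper_suffridge n k)).
    move=> hS kS; apply: contrapT => hk; apply: cst.
    exists (roper_suffridge n h), (roper_suffridge n k).
    by split; [exact: (ex_intro2 _ _ h hS erefl)
      |exact: (ex_intro2 _ _ k kS erefl)|exact: hk].
  have v_dense r : 0 < r < 1 -> poly_dense r v.
    by move=> r01; exact: (chain_dense hft t0 r01 v1 vE).
  have LE := pullback_cst E1 hv v_inj v1 v0 hsg sg0 sgE L_clf v_dense cst.
  exact: (neq (congr1 (@complex.Re R) (etrans (LE f1 f1S) (esym (LE f2 f2S))))).
(* The pullback maps the image of [Psi] into itself, so the maximality of [F] bounds the new
   functional at every [Psi h]. *)
- move=> _ [h hS <-]; have [kS kE] := pull h hS; have [_ gE] := pull g gS.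
  have := maxL _ (ex_intro2 _ _ _ kS erefl); rewrite hF fE -kE -gE.
  exact.
Qed.
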